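(* Let $n\ge 1$ be an integer and $0<\delta<\pi$. As $|z|\to\infty$ in the sector $\Delta_\delta=\{z\in\mathbb{C}: |\arg z|<\pi-\delta\}$, one has the asymptotic expansion $$\log G_n(z+1)\sim \left\{\binom{z+1}{n}+\sum_{r=1}^{n}\frac{B_r}{r!}\left(-\frac{d}{dz}\right)^{r-1}\binom{z}{n-1}\right\}\log(z+1)$$ $$-\sum_{r=1}^{n}\left\{\left(-\frac{d}{dz}\right)^{r-1}\binom{z}{n-1}\right\}\frac{1}{r!\,r}\left\{(z+1)^r-1\right\}-\sum_{j=0}^{n-1}G_{n,j}(z)\left\{\zeta'(-j)+\frac{1}{(j+1)^2}\right\}+\sum_{r=1}^{\infty}\frac{B_{2r}}{(2r)!}F_{n,2r-1}(z).$$ Here $\sim$ means: for every integer $M$ with $2M>n$, the difference between $\log G_n(z+1)$ and the right-hand side with the last (infinite) sum truncated to $1\le r\le M$ is $O(|z|^{n-2M-2})$ as $|z|\to\infty$ in $\Delta_\delta$.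
   Context: Multiple gamma functions (Vignéras). $(G_n)_{n\ge0}$ is the unique hierarchy of meromorphic functions on $\mathbb{C}$ such that $G_0(z)=z$ and, for $n\ge1$: $G_n(z+1)=G_{n-1}(z)G_n(z)$; $G_n(1)=1$; and $\frac{d^{n+1}}{dz^{n+1}}\log G_n(z+1)\ge0$ for real $z\ge0$ (existence and uniqueness are known). So $G_1=\Gamma$ and $G_2$ is the Barnes $G$-function. $G_n(z+1)$ has no zeros or poles on $\mathbb{C}\setminus(-\infty,-1]$, and $\log G_n(z+1)$ denotes the holomorphic branch there that vanishes at $z=0$. Other logarithms are principal. Notation. Bernoulli polynomials: $\frac{x e^{tx}}{e^x-1}=\sum_{k\ge0}\frac{B_k(t)}{k!}x^k$, and $B_k=B_k(0)$ (so $B_1=-1/2$). $\binom{x}{k}=x(x-1)\cdots(x-k+1)/k!$ is the binomial polynomial, with $\binom{x}{0}=1$. $\zeta$ is the Riemann zeta function and $\zeta'$ its derivative. The polynomials $G_{n,j}(z)$ are defined by $\binom{z-u}{n-1}=\sum_{j=0}^{n-1}G_{n,j}(z)u^j$. For $r\ge1$, $$F_{n,r-1}(z)=\left(\frac{d}{dt}\right)^{r-1}\left\{\binom{-t}{n-1}\log\left(\frac{z+t}{z+1}\right)\right\}\Bigg|_{t=1}.$$ *)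

(* Defs.v *)
From HB Require Import structures.
From mathcomp Require Import all_boot all_order all_algebra.
From mathcomp Require Import all_classical all_reals all_analysis.
From mathcomp Require Export complex.
Set Implicit Arguments.
Unset Strict Implicit.
Unset Printing Implicit Defensive.
Import Order.TTheory GRing.Theory Num.Theory numFieldNormedType.Exports.
Local Open Scope classical_set_scope.
Local Open Scope ring_scope.
Local Open Scope complex_scope.

Local Notation Re := complex.Re.
Local Notation Im := complex.Im.

(* R[i] as a normed space over itself, so that derivable and derive1n on
   functions R[i] -> R[i] are the complex derivatives. *)
#[warnings="-redundant-canonical-projection"]
HB.instance Definition _ (R : realType) := NormedModule.copy R[i] R[i]^o.

Section Elementary.
Variable R : realType.
Implicit Types z s : R[i].

Definition cexp z : R[i] :=
  (expR (Re z))%:C * (cos (Im z) +i* sin (Im z)).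

(* Principal argument, in ]-pi, pi]; the value at 0 is junk. *)
Definition carg z : R :=
  if 0 <= Im z then acos (Re z / Re `|z|) else - acos (Re z / Re `|z|).

Definition clog z : R[i] := ln (Re `|z|) +i* carg z.

Definition sector (delta : R) : set R[i] :=
  [set z | z != 0 /\ `|carg z| < pi - delta].

(* The complex plane minus the half-line of reals <= -1. *)
Definition slit_plane : set R[i] := [set z | ~ (Im z = 0 /\ Re z <= -1)].

End Elementary.

Section Holomorphic.
Variable R : realType.
Implicit Types f : R[i] -> R[i].

Definition holomorphic_at f (z : R[i]) := \forall w \near z, derivable f w 1.

Definition pole f (z : R[i]) :=
  (\forall w \near z^', derivable f w 1) /\ `|f w| @[w --> z^'] --> +oo.

(* The value of f at a pole is junk. *)
Definition meromorphic f := forall z, holomorphic_at f z \/ pole f z.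

End Holomorphic.

Section MultipleGamma.
Variable R : realType.

(* The functional equation is an identity of meromorphic functions, hence is
   required only where its three terms are regular.  The convexity condition
   involves the real logarithm of G_n.+1 on [1, +oo[ (as in Bohr-Mollerup), so
   G_n.+1 is regular and positive there: in R[i], 0 < w says that w is real and
   positive.  Without positivity, G_n.+1 would only be determined up to factors
   such as exp(2 i pi z). *)
Definition multiple_gamma (G : nat -> R[i] -> R[i]) :=
  [/\ forall n, meromorphic (G n),
      forall z, G 0%N z = z &
      forall n : nat,
      [/\ forall z, holomorphic_at (G n) z -> holomorphic_at (G n.+1) z ->
            holomorphic_at (G n.+1) (z + 1) ->
            G n.+1 (z + 1) = G n z * G n.+1 z,
          holomorphic_at (G n.+1) 1 /\ G n.+1 1 = 1 &
          forall x : R, 0 <= x ->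
            [/\ holomorphic_at (G n.+1) (x%:C + 1),
                0 < G n.+1 (x%:C + 1) &
                0 <= derive1n n.+2
                       (fun y : R => ln (Re (G n.+1 (y%:C + 1)))) x]]].

(* L is the branch of z |-> log (f (z + 1)) on the slit plane with L 0 = 0. *)
Definition log_shift_branch (f L : R[i] -> R[i]) :=
  [/\ {in @slit_plane R, forall z, derivable L z 1},
      {in @slit_plane R, forall z, cexp (L z) = f (z + 1)} &
      L 0 = 0].

(* zeta is the holomorphic continuation of the Dirichlet series; the value
   zeta 1 is junk. *)
Definition riemann_zeta (zeta : R[i] -> R[i]) :=
  (forall s, s != 1 -> derivable zeta s 1) /\
  (forall s, 1 < Re s ->
     series (fun k : nat => cexp (- s * (ln (k.+1%:R : R))%:C)) @ \oo
       --> zeta s).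

(* The function x |-> x e^(tx) / (e^x - 1), extended by continuity at 0. *)
Definition bernoulli_gen (t x : R) : R :=
  if x == 0 then 1 else x * expR (t * x) / (expR x - 1).

(* B_k(t) / k! is the k-th Taylor coefficient at 0 of bernoulli_gen t. *)
Definition bernoulli_poly (k : nat) (t : R) : R :=
  derive1n k (bernoulli_gen t) 0.

Definition bernoulli_num (k : nat) : R := bernoulli_poly k 0.

Definition binom_poly (k : nat) : {poly R[i]} :=
  (k`!%:R)^-1 *: \prod_(i < k) ('X - i%:R%:P).

(* The coefficient of u^j in binom(z - u, n - 1). *)
Definition Gcoef (n j : nat) (z : R[i]) : R[i] :=
  (binom_poly n.-1 \Po (z%:P - 'X))`_j.

Definition Fterm (n k : nat) (z : R[i]) : R[i] :=
  derive1n k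
    (fun t : R[i] => (binom_poly n.-1).[- t] * clog ((z + t) / (z + 1))) 1.

(* The polynomial (- d/dz)^k binom(z, n - 1). *)
Definition binom_deriv (n k : nat) (z : R[i]) : R[i] :=
  (-1) ^+ k * (derivn k (binom_poly n.-1)).[z].

End MultipleGamma.

(* Main.v *)
(* For j >= 0 let Z_j(a) = zeta'(-j, a), constructed as an Euler-Maclaurin main
   term plus a convergent series of remainders that is O(|a|^(j+1-N)) in
   sectors.  It satisfies Z_j(a+1) - Z_j(a) = a^j log a, and Z_j(1) = zeta'(-j)
   by analytic continuation in s.  Put
     Lambda_n(z) = sum_(j < n) G_(n,j)(z) (Z_j(z+1) - Z_j(1)).
   Since G_(n+1,j)(z+1) = G_(n+1,j)(z) + G_(n,j)(z) and
   sum_j G_(n,j)(z) z^j = binom(0, n-1), the Lambda_n satisfy the same functional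
   equations as log G_n(z+1).  On the positive reals the two agree by an
   argument of Bohr-Mollerup type: their difference is 1-periodic, and its
   finite differences of order n+1 with step 1/q tend to 0 at infinity, those
   of log G_n because convexity squeezes them, so it is constant.  The identity
   theorem extends the equality to the slit plane, and the expansion is that of
   the Z_j, the coefficients of the logarithm being compared through their
   difference equation in z. *)
Require Import Defs.
From HB Require Import structures.
From mathcomp Require Import all_boot all_order all_algebra.
From mathcomp Require Import all_classical all_reals all_analysis complex.
From mathcomp Require Import ring lra zify.
Set Implicit Arguments.
Unset Strict Implicit.
Unset Printing Implicit Defensive.
Import Order.TTheory GRing.Theory Num.Theory numFieldNormedType.Exports.
Local Open Scope classical_set_scope.
Local Open Scope ring_scope.
Local Open Scope complex_scope.

Local Notation Re := complex.Re.
Local Notation Im := complex.Im.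

(** * Complex differentiation *)

Section Norm.
Context {R : realType}.
Implicit Types (z w : R[i]) (x y : R).

(** The integer N in [zfun N j] is the order of the Euler-Maclaurin formula. It stays free because N
    > j + 1 is needed for convergence, N > j + 2 for the derivative at s = -j, and N = 2M + 3 is
    used for the stated error. Z_j(1) is computed by applying the same formula to k^(-s) with s
    variable: at s = -j the s-derivatives of its terms are, up to sign, the terms of Z_j, and a
    locally uniform limit of holomorphic functions may be differentiated. Steps 1/q are needed
    because differences with step 1 do not see 1-periodic functions; with step 1/q they force such a
    function to be constant on each grid, and continuity does the rest. The order n + 1 suits both
    sides: convexity concerns the derivative of order n + 1, and Lambda_n grows like z^n log z. The
    Euler-Maclaurin remainder comes from Taylor's formula on unit intervals, without periodic
    Bernoulli functions. The complex analysis rests on Goursat for axis-parallel rectangles and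
    Taylor expansion on a circle; what is drawn from them is Weierstrass' theorem, differentiability
    of derivatives and the identity theorem on discs. *)

Definition nm z : R := Re `|z|.

(** The norm of [R[i]] takes its values in [R[i]]; estimates are made on its real value [nm], where
    the order is total and [lra] applies. *)
Lemma nmE z : `|z| = (nm z)%:C.
Proof. by rewrite /nm normc_def. Qed.

Lemma nm_sqrt z : nm z = Num.sqrt (Re z ^+ 2 + Im z ^+ 2).
Proof. by rewrite /nm normc_def. Qed.

Lemma nm_ge0 z : 0 <= nm z.
Proof. by rewrite nm_sqrt sqrtr_ge0. Qed.

Lemma sqr_nm z : nm z ^+ 2 = Re z ^+ 2 + Im z ^+ 2.
Proof. by rewrite nm_sqrt sqr_sqrtr // addr_ge0 ?sqr_ge0. Qed.

Lemma nmD z w : nm (z + w) <= nm z + nm w.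
Proof. by rewrite -lecR rmorphD /= -!nmE ler_normD. Qed.

Lemma nmM z w : nm (z * w) = nm z * nm w.
Proof. by apply: (@complexI R); rewrite rmorphM /= -!nmE normrM. Qed.

Lemma nmN z : nm (- z) = nm z.
Proof. by rewrite /nm normrN. Qed.

Lemma nmBC z w : nm (z - w) = nm (w - z).
Proof. by rewrite /nm distrC. Qed.

Lemma nmB z w : nm (z - w) <= nm z + nm w.
Proof. by rewrite -(nmN w); apply: nmD. Qed.

Lemma nm_lerB z w : nm z - nm w <= nm (z - w).
Proof. by rewrite lerBlDr; have := nmD (z - w) w; rewrite subrK. Qed.

Lemma nm_dist u z w : nm (z - w) <= nm (z - u) + nm (u - w).
Proof. by have := nmD (z - u) (u - w); rewrite addrA subrK. Qed.

Lemma nm0 : nm 0 = 0 :> R.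
Proof. by rewrite /nm normr0. Qed.

Lemma nm1 : nm 1 = 1 :> R.
Proof. by rewrite /nm normr1. Qed.

Lemma nm_eq0 z : (nm z == 0) = (z == 0).
Proof. by rewrite -(inj_eq (@complexI R)) -nmE normr_eq0. Qed.

Lemma nm0P z : nm z = 0 -> z = 0.
Proof. by move/eqP; rewrite nm_eq0 => /eqP. Qed.

Lemma nm_gt0 z : (0 < nm z) = (z != 0).
Proof. by rewrite lt_neqAle nm_ge0 andbT eq_sym nm_eq0. Qed.

Lemma nm_le0 z : nm z <= 0 -> z = 0.
Proof. by move=> h; apply: nm0P; apply/eqP; rewrite eq_le h nm_ge0. Qed.

Lemma nmV z : nm z^-1 = (nm z)^-1.
Proof. by apply: (@complexI R); rewrite fmorphV /= -!nmE normfV. Qed.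

Lemma nmX z n : nm (z ^+ n) = nm z ^+ n.
Proof. by apply: (@complexI R); rewrite rmorphXn /= -!nmE normrX. Qed.

Lemma nmZ z (n : int) : nm (z ^ n) = nm z ^ n.
Proof. by case: n => n; rewrite ?nmX // /exprz nmV nmX. Qed.

Lemma nm_real x : nm x%:C = `|x|.
Proof. by rewrite nm_sqrt /= expr0n addr0 sqrtr_sqr. Qed.

Lemma nm_i : nm 'i = 1 :> R.
Proof. by rewrite nm_sqrt /= expr0n add0r expr1n sqrtr1. Qed.

Lemma Re_nm z : `|Re z| <= nm z.
Proof.
by rewrite nm_sqrt -sqrtr_sqr ler_sqrt ?lerDl ?sqr_ge0 // addr_ge0 ?sqr_ge0.
Qed.

Lemma Im_nm z : `|Im z| <= nm z.
Proof.
by rewrite nm_sqrt -sqrtr_sqr ler_sqrt ?lerDr ?sqr_ge0 // addr_ge0 ?sqr_ge0.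
Qed.

Lemma complex_split z : z = (Re z)%:C + 'i * (Im z)%:C.
Proof. exact: complexE. Qed.

Lemma nm_le_ReIm z : nm z <= `|Re z| + `|Im z|.
Proof.
rewrite {1}(complex_split z); apply: le_trans (nmD _ _) _.
by rewrite nmM nm_i mul1r !nm_real.
Qed.

Lemma cReD z w : Re (z + w) = Re z + Re w.
Proof. by case: z; case: w. Qed.
Lemma cImD z w : Im (z + w) = Im z + Im w.
Proof. by case: z; case: w. Qed.
Lemma cReN z : Re (- z) = - Re z.
Proof. by case: z. Qed.
Lemma cImN z : Im (- z) = - Im z.
Proof. by case: z. Qed.
Lemma cReM z w : Re (z * w) = Re z * Re w - Im z * Im w.
Proof. by case: z => a b; case: w. Qed.
Lemma cImM z w : Im (z * w) = Re z * Im w + Im z * Re w.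
Proof. by case: z => a b; case: w. Qed.

Lemma nm_sum (I : Type) (s : seq I) (P : pred I) (F : I -> R[i]) :
  nm (\sum_(i <- s | P i) F i) <= \sum_(i <- s | P i) nm (F i).
Proof.
elim/big_ind2: _ => [|a b c d ha hb|//]; first by rewrite nm0.
by apply: le_trans (nmD _ _) _; apply: lerD.
Qed.

End Norm.

(** * Epsilon-delta calculus of complex derivatives *)

Section Calculus.
Context {R : realType}.
Implicit Types (f g : R[i] -> R[i]) (z w l : R[i]) (x y : R).

Definition ccont f z := forall e : R, 0 < e ->
  exists2 d : R, 0 < d & forall h, nm h < d -> nm (f (z + h) - f z) <= e.

(** Stated on the error term, without a division, so that h = 0 needs no exception; the derivative
    is an argument, so that no value is ever junk. *)
Definition cderiv f z l := forall e : R, 0 < e ->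
  exists2 d : R, 0 < d &
    forall h, nm h < d -> nm (f (z + h) - f z - l * h) <= e * nm h.

(** The derivative in a real parameter, used along paths of integration and on Euler-Maclaurin
    intervals. *)
Definition rderiv (p : R -> R[i]) (t : R) l := forall e : R, 0 < e ->
  exists2 d : R, 0 < d & forall h : R, `|h| < d ->
    nm (p (t + h) - p t - l * h%:C) <= e * `|h|.

Lemma cderiv_ccont f z l : cderiv f z l -> ccont f z.
Proof.
move=> fl e e0; have [d d0 H] := fl 1 ltr01.
have K0 : 0 < 1 + nm l by rewrite ltr_pwDl ?nm_ge0.
exists (Num.min d (e / (1 + nm l))); first by rewrite lt_min d0 divr_gt0.
move=> h; rewrite lt_min => /andP[/H hd].
rewrite ltr_pdivlMr // => he.
have -> : f (z + h) - f z = (f (z + h) - f z - l * h) + l * h by rewrite subrK.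
apply: le_trans (nmD _ _) _; rewrite nmM.
have := nm_ge0 h; nra.
Qed.

Lemma cderiv_cst c z : cderiv (fun=> c) z 0.
Proof.
move=> e e0; exists 1 => // h _.
by rewrite subrr mul0r subr0 nm0 mulr_ge0 ?nm_ge0 // ltW.
Qed.

Lemma cderiv_id z : cderiv id z 1.
Proof.
move=> e e0; exists 1 => // h _.
have -> : id (z + h) - id z - 1 * h = 0 by rewrite /=; ring.
by rewrite nm0 mulr_ge0 ?nm_ge0 // ltW.
Qed.

Lemma cderivD f g z l m :
  cderiv f z l -> cderiv g z m -> cderiv (fun w => f w + g w) z (l + m).
Proof.
move=> fl gm e e0; have e2 : 0 < e / 2 by rewrite divr_gt0.
have [d d0 H] := fl _ e2; have [d' d0' H'] := gm _ e2.
exists (Num.min d d'); first by rewrite lt_min d0.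
move=> h; rewrite lt_min => /andP[/H h1 /H' h2].
have -> : f (z + h) + g (z + h) - (f z + g z) - (l + m) * h =
  (f (z + h) - f z - l * h) + (g (z + h) - g z - m * h) by ring.
by apply: le_trans (nmD _ _) _; lra.
Qed.

Lemma cderivN f z l : cderiv f z l -> cderiv (fun w => - f w) z (- l).
Proof.
move=> fl e e0; have [d d0 H] := fl _ e0; exists d => // h /H.
by rewrite -nmN; congr (nm _ <= _); ring.
Qed.

Lemma cderivB f g z l m :
  cderiv f z l -> cderiv g z m -> cderiv (fun w => f w - g w) z (l - m).
Proof. by move=> fl gm; apply: cderivD => //; apply: cderivN. Qed.

Lemma cderivM f g z l m : cderiv f z l -> cderiv g z m ->
  cderiv (fun w => f w * g w) z (l * g z + f z * m).
Proof.
move=> fl gm e e0.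
have K0 : 0 < 1 + nm (f z) + nm (g z) + nm l.
  by have := nm_ge0 (f z); have := nm_ge0 (g z); have := nm_ge0 l; lra.
set K := 1 + _ + _ + _ in K0.
have e3 : 0 < e / (3 * K) by rewrite divr_gt0 ?mulr_gt0.
have e4 : 0 < Num.min 1 (e / (3 * K)) by rewrite lt_min e3 ltr01.
have [d1 d10 H1] := fl _ e3; have [d2 d20 H2] := gm _ e3.
have [d3 d30 H3] := cderiv_ccont gm e4.
exists (Num.min d1 (Num.min d2 d3)); first by rewrite !lt_min d10 d20.
move=> h; rewrite !lt_min => /and3P[/H1 h1 /H2 h2 /H3].
rewrite le_min => /andP[h3 h4].
have -> : f (z + h) * g (z + h) - f z * g z - (l * g z + f z * m) * h =
  (f (z + h) - f z - l * h) * g (z + h) + f z * (g (z + h) - g z - m * h)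
  + l * h * (g (z + h) - g z) by ring.
apply: le_trans (nmD _ _) _; rewrite !nmM.
apply: le_trans (lerD (nmD _ _) (lexx _)) _; rewrite !nmM.
have gK : nm (g (z + h)) <= K.
  have := nmD (g (z + h) - g z) (g z); rewrite subrK => hh.
  apply: le_trans hh _; rewrite /K.
  by have := nm_ge0 (f z); have := nm_ge0 l; lra.
set e' := e / (3 * K) in e3 h1 h2 h4.
have ee : e = e' * 3 * K by rewrite /e'; field; lra.
have fK : nm (f z) <= K.
  by rewrite /K; have := nm_ge0 (g z); have := nm_ge0 l; lra.
have lK : nm l <= K.
  by rewrite /K; have := nm_ge0 (g z); have := nm_ge0 (f z); lra.
have h0 := nm_ge0 h; have eh0 : 0 <= e' * nm h by rewrite mulr_ge0 // ltW.
rewrite ee.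
have t1 : nm (f (z + h) - f z - l * h) * nm (g (z + h)) <= e' * nm h * K.
  by apply: ler_pM; rewrite ?nm_ge0.
have t2 : nm (f z) * nm (g (z + h) - g z - m * h) <= K * (e' * nm h).
  by apply: ler_pM; rewrite ?nm_ge0.
have t3 : nm l * nm h * nm (g (z + h) - g z) <= K * nm h * e'.
  by apply: ler_pM; rewrite ?mulr_ge0 ?nm_ge0 //; apply: ler_pM; rewrite ?nm_ge0.
by move: t1 t2 t3; lra.
Qed.

Lemma cderivZ f c z l : cderiv f z l -> cderiv (fun w => c * f w) z (c * l).
Proof.
move=> fl; have := cderivM (cderiv_cst c z) fl.
by rewrite mul0r add0r.
Qed.

Lemma cderiv_sum (I : Type) (s : seq I) (P : pred I) (F : I -> R[i] -> R[i])
    (L : I -> R[i]) z : (forall i, P i -> cderiv (F i) z (L i)) ->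
  cderiv (fun w => \sum_(i <- s | P i) F i w) z (\sum_(i <- s | P i) L i).
Proof.
move=> H; elim: s => [|i s IH].
  rewrite big_nil; under eq_fun do rewrite big_nil; exact: cderiv_cst.
rewrite big_cons; under eq_fun do rewrite big_cons.
by case: ifP => // Pi; exact: cderivD (H _ Pi) IH.
Qed.

Lemma cderiv_comp f g z l m :
  cderiv g z m -> cderiv f (g z) l -> cderiv (fun w => f (g w)) z (l * m).
Proof.
move=> gm fl e e0.
have K0 : 0 < 1 + nm m + nm l by have := nm_ge0 m; have := nm_ge0 l; lra.
set K := _ + _ in K0.
have e1 : 0 < e / (2 * K) by rewrite divr_gt0 ?mulr_gt0.
have e4 : 0 < Num.min 1 (e / (2 * K)) by rewrite lt_min e1 ltr01.
have [d d0 H] := fl _ e1.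
have [d1 d10 H1] := gm _ e4.
have d20' : 0 < d / 2 by rewrite divr_gt0.
have [d2 d20 H2] := cderiv_ccont gm d20'.
exists (Num.min d1 d2); first by rewrite lt_min d10.
move=> h; rewrite lt_min => /andP[/H1 h1 /H2 h2].
have gh : nm (g (z + h) - g z) < d by apply: le_lt_trans h2 _; lra.
have := H _ gh; rewrite [g z + _]addrC subrK => h3.
have h0 := nm_ge0 h.
have [m1 m2] : Num.min 1 (e / (2 * K)) <= 1 /\
  Num.min 1 (e / (2 * K)) <= e / (2 * K) by rewrite !ge_min !lexx orbT.
set e' := e / (2 * K) in e1 h3 m2 h1 m1.
have ee : e = e' * 2 * K by rewrite /e'; field; lra.
set mn := Num.min 1 e' in m1 m2 h1.
have gK : nm (g (z + h) - g z) <= K * nm h.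
  have -> : g (z + h) - g z = (g (z + h) - g z - m * h) + m * h by ring.
  apply: le_trans (nmD _ _) _; rewrite nmM.
  have l0 := nm_ge0 l.
  have t1 : Num.min 1 e' * nm h <= 1 * nm h by rewrite ler_wpM2r.
  have t2 : 0 <= nm l * nm h by rewrite mulr_ge0.
  by move: h1 t1 t2; rewrite /mn /K !mulrDl; lra.
have -> : f (g (z + h)) - f (g z) - l * m * h =
  (f (g (z + h)) - f (g z) - l * (g (z + h) - g z))
  + l * (g (z + h) - g z - m * h) by ring.
apply: le_trans (nmD _ _) _; rewrite nmM.
have t1 : e' * nm (g (z + h) - g z) <= e' * (K * nm h).
  by rewrite ler_wpM2l // ltW.
have t2 : nm l * nm (g (z + h) - g z - m * h) <= K * (e' * nm h).
  apply: ler_pM; rewrite ?nm_ge0 //.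
    by rewrite /K; have := nm_ge0 m; lra.
  by apply: le_trans h1 _; rewrite ler_wpM2r.
by rewrite ee; move: h3 t1 t2; lra.
Qed.

Lemma cderiv_inv z : z != 0 -> cderiv (fun w => w^-1) z (- z ^- 2).
Proof.
move=> z0 e e0; have nz : 0 < nm z by rewrite nm_gt0.
exists (Num.min (nm z / 2) (e * nm z ^+ 3 / 2)).
  by rewrite lt_min !divr_gt0 ?mulr_gt0 ?exprn_gt0.
move=> h; rewrite lt_min => /andP[h1 h2].
have zh : nm z / 2 <= nm (z + h).
  by have := nm_lerB z (- h); rewrite opprK nmN; lra.
have zh0 : z + h != 0 by rewrite -nm_gt0; lra.
have -> : (z + h)^-1 - z^-1 - - z ^- 2 * h = h ^+ 2 / (z ^+ 2 * (z + h)).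
  by field; rewrite zh0 z0.
rewrite nmM nmV nmM !nmX ler_pdivrMr; last by rewrite mulr_gt0 ?exprn_gt0; lra.
have t : e * nm z ^+ 3 / 2 <= e * (nm z ^+ 2 * nm (z + h)).
  have p : 0 <= e * nm z ^+ 2 by rewrite mulr_ge0 ?exprn_ge0 // ltW.
  by have := ler_wpM2l p zh; congr (_ <= _); ring.
have := ler_wpM2l (nm_ge0 h) (le_trans (ltW h2) t).
by congr (_ <= _); ring.
Qed.

Lemma cderivX f (n : nat) z l : cderiv f z l ->
  cderiv (fun w => f w ^+ n) z (n%:R * f z ^+ n.-1 * l).
Proof.
move=> fl; elim: n => [|n IH]; first by rewrite !mul0r; apply: cderiv_cst.
under eq_fun do rewrite exprS.
have := cderivM fl IH; congr cderiv; case: n {IH} => [|n] /=.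
  by rewrite expr0 !mul0r mulr0 !mulr1 addr0 mul1r.
by rewrite exprS -!natr1; ring.
Qed.

Lemma cderiv_expz (n : int) z : z != 0 ->
  cderiv (fun w => w ^ n) z (n%:~R * z ^ (n - 1)).
Proof.
move=> z0; case: n => n.
  have := cderivX n (cderiv_id z); congr cderiv; rewrite mulr1.
  case: n => [|n]; first by rewrite !mul0r.
  by rewrite -pmulrn intS [_ + _ - _]addrAC subrr add0r.
rewrite NegzE.
have := cderiv_comp (cderivX n.+1 (cderiv_id z)) (cderiv_inv (expf_neq0 n.+1 z0)).
have -> : (fun w => w ^ (- n.+1%:Z)) = (fun w => (w ^+ n.+1)^-1) by [].
congr cderiv.
have -> : - n.+1%:Z - 1 = - n.+2%:Z by rewrite -opprD -PoszD addn1.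
rewrite intrN -pmulrn -exprnN /= !exprS.
have zn : z ^+ n != 0 by rewrite expf_neq0.
by field; rewrite zn z0.
Qed.

Lemma cderiv_near f g z l (d : R) : 0 < d ->
  (forall w, nm (w - z) < d -> f w = g w) -> cderiv f z l -> cderiv g z l.
Proof.
move=> d0 fg fl e e0; have [d' d0' H] := fl _ e0.
exists (Num.min d d'); first by rewrite lt_min d0.
move=> h; rewrite lt_min => /andP[h1 /H].
by rewrite !fg ?subrr ?nm0 // [z + h]addrC addrK.
Qed.

Lemma cderiv_uniq f z l m : cderiv f z l -> cderiv f z m -> l = m.
Proof.
move=> fl fm; apply/eqP; rewrite -subr_eq0 -nm_eq0; apply/negPn/negP => n0.
have e0 : 0 < nm (l - m) / 3 by rewrite divr_gt0 // lt_neqAle nm_ge0 eq_sym n0.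
have [d d0 H] := fl _ e0; have [d' d0' H'] := fm _ e0.
pose t := Num.min d d' / 2.
have t0 : 0 < t by rewrite divr_gt0 // lt_min d0.
have ht : nm t%:C = t by rewrite nm_real gtr0_norm.
have td : t < Num.min d d' by rewrite /t; move: t0; rewrite /t; lra.
move: td; rewrite lt_min => /andP[td td'].
have := H t%:C; rewrite ht => /(_ td) h1.
have := H' t%:C; rewrite ht => /(_ td') h2.
have h3 : nm ((l - m) * t%:C) <= nm (l - m) / 3 * t + nm (l - m) / 3 * t.
  have -> : (l - m) * t%:C = (f (z + t%:C) - f z - m * t%:C)
     - (f (z + t%:C) - f z - l * t%:C) by ring.
  by apply: le_trans (nmB _ _) _; apply: lerD.
move: h3; rewrite nmM ht; move: e0; set N := nm _ => e0 h3.
have : 0 < N * t by apply: mulr_gt0 => //; lra.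
by move: h3; rewrite (mulrAC N); lra.
Qed.

Lemma ccont_comp f g z : ccont g z -> ccont f (g z) -> ccont (fun w => f (g w)) z.
Proof.
move=> cg cf e /cf[d d0 H].
have d20' : 0 < d / 2 by rewrite divr_gt0.
have [d' d0' H'] := cg _ d20'.
exists d' => // h /H' h1; have -> : g (z + h) = g z + (g (z + h) - g z) by ring.
by apply: H; apply: le_lt_trans h1 _; lra.
Qed.

Lemma ccontD f g z : ccont f z -> ccont g z -> ccont (fun w => f w + g w) z.
Proof.
move=> fl gm e e0; have e2 : 0 < e / 2 by rewrite divr_gt0.
have [d d0 H] := fl _ e2; have [d' d0' H'] := gm _ e2.
exists (Num.min d d'); first by rewrite lt_min d0.
move=> h; rewrite lt_min => /andP[/H h1 /H' h2].
by rewrite opprD addrACA; apply: le_trans (nmD _ _) _; lra.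
Qed.

Lemma ccontM f g z : ccont f z -> ccont g z -> ccont (fun w => f w * g w) z.
Proof.
move=> fl gm e e0.
have K0 : 0 < 1 + nm (f z) + nm (g z).
  by have := nm_ge0 (f z); have := nm_ge0 (g z); lra.
set K := _ + _ in K0.
have e2 : 0 < Num.min 1 (e / (2 * K)).
  by rewrite lt_min ltr01 divr_gt0 // mulr_gt0.
have [d d0 H] := fl _ e2; have [d' d0' H'] := gm _ e2.
exists (Num.min d d'); first by rewrite lt_min d0.
move=> h; rewrite lt_min => /andP[/H + /H'].
rewrite !le_min => /andP[h1 h2] /andP[h3 h4].
have -> : f (z + h) * g (z + h) - f z * g z =
   (f (z + h) - f z) * g (z + h) + f z * (g (z + h) - g z) by ring.
apply: le_trans (nmD _ _) _; rewrite !nmM.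
have gK : nm (g (z + h)) <= K.
  have := nmD (g (z + h) - g z) (g z); rewrite subrK => hh.
  by apply: le_trans hh _; rewrite /K; have := nm_ge0 (f z); lra.
have fK : nm (f z) <= K by rewrite /K; have := nm_ge0 (g z); lra.
set e' := e / (2 * K) in e2 h2 h4.
have ee : e = e' * 2 * K by rewrite /e'; field; lra.
have := ler_pM (nm_ge0 _) (nm_ge0 _) h2 gK.
have := ler_pM (nm_ge0 _) (nm_ge0 _) fK h4.
by rewrite ee; lra.
Qed.

Lemma ccont_cst c z : ccont (fun=> c) z.
Proof. exact: cderiv_ccont (cderiv_cst _ _). Qed.

Lemma ccont_near f g z (d : R) : 0 < d ->
  (forall w, nm (w - z) < d -> f w = g w) -> ccont f z -> ccont g z.
Proof.
move=> d0 fg fl e e0; have [d' d0' H] := fl _ e0.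
exists (Num.min d d'); first by rewrite lt_min d0.
move=> h; rewrite lt_min => /andP[h1 /H].
by rewrite !fg ?subrr ?nm0 // [z + h]addrC addrK.
Qed.

Lemma cderiv_shift f c z l :
  cderiv f (c + z) l <-> cderiv (fun w => f (c + w)) z l.
Proof. by split=> H e /H[d d0 K]; exists d => // h /K; rewrite addrA. Qed.

End Calculus.

(** * Comparison with the derivatives of the library *)

Section DeriveEps.
Context {K : numFieldType}.

(** Multiplying by |h| turns the difference quotient into the error term. A general field is taken
    so that the result serves both [R] and [R[i]]. *)
Lemma derive_epsP (f : K -> K) (x l : K) :
  is_derive x 1 f l <->
  (forall e : K, 0 < e -> exists2 d : K, 0 < d &
    forall h, `|h| < d -> `|f (x + h) - f x - l * h| <= e * `|h|).
Proof.
have E h : h != 0 -> `|l - h^-1 *: ((f \o shift x) (h *: 1) - f x)| =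
    `|f (x + h) - f x - l * h| / `|h|.
  move=> h0; rewrite -normfV -normrM -normrN; congr (`|_|).
  by rewrite /= [h *: 1]mulr1 [h + x]addrC /GRing.scale /=; field.
split=> [[dv lE] e e0|H].
- have : h^-1 *: ((f \o shift x) (h *: 1) - f x) @[h --> 0^'] --> l.
    by rewrite -lE; exact: dv.
  move=> /cvgrPdist_le/(_ _ e0); rewrite near_withinE => /nbhs_ballP[d /= d0 D].
  exists d => // h hd; have [->|h0] := eqVneq h 0.
    by rewrite addr0 subrr mulr0 subrr normr0 mulr0.
  have := D h; rewrite -ball_normE /= sub0r normrN => /(_ hd h0).
  by rewrite E // ler_pdivrMr ?normr_gt0.
- have C : h^-1 *: ((f \o shift x) (h *: 1) - f x) @[h --> 0^'] --> l.
    apply/cvgrPdist_le => e e0; have [d d0 D] := H _ e0.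
    rewrite near_withinE; apply/nbhs_ballP; exists d => //= h.
    rewrite -ball_normE /= sub0r normrN => /D hd h0.
    by rewrite E // ler_pdivrMr ?normr_gt0.
  by apply: DeriveDef; [apply/cvg_ex; exists l|apply: cvg_lim].
Qed.

End DeriveEps.

(** * Functions of a real parameter and the mean value inequality *)

Section RealPaths.
Context {R : realType}.
Implicit Types (f g : R[i] -> R[i]) (z w l : R[i]) (x y : R).

(** A positive element of [R[i]] is real, so epsilons and deltas pass between [R[i]] and [R]. *)
Lemma cderivP f z l : cderiv f z l <-> is_derive z 1 f l.
Proof.
split=> [H|/derive_epsP H].
- apply/derive_epsP => e e0.
  have er : e = (Re e)%:C by rewrite RRe_real // gtr0_real.
  move: e0; rewrite er ltcR => /H[d d0 D]; exists d%:C; first by rewrite ltcR.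
  by move=> h; rewrite nmE ltcR => /D; rewrite -lecR rmorphM /= -!nmE.
- move=> e; rewrite -ltcR => /H[d d0 D].
  have dr : d = (Re d)%:C by rewrite RRe_real // gtr0_real.
  exists (Re d); first by rewrite -ltcR -dr.
  move=> h; rewrite -ltcR -dr -nmE => /D.
  by rewrite !nmE -rmorphM lecR.
Qed.

Lemma derivable_cderiv f z : derivable f z 1 -> cderiv f z (derive1 f z).
Proof. by move=> H; apply/cderivP; rewrite derive1E; apply: derivableP. Qed.

Lemma cderiv_derive1 f z l : cderiv f z l -> derive1 f z = l.
Proof. by move/cderivP => [_]; rewrite derive1E. Qed.

Lemma rderiv_Re (p : R -> R[i]) t l :
  rderiv p t l -> is_derive t 1 (fun s => Re (p s)) (Re l).
Proof.
move=> H; apply/derive_epsP => e /H[d d0 D]; exists d => // h /D.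
by move/(le_trans (Re_nm _)); rewrite !(cReD, cReN, cReM) /= mulr0 subr0.
Qed.

Lemma rderiv_Im (p : R -> R[i]) t l :
  rderiv p t l -> is_derive t 1 (fun s => Im (p s)) (Im l).
Proof.
move=> H; apply/derive_epsP => e /H[d d0 D]; exists d => // h /D.
by move/(le_trans (Im_nm _)); rewrite !(cImD, cImN, cImM) /= mulr0 add0r.
Qed.

Lemma rderiv_ReIm (p : R -> R[i]) (t : R) l :
  is_derive t 1 (fun s => Re (p s)) (Re l) ->
  is_derive t 1 (fun s => Im (p s)) (Im l) -> rderiv p t l.
Proof.
move=> /derive_epsP H1 /derive_epsP H2 e e0.
have e2 : 0 < e / 2 by rewrite divr_gt0.
have [d d0 D] := H1 _ e2; have [d' d0' D'] := H2 _ e2.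
exists (Num.min d d'); first by rewrite lt_min d0.
move=> h; rewrite lt_min => /andP[/D h1 /D' h2].
apply: le_trans (nm_le_ReIm _) _.
rewrite !(cReD, cReN, cReM, cImD, cImN, cImM) /= !mulr0 subr0 add0r.
by move: h1 h2; lra.
Qed.

Lemma rderiv_comp f (p : R -> R[i]) (t : R) l v :
  cderiv f (p t) l -> rderiv p t v -> rderiv (fun s => f (p s)) t (l * v).
Proof.
move=> fl gm e e0.
have K0 : 0 < 1 + nm v + nm l by have := nm_ge0 v; have := nm_ge0 l; lra.
set K := _ + _ in K0.
have e1 : 0 < e / (2 * K) by rewrite divr_gt0 ?mulr_gt0.
have e4 : 0 < Num.min 1 (e / (2 * K)) by rewrite lt_min e1 ltr01.
have [d d0 H] := fl _ e1.
have [d1 d10 H1] := gm _ e4.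
exists (Num.min d1 (d / (2 * K))); first by rewrite lt_min d10 divr_gt0 ?mulr_gt0.
move=> h; rewrite lt_min => /andP[/H1 h1 h2].
have h0 := normr_ge0 h.
have [m1 m2] : Num.min 1 (e / (2 * K)) <= 1 /\
  Num.min 1 (e / (2 * K)) <= e / (2 * K) by rewrite !ge_min !lexx orbT.
move: m1 m2 h1; set e' := e / (2 * K) in e1 H *.
have ee : e = e' * 2 * K by rewrite /e'; field; lra.
set mn := Num.min 1 e' => m1 m2 h1.
have gK : nm (p (t + h) - p t) <= K * `|h|.
  have -> : p (t + h) - p t = (p (t + h) - p t - v * h%:C) + v * h%:C by ring.
  apply: le_trans (nmD _ _) _; rewrite nmM nm_real.
  have l0 := nm_ge0 l.
  have t1 : mn * `|h| <= 1 * `|h| by rewrite ler_wpM2r.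
  have t2 : 0 <= nm l * `|h| by rewrite mulr_ge0.
  by move: h1 t1 t2; rewrite /K !mulrDl; lra.
have gh : nm (p (t + h) - p t) < d.
  apply: le_lt_trans gK _; move: h2; rewrite ltr_pdivlMr ?mulr_gt0 // => h2.
  by apply: le_lt_trans h2; have := mulr_ge0 h0 (ltW K0); lra.
have := H _ gh; rewrite [p t + _]addrC subrK => h3.
have -> : f (p (t + h)) - f (p t) - l * v * h%:C =
  (f (p (t + h)) - f (p t) - l * (p (t + h) - p t))
  + l * (p (t + h) - p t - v * h%:C) by ring.
apply: le_trans (nmD _ _) _; rewrite nmM.
have t1 : e' * nm (p (t + h) - p t) <= e' * (K * `|h|).
  by rewrite ler_wpM2l // ltW.
have t2 : nm l * nm (p (t + h) - p t - v * h%:C) <= K * (e' * `|h|).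
  apply: ler_pM; rewrite ?nm_ge0 //.
    by rewrite /K; have := nm_ge0 v; lra.
  by apply: le_trans h1 _; rewrite ler_wpM2r.
by rewrite ee; move: h3 t1 t2; lra.
Qed.

Lemma rderiv_affine z w (t : R) : rderiv (fun s : R => z + s%:C * w) t w.
Proof.
move=> e e0; exists 1 => // h _.
have -> : z + (t + h)%:C * w - (z + t%:C * w) - w * h%:C = 0.
  by rewrite rmorphD /=; ring.
by rewrite nm0 mulr_ge0 // ltW.
Qed.

Lemma rderivB (p q : R -> R[i]) t l m :
  rderiv p t l -> rderiv q t m -> rderiv (fun s => p s - q s) t (l - m).
Proof.
move=> fl gm e e0; have e2 : 0 < e / 2 by rewrite divr_gt0.
have [d d0 H] := fl _ e2; have [d' d0' H'] := gm _ e2.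
exists (Num.min d d'); first by rewrite lt_min d0.
move=> h; rewrite lt_min => /andP[/H h1 /H' h2].
have -> : p (t + h) - q (t + h) - (p t - q t) - (l - m) * h%:C =
  (p (t + h) - p t - l * h%:C) - (q (t + h) - q t - m * h%:C) by ring.
by apply: le_trans (nmB _ _) _; lra.
Qed.

Lemma rderivZ c (p : R -> R[i]) t l :
  rderiv p t l -> rderiv (fun s => c * p s) t (c * l).
Proof.
move=> pl; have := rderiv_comp (cderivZ c (cderiv_id (p t))) pl.
by rewrite mulr1.
Qed.

Lemma rderivD (p q : R -> R[i]) t l m :
  rderiv p t l -> rderiv q t m -> rderiv (fun s => p s + q s) t (l + m).
Proof.
move=> pl /(rderivZ (-1)) qm; have := rderivB pl qm.
by rewrite mulN1r opprK; congr rderiv; apply/funext => s; rewrite mulN1r opprK.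
Qed.

Definition rcont (p : R -> R[i]) t := forall e : R, 0 < e ->
  exists2 d : R, 0 < d & forall h, `|h| < d -> nm (p (t + h) - p t) <= e.

Lemma rcont_comp f (p : R -> R[i]) t :
  ccont f (p t) -> rcont p t -> rcont (fun s => f (p s)) t.
Proof.
move=> cf cg e /cf[d d0 H].
have d20' : 0 < d / 2 by rewrite divr_gt0.
have [d' d0' H'] := cg _ d20'.
exists d' => // h /H' h1; have -> : p (t + h) = p t + (p (t + h) - p t) by ring.
by apply: H; apply: le_lt_trans h1 _; lra.
Qed.

Lemma rderiv_rcont (p : R -> R[i]) t l : rderiv p t l -> rcont p t.
Proof.
move=> fl e e0; have [d d0 H] := fl 1 ltr01.
have K0 : 0 < 1 + nm l by rewrite ltr_pwDl ?nm_ge0.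
exists (Num.min d (e / (1 + nm l))); first by rewrite lt_min d0 divr_gt0.
move=> h; rewrite lt_min => /andP[/H hd].
rewrite ltr_pdivlMr // => he.
have -> : p (t + h) - p t = (p (t + h) - p t - l * h%:C) + l * h%:C by rewrite subrK.
apply: le_trans (nmD _ _) _; rewrite nmM nm_real.
have := normr_ge0 h; nra.
Qed.

Lemma rcontD (p q : R -> R[i]) t :
  rcont p t -> rcont q t -> rcont (fun s => p s + q s) t.
Proof.
move=> cp cq e e0; have e2 : 0 < e / 2 by rewrite divr_gt0.
have [d d0 D] := cp _ e2; have [d' d0' D'] := cq _ e2.
exists (Num.min d d'); first by rewrite lt_min d0.
move=> v; rewrite lt_min => /andP[/D h1 /D' h2].
have -> : p (t + v) + q (t + v) - (p t + q t) = (p (t + v) - p t) + (q (t + v) - q t) by ring.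
by apply: le_trans (nmD _ _) _; lra.
Qed.

Lemma rcontM (p q : R -> R[i]) t :
  rcont p t -> rcont q t -> rcont (fun s => p s * q s) t.
Proof.
move=> fl gm e e0.
have K0 : 0 < 1 + nm (p t) + nm (q t).
  by have := nm_ge0 (p t); have := nm_ge0 (q t); lra.
set K := _ + _ in K0.
have e2 : 0 < Num.min 1 (e / (2 * K)).
  by rewrite lt_min ltr01 divr_gt0 // mulr_gt0.
have [d d0 H] := fl _ e2; have [d' d0' H'] := gm _ e2.
exists (Num.min d d'); first by rewrite lt_min d0.
move=> h; rewrite lt_min => /andP[/H + /H'].
rewrite !le_min => /andP[h1 h2] /andP[h3 h4].
have -> : p (t + h) * q (t + h) - p t * q t =
   (p (t + h) - p t) * q (t + h) + p t * (q (t + h) - q t) by ring.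
apply: le_trans (nmD _ _) _; rewrite !nmM.
have gK : nm (q (t + h)) <= K.
  have := nmD (q (t + h) - q t) (q t); rewrite subrK => hh.
  by apply: le_trans hh _; rewrite /K; have := nm_ge0 (p t); lra.
have fK : nm (p t) <= K by rewrite /K; have := nm_ge0 (q t); lra.
set e' := e / (2 * K) in e2 h2 h4.
have ee : e = e' * 2 * K by rewrite /e'; field; lra.
have := ler_pM (nm_ge0 _) (nm_ge0 _) h2 gK.
have := ler_pM (nm_ge0 _) (nm_ge0 _) fK h4.
by rewrite ee; lra.
Qed.

Lemma is_derive_cont (f : R -> R) (x l : R) :
  is_derive x 1 f l -> {for x, continuous f}.
Proof.
by move=> [D _]; apply: differentiable_continuous; apply/derivable1_diffP.
Qed.

Lemma real_mean_value (f df : R -> R) (a b B : R) : a <= b ->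
  (forall x, a <= x <= b -> is_derive x 1 f (df x)) ->
  (forall x, a <= x <= b -> `|df x| <= B) -> `|f b - f a| <= B * (b - a).
Proof.
move=> ab H HB.
have C : {within `[a, b], continuous f}.
  apply: continuous_in_subspaceT => x; rewrite inE /= in_itv /= => xab.
  exact: is_derive_cont (H _ xab).
have H' x : x \in `]a, b[ -> is_derive x 1 f (df x).
  by rewrite in_itv /= => /andP[/ltW ax /ltW xb]; apply: H; rewrite ax.
have [c cab ->] := MVT_segment ab H' C.
rewrite normrM [`|b - a|]ger0_norm ?subr_ge0 // ler_wpM2r ?subr_ge0 //.
by apply: HB; rewrite in_itv in cab.
Qed.

(** The real mean value theorem is applied to the real and imaginary parts separately, whence the
    factor 2, harmless everywhere below. *)
Lemma mean_value (p dp : R -> R[i]) (a b B : R) : a <= b ->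
  (forall t, a <= t <= b -> rderiv p t (dp t)) ->
  (forall t, a <= t <= b -> nm (dp t) <= B) -> nm (p b - p a) <= 2 * B * (b - a).
Proof.
move=> ab H HB; apply: le_trans (nm_le_ReIm _) _; rewrite !(cReD, cImD, cReN, cImN).
have h1 := @real_mean_value (fun s => Re (p s)) (fun s => Re (dp s)) _ _ B ab.
have h2 := @real_mean_value (fun s => Im (p s)) (fun s => Im (dp s)) _ _ B ab.
have -> : 2 * B * (b - a) = B * (b - a) + B * (b - a) by ring.
apply: lerD.
- apply: h1 => [x xab|x xab]; first exact: rderiv_Re (H _ xab).
  by apply: le_trans (Re_nm _) (HB _ xab).
- apply: h2 => [x xab|x xab]; first exact: rderiv_Im (H _ xab).
  by apply: le_trans (Im_nm _) (HB _ xab).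
Qed.

End RealPaths.

(** * Primitives and integrals of continuous functions on the line *)

Section Primitive.
Context {R : realType}.

Lemma zero_derive_const (f : R -> R) (a b : R) : a <= b ->
  (forall x, a <= x <= b -> is_derive x 1 f 0) -> f a = f b.
Proof.
move=> ab H; apply/esym/eqP; rewrite -subr_eq0 -normr_le0.
have := @real_mean_value R f (fun=> 0) a b 0 ab H.
by rewrite mul0r; apply => x _; rewrite normr0.
Qed.

(** The integral from -N is differentiable inside ]-N, N[; the normalisation at 0 makes the
    primitives for different N agree. *)
Lemma primitive_on (g : R -> R) (N : R) : 0 < N -> (forall x, {for x, continuous g}) ->
  exists P : R -> R, P 0 = 0 /\ forall x : R, `|x| < N -> is_derive x 1 P (g x).
Proof.
move=> N0 cg.
pose F (x : R) := (\int[lebesgue_measure]_(t in [set` `[- N, x]]) g t)%R.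
exists (fun x => F x - F 0); split; first by rewrite subrr.
move=> x; rewrite ltr_norml => /andP[Nx xN].
have gi : (@lebesgue_measure R).-integrable `[- N, N]%classic (EFin \o g).
  apply: continuous_compact_integrable; first exact: segment_compact.
  by apply: continuous_in_subspaceT => y _; apply: cg.
have [d dE] := continuous_FTC1_closed xN gi Nx (cg x).
rewrite -(subr0 (g x)); apply: is_deriveB.
by apply: DeriveDef; [exact: d|rewrite -derive1E; exact: dE].
Qed.

Lemma primitive_exists (g : R -> R) : (forall x, {for x, continuous g}) ->
  exists P : R -> R, forall x : R, is_derive x 1 P (g x).
Proof.
move=> cg.
have /choice[P HP] (N : R) : exists P : R -> R, 0 < N ->
    P 0 = 0 /\ forall x : R, `|x| < N -> is_derive x 1 P (g x).
  have [N0|N0] := ltP 0 N; last by exists id.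
  by have [Q HQ] := primitive_on N0 cg; exists Q.
have PE (M N x : R) : `|x| < M -> M <= N -> P M x = P N x.
  move=> xM MN; have M0 : 0 < M by apply: le_lt_trans xM.
  have N0 : 0 < N by apply: lt_le_trans MN.
  have [PM0 PMd] := HP _ M0; have [PN0 PNd] := HP _ N0.
  have D (y : R) : `|y| < M -> is_derive y 1 (fun y => P M y - P N y) 0.
    move=> yM; rewrite -(subrr (g y)).
    by apply: is_deriveB; [apply: PMd|apply: PNd; apply: lt_le_trans MN].
  apply/eqP; rewrite -subr_eq0; apply/eqP.
  have -> : 0 = (fun y => P M y - P N y) 0 by rewrite PM0 PN0 subrr.
  move: xM; rewrite ltr_norml => /andP[x1 x2].
  have [x0|x0] := leP 0 x.
  - apply/esym.
    apply: (@zero_derive_const (fun y => P M y - P N y) 0 x x0) => y /andP[y1 y2]; apply: D.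
    by rewrite ltr_norml; apply/andP; split; lra.
  - apply: (@zero_derive_const (fun y => P M y - P N y) x 0 (ltW x0)) => y /andP[y1 y2].
    by apply: D; rewrite ltr_norml; apply/andP; split; lra.
(* Each value is read off a primitive valid beyond |x|; by [PE] the choice of the interval does not
   matter. *)
exists (fun x => P (`|x| + 1) x) => x.
have x2 : 0 < `|x| + 2 by rewrite ltr_wpDl.
have [_ /(_ x)] := HP _ x2; rewrite ltrDl => /(_ (@ltr0Sn _ 1)) /derive_epsP H.
apply/derive_epsP => e /H[d d0 D].
exists (Num.min d 1); first by rewrite lt_min d0 ltr01.
move=> h; rewrite lt_min => /andP[/D hd h1].
have xh := ler_normD x h.
by rewrite (PE _ (`|x| + 2) x) ?(PE _ (`|x| + 2) (x + h)) //; lra.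
Qed.

Definition prim (g : R -> R) : R -> R :=
  xget (fun=> 0) [set P : R -> R | forall x : R, is_derive x 1 P (g x)].

Lemma primP (g : R -> R) : (forall x, {for x, continuous g}) ->
  forall x : R, is_derive x 1 (prim g) (g x).
Proof.
move=> /primitive_exists[P HP]; rewrite /prim; case: xgetP => [Q _ HQ //|].
by move=> /(_ P); case.
Qed.

Implicit Types (p q P : R -> R[i]).

Lemma rcont_Re p (t : R) : rcont p t -> {for t, continuous (fun s => Re (p s))}.
Proof.
move=> cp; apply/cvgrPdist_le => e e0; have [d d0 D] := cp _ e0.
apply/nbhs_ballP; exists d => //= y ty.
have := D (y - t); rewrite distrC => /(_ ty); rewrite [t + _]addrC subrK => h.
rewrite distrC -cReN -cReD; exact: le_trans (Re_nm _) h.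
Qed.

Lemma rcont_Im p (t : R) : rcont p t -> {for t, continuous (fun s => Im (p s))}.
Proof.
move=> cp; apply/cvgrPdist_le => e e0; have [d d0 D] := cp _ e0.
apply/nbhs_ballP; exists d => //= y ty.
have := D (y - t); rewrite distrC => /(_ ty); rewrite [t + _]addrC subrK => h.
rewrite distrC -cImN -cImD; exact: le_trans (Im_nm _) h.
Qed.

(* The integral of p from a to b; junk unless p is continuous on the whole line,
   since it is a difference of values of a primitive. *)
Definition cI p (a b : R) : R[i] :=
  (prim (fun s => Re (p s)) b - prim (fun s => Re (p s)) a) +i*
  (prim (fun s => Im (p s)) b - prim (fun s => Im (p s)) a).

Definition rcontT p := forall t, rcont p t.

Definition cprim p (t : R) : R[i] :=
  prim (fun s => Re (p s)) t +i* prim (fun s => Im (p s)) t.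

Lemma cIE p a b : cI p a b = cprim p b - cprim p a.
Proof. by []. Qed.

Lemma cprimP p (t : R) : rcontT p -> rderiv (cprim p) t (p t).
Proof.
move=> cp; apply: rderiv_ReIm => /=.
- by apply: primP => s; apply: rcont_Re.
- by apply: primP => s; apply: rcont_Im.
Qed.

Lemma rderiv0_const P (a b : R) : a <= b ->
  (forall t, a <= t <= b -> rderiv P t 0) -> P a = P b.
Proof.
move=> ab H; apply/esym/eqP; rewrite -subr_eq0; apply/eqP/nm_le0.
have := @mean_value R P (fun=> 0) a b 0 ab H.
by rewrite mulr0 mul0r; apply => x _; rewrite nm0.
Qed.

Lemma cI_sym p a b : cI p a b = - cI p b a.
Proof. by rewrite !cIE; ring. Qed.

(** Where P has derivative p it differs from [cprim p] by a constant, so P need only be a primitive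
    on the segment, whichever end is the larger. *)
Lemma cI_ftc p P a b : rcontT p ->
  (forall t, Num.min a b <= t <= Num.max a b -> rderiv P t (p t)) ->
  cI p a b = P b - P a.
Proof.
move=> cp; wlog ab : a b / a <= b => [W H|].
  have [/W|/ltW ba] := leP a b; first exact.
  by rewrite cI_sym (W b a) // ?opprB // minC maxC.
rewrite minEle maxEle ab => H.
have : (fun t => cprim p t - P t) a = (fun t => cprim p t - P t) b.
  apply: (@rderiv0_const (fun t => cprim p t - P t) a b ab) => t /H Pt; rewrite -(subrr (p t)).
  by apply: rderivB => //; apply: cprimP.
by rewrite cIE => /(congr1 (fun z => cprim p b - P a - z)); rewrite /=; move=> h;
  apply/eqP; rewrite -subr_eq0; apply/eqP; move/eqP: h; rewrite -subr_eq0 => /eqP <-; ring.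
Qed.

Lemma cI_lin p q c a b : rcontT p -> rcontT q ->
  rcontT (fun t => p t + c * q t) ->
  cI (fun t => p t + c * q t) a b = cI p a b + c * cI q a b.
Proof.
move=> cp cq cr.
rewrite (@cI_ftc _ (fun t => cprim p t + c * cprim q t)) //.
  by rewrite !cIE; ring.
by move=> t _; apply: rderivD; [|apply: rderivZ]; apply: cprimP.
Qed.

Lemma cI_bound p a b B : rcontT p ->
  (forall t, Num.min a b <= t <= Num.max a b -> nm (p t) <= B) ->
  nm (cI p a b) <= 2 * B * `|b - a|.
Proof.
move=> cp; wlog ab : a b / a <= b => [W H|].
  have [/W|/ltW ba] := leP a b; first exact.
  by rewrite cI_sym nmN distrC; apply: W => //; rewrite minC maxC.
rewrite minEle maxEle ab => H; rewrite cIE ger0_norm ?subr_ge0 //.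
by apply: mean_value ab _ H => t _; apply: cprimP.
Qed.

Lemma cI_ext p q a b : (forall t, p t = q t) -> cI p a b = cI q a b.
Proof. by move=> /funext ->. Qed.

End Primitive.

(** * Cauchy theory on squares *)

Section Bisection.
Context {R : realType}.

Lemma pow2_gt (w d : R) : 0 < d -> exists k : nat, w / 2 ^+ k < d.
Proof.
move=> d0; have [k kw] : exists k : nat, w / d < k%:R.
  have [/ltW h|h] := ltP (w / d) 0; first by exists 1; apply: le_lt_trans h _.
  by exists (Num.bound (w / d)); apply: archi_boundP.
exists k; rewrite ltr_pdivrMr ?exprn_gt0 // mulrC -ltr_pdivrMr //.
apply: lt_trans kw _; rewrite -natrX ltr_nat; exact: ltn_expl.
Qed.

Lemma nested_intervals (a b : nat -> R) :
  (forall k, a k <= a k.+1) -> (forall k, b k.+1 <= b k) ->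
  (forall k, a k <= b k) -> exists p, forall k, a k <= p <= b k.
Proof.
move=> ha hb hab.
have am : {homo a : i j / (i <= j)%N >-> i <= j}.
  by apply: homo_leq => // x y z; apply: le_trans.
have bm : {homo b : i j / (i <= j)%N >-> j <= i}.
  by apply: homo_leq => // x y z xy yz; apply: le_trans yz xy.
have ub k : ubound (range a) (b k).
  move=> _ [j _ <-]; apply: le_trans (am _ _ (leq_maxl j k)) _.
  by apply: le_trans (hab _) _; apply: bm; apply: leq_maxr.
have hs : has_sup (range a) by split; [exists (a 0%N), 0%N|exists (b 0%N); apply: ub].
exists (sup (range a)) => k; apply/andP; split.
  by apply: sup_ubound; [case: hs|exists k].
by apply: sup_le_ub => //; case: hs.
Qed.

Definition half_of (I J : R * R) :=
  J = (I.1, (I.1 + I.2) / 2) \/ J = ((I.1 + I.2) / 2, I.2).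

Lemma half_ofP I J : I.1 <= I.2 -> half_of I J ->
  [/\ I.1 <= J.1, J.2 <= I.2, J.1 <= J.2 & J.2 - J.1 = (I.2 - I.1) / 2].
Proof. by case: I => a b /= ab [|] -> /=; split; lra. Qed.

(** If P fails on a rectangle it fails on one of its quarters; the nested failures shrink to a
    point, near which P holds for all small rectangles. Goursat's lemma and the boundedness of
    continuous functions both follow this scheme. *)
Lemma bisection (P : R * R -> R * R -> Prop) (X Y : R * R) :
  X.1 <= X.2 -> Y.1 <= Y.2 ->
  (forall I J, (forall I' J', half_of I I' -> half_of J J' -> P I' J') -> P I J) ->
  (forall p q, X.1 <= p <= X.2 -> Y.1 <= q <= Y.2 -> exists2 d : R, 0 < d &
     forall I J, I.1 <= p <= I.2 -> J.1 <= q <= J.2 -> X.1 <= I.1 -> I.2 <= X.2 ->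
       Y.1 <= J.1 -> J.2 <= Y.2 ->
       I.2 - I.1 < d -> J.2 - J.1 < d -> P I J) ->
  P X Y.
Proof.
move=> hX hY Pstep Ploc; apply: contrapT => nP.
(* [st] selects a failing quarter of a failing rectangle. *)
have /choice[st Hst] (S : (R * R) * (R * R)) : exists T : (R * R) * (R * R),
    ~ P S.1 S.2 -> [/\ half_of S.1 T.1, half_of S.2 T.2 & ~ P T.1 T.2].
  have [h|h] := EM (P S.1 S.2); first by exists S.
  have : ~ forall I' J', half_of S.1 I' -> half_of S.2 J' -> P I' J'.
    by move=> H; apply: h; apply: Pstep.
  move=> /existsNP[I' /existsNP[J' /not_implyP[h1 /not_implyP[h2 h3]]]].
  by exists (I', J').
pose S k := iter k st (X, Y).
have nPS k : ~ P (S k).1 (S k).2.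
  by elim: k => [//|k IH]; rewrite /S iterS; have [] := Hst _ IH.
have le1 k : (S k).1.1 <= (S k).1.2.
  elim: k => [//|k IH]; have [h _ _] := Hst _ (nPS k).
  by have [] := half_ofP IH h.
have le2 k : (S k).2.1 <= (S k).2.2.
  elim: k => [//|k IH]; have [_ h _] := Hst _ (nPS k).
  by have [] := half_ofP IH h.
have [p hp] : exists p, forall k, (S k).1.1 <= p <= (S k).1.2.
  apply: nested_intervals => [k|k|//]; have [h _ _] := Hst _ (nPS k);
  by have [] := half_ofP (le1 k) h.
have [q hq] : exists p, forall k, (S k).2.1 <= p <= (S k).2.2.
  apply: nested_intervals => [k|k|//]; have [_ h _] := Hst _ (nPS k);
  by have [] := half_ofP (le2 k) h.
have [d d0 D] := Ploc p q (hp 0%N) (hq 0%N).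
have w1 k : (S k).1.2 - (S k).1.1 = (X.2 - X.1) / 2 ^+ k.
  elim: k => [|k IH]; first by rewrite divr1.
  have [h _ _] := Hst _ (nPS k); have [_ _ _ ->] := half_ofP (le1 k) h.
  by rewrite IH exprSr invfM mulrA.
have w2 k : (S k).2.2 - (S k).2.1 = (Y.2 - Y.1) / 2 ^+ k.
  elim: k => [|k IH]; first by rewrite divr1.
  have [_ h _] := Hst _ (nPS k); have [_ _ _ ->] := half_ofP (le2 k) h.
  by rewrite IH exprSr invfM mulrA.
have in1 k : X.1 <= (S k).1.1 /\ (S k).1.2 <= X.2.
  elim: k => [//|k [i1 i2]]; have [h _ _] := Hst _ (nPS k).
  by have [? ? _ _] := half_ofP (le1 k) h; split; [apply: le_trans i1 _|apply: le_trans i2].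
have in2 k : Y.1 <= (S k).2.1 /\ (S k).2.2 <= Y.2.
  elim: k => [//|k [i1 i2]]; have [_ h _] := Hst _ (nPS k).
  by have [? ? _ _] := half_ofP (le2 k) h; split; [apply: le_trans i1 _|apply: le_trans i2].
have [k kw] := pow2_gt (X.2 - X.1 + (Y.2 - Y.1)) d0.
have k0 : 0 < (2 ^+ k : R)^-1 by rewrite invr_gt0 exprn_gt0.
have [i1 i2] := in1 k; have [j1 j2] := in2 k.
apply: (nPS k); apply: D => //.
- rewrite w1; apply: le_lt_trans kw; rewrite ler_wpM2r ?(ltW k0) //; lra.
- rewrite w2; apply: le_lt_trans kw; rewrite ler_wpM2r ?(ltW k0) //; lra.
Qed.

End Bisection.

(** * Goursat's lemma for rectangles *)

Section Goursat.
Context {R : realType}.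
Implicit Types (f F g : R[i] -> R[i]) (x y : R).

Definition ccontT f := forall z, ccont f z.

Lemma rderiv_hor (y : R) t : rderiv (fun s : R => s +i* y) t 1.
Proof.
have := @rderiv_affine R (0 +i* y) 1 t; congr rderiv; apply/funext => s.
by rewrite mulr1; apply/eqP; rewrite eq_complex /= add0r addr0 !eqxx.
Qed.

Lemma rderiv_ver (x : R) t : rderiv (fun s : R => x +i* s) t 'i.
Proof.
have := @rderiv_affine R (x +i* 0) 'i t; congr rderiv; apply/funext => s.
by apply/eqP; rewrite eq_complex /= !mul0r !mulr0 mulr1 subrr !(add0r, addr0) !eqxx.
Qed.

Lemma rcontT_hor f y : ccontT f -> rcontT (fun s => f (s +i* y)).
Proof. by move=> cf t; apply: rcont_comp (cf _) (rderiv_rcont (rderiv_hor _ _)). Qed.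

Lemma rcontT_ver f x : ccontT f -> rcontT (fun s => f (x +i* s)).
Proof. by move=> cf t; apply: rcont_comp (cf _) (rderiv_rcont (rderiv_ver _ _)). Qed.

(** The bounds need not be ordered: exchanging two of them changes the sign, so that rectangles on
    any side of a given corner are treated alike. *)
Definition rect_int f x0 x1 y0 y1 : R[i] :=
  cI (fun s => f (s +i* y0)) x0 x1 + 'i * cI (fun s => f (x1 +i* s)) y0 y1
  - cI (fun s => f (s +i* y1)) x0 x1 - 'i * cI (fun s => f (x0 +i* s)) y0 y1.

Lemma rect_int_splitx f x0 x1 x2 y0 y1 :
  rect_int f x0 x1 y0 y1 + rect_int f x1 x2 y0 y1 = rect_int f x0 x2 y0 y1.
Proof. by rewrite /rect_int !cIE; ring. Qed.

Lemma rect_int_splity f x0 x1 y0 y1 y2 :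
  rect_int f x0 x1 y0 y1 + rect_int f x0 x1 y1 y2 = rect_int f x0 x1 y0 y2.
Proof. by rewrite /rect_int !cIE; ring. Qed.

Lemma rect_int_symx f x0 x1 y0 y1 : rect_int f x0 x1 y0 y1 = - rect_int f x1 x0 y0 y1.
Proof. by rewrite /rect_int !cIE; ring. Qed.

Lemma rect_int_symy f x0 x1 y0 y1 : rect_int f x0 x1 y0 y1 = - rect_int f x0 x1 y1 y0.
Proof. by rewrite /rect_int !cIE; ring. Qed.

Lemma cI_hor f F y a b : ccontT f ->
  (forall t, Num.min a b <= t <= Num.max a b -> cderiv F (t +i* y) (f (t +i* y))) ->
  cI (fun s => f (s +i* y)) a b = F (b +i* y) - F (a +i* y).
Proof.
move=> cf H; apply: (@cI_ftc _ _ (fun s => F (s +i* y))); first exact: rcontT_hor.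
by move=> t /H Ft; have := rderiv_comp Ft (rderiv_hor y t); rewrite mulr1.
Qed.

Lemma cI_ver f F x a b : ccontT f ->
  (forall t, Num.min a b <= t <= Num.max a b -> cderiv F (x +i* t) (f (x +i* t))) ->
  'i * cI (fun s => f (x +i* s)) a b = F (x +i* b) - F (x +i* a).
Proof.
move=> cf H.
rewrite (@cI_ftc _ _ (fun s => - 'i * F (x +i* s))); last 2 first.
- exact: rcontT_ver.
- move=> t /H Ft; have := rderivZ (- 'i) (rderiv_comp Ft (rderiv_ver x t)).
  by rewrite mulrCA mulNr -expr2 sqr_i opprK mulr1.
by rewrite -mulrBr mulrA mulrN -expr2 sqr_i opprK mul1r.
Qed.

Lemma rect_int_lin f g c x0 x1 y0 y1 : ccontT f -> ccontT g ->
  rect_int (fun z => f z + c * g z) x0 x1 y0 y1 =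
  rect_int f x0 x1 y0 y1 + c * rect_int g x0 x1 y0 y1.
Proof.
move=> cf cg; have ch : ccontT (fun z => f z + c * g z).
  by move=> z; apply: ccontD => //; apply: ccontM => //; apply: ccont_cst.
have hh y := @cI_lin R _ _ c x0 x1 (rcontT_hor y cf) (rcontT_hor y cg) (rcontT_hor y ch).
have vv x := @cI_lin R _ _ c y0 y1 (rcontT_ver x cf) (rcontT_ver x cg) (rcontT_ver x ch).
by rewrite /rect_int !hh !vv; ring.
Qed.

Lemma rect_int_bound f x0 x1 y0 y1 B : ccontT f ->
  (forall s t, Num.min x0 x1 <= s <= Num.max x0 x1 ->
     Num.min y0 y1 <= t <= Num.max y0 y1 -> nm (f (s +i* t)) <= B) ->
  nm (rect_int f x0 x1 y0 y1) <= 4 * B * (`|x1 - x0| + `|y1 - y0|).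
Proof.
move=> cf H; rewrite /rect_int.
have mx (a b : R) : Num.min a b <= a <= Num.max a b /\ Num.min a b <= b <= Num.max a b.
  by rewrite !ge_min !le_max !lexx !orbT.
have [mx0 mx1] := mx x0 x1; have [my0 my1] := mx y0 y1.
have h1 := @cI_bound R _ x0 x1 B (rcontT_hor y0 cf) (fun t ht => H t y0 ht my0).
have h2 := @cI_bound R _ x0 x1 B (rcontT_hor y1 cf) (fun t ht => H t y1 ht my1).
have v1 := @cI_bound R _ y0 y1 B (rcontT_ver x0 cf) (fun t ht => H x0 t mx0 ht).
have v2 := @cI_bound R _ y0 y1 B (rcontT_ver x1 cf) (fun t ht => H x1 t mx1 ht).
apply: le_trans (nmB _ _) _; apply: le_trans (lerD (nmB _ _) (lexx _)) _.
apply: le_trans (lerD (lerD (nmD _ _) (lexx _)) (lexx _)) _.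
by rewrite !nmM nm_i !mul1r; move: h1 h2 v1 v2; lra.
Qed.

Lemma rect_int_ftc f F x0 x1 y0 y1 : ccontT f ->
  (forall s t, Num.min x0 x1 <= s <= Num.max x0 x1 ->
     Num.min y0 y1 <= t <= Num.max y0 y1 -> cderiv F (s +i* t) (f (s +i* t))) ->
  rect_int f x0 x1 y0 y1 = 0.
Proof.
move=> cf H; rewrite /rect_int.
have mx (a b : R) : Num.min a b <= a <= Num.max a b /\ Num.min a b <= b <= Num.max a b.
  by rewrite !ge_min !le_max !lexx !orbT.
have [mx0 mx1] := mx x0 x1; have [my0 my1] := mx y0 y1.
rewrite !(@cI_hor _ F) // ?(@cI_ver _ F) //; first by ring.
all: by move=> t ht; apply: H.
Qed.

Lemma rect_int_affine (a b : R[i]) x0 x1 y0 y1 :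
  rect_int (fun z => a + b * z) x0 x1 y0 y1 = 0.
Proof.
apply: (@rect_int_ftc _ (fun z => a * z + b / 2 * z ^+ 2)).
  move=> z; apply: ccontD; first exact: ccont_cst.
  by apply: ccontM; [exact: ccont_cst|exact: cderiv_ccont (cderiv_id z)].
move=> s t _ _; have := cderivD (cderivZ a (cderiv_id (s +i* t)))
  (cderivZ (b / 2) (cderivX 2 (cderiv_id (s +i* t)))).
by congr cderiv; rewrite /= expr1; field.
Qed.

(** A bound by a multiple of the squared half-perimeter passes from the four quarters to the
    rectangle, since each quarter has half the half-perimeter. Near a point it holds with an
    arbitrarily small factor, by differentiability there. *)
Lemma goursat f x0 x1 y0 y1 : x0 <= x1 -> y0 <= y1 -> ccontT f ->
  (forall s t, x0 <= s <= x1 -> y0 <= t <= y1 -> exists l, cderiv f (s +i* t) l) ->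
  rect_int f x0 x1 y0 y1 = 0.
Proof.
move=> hx hy cf H; apply: nm_le0; apply/ler_addgt0Pr => e e0; rewrite add0r.
(* The summand 1 keeps [W] positive for a degenerate rectangle. *)
pose W := (x1 - x0) + (y1 - y0) + 1.
have W0 : 0 < W by rewrite /W; lra.
pose e' := e / W ^+ 2; have e'0 : 0 < e' by rewrite divr_gt0 ?exprn_gt0.
suff : nm (rect_int f x0 x1 y0 y1) <= e' * ((x1 - x0) + (y1 - y0)) ^+ 2.
  move=> h; apply: le_trans h _; rewrite /e' mulrAC ler_pdivrMr ?exprn_gt0 //.
  rewrite ler_wpM2l ?(ltW e0) // ler_pXn2r ?nnegrE //; rewrite ?(ltW W0) // /W; lra.
pose P (I J : R * R) := I.1 <= I.2 -> J.1 <= J.2 ->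
  nm (rect_int f I.1 I.2 J.1 J.2) <= e' * ((I.2 - I.1) + (J.2 - J.1)) ^+ 2.
suff : P (x0, x1) (y0, y1) by apply.
apply: bisection => // [[a b] [c d]|p q hp hq].
- rewrite /P /= => K ab cd.
  have [m1 m2 k1 k2] : [/\ a <= (a + b) / 2, (a + b) / 2 <= b,
    c <= (c + d) / 2 & (c + d) / 2 <= d] by split; lra.
  have h1 := K (_, _) (_, _) (or_introl erefl) (or_introl erefl) m1 k1.
  have h2 := K (_, _) (_, _) (or_intror erefl) (or_introl erefl) m2 k1.
  have h3 := K (_, _) (_, _) (or_introl erefl) (or_intror erefl) m1 k2.
  have h4 := K (_, _) (_, _) (or_intror erefl) (or_intror erefl) m2 k2.
  move: h1 h2 h3 h4 => /=.
  rewrite -(rect_int_splitx f a ((a + b) / 2) b).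
  rewrite -!(rect_int_splity f _ _ c ((c + d) / 2) d).
  set r1 := rect_int _ _ _ _ _; set r2 := rect_int _ _ _ _ _.
  set r3 := rect_int _ _ _ _ _; set r4 := rect_int _ _ _ _ _.
  have n1 := nmD (r1 + r3) (r2 + r4); have n2 := nmD r1 r3; have n3 := nmD r2 r4.
  by rewrite !expr2; move: n1 n2 n3; lra.
- have [l lP] := H _ _ hp hq; have e4 : 0 < e' / 4 by rewrite divr_gt0.
  have [d d0 D] := lP _ e4; exists (d / 2); first by rewrite divr_gt0.
  move=> [a b] [c k] /= /andP[ap pb] /andP[cq qk] _ _ _ _ h1 h2 ab ck.
  (* [g] is the affine approximation of f at z; its boundary integral is zero, so only f - g has to
     be estimated. *)
  pose z := p +i* q; pose g w := f z - l * z + l * w.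
  have cg : ccontT g.
    move=> w; apply: ccontD; first exact: ccont_cst.
    by apply: ccontM; [exact: ccont_cst|exact: cderiv_ccont (cderiv_id w)].
  have := rect_int_lin (-1) a b c k cf cg.
  rewrite rect_int_affine mulr0 addr0 => <-.
  have ch : ccontT (fun w => f w + -1 * g w).
    by move=> w; apply: ccontD => //; apply: ccontM => //; apply: ccont_cst.
  have := @rect_int_bound _ a b c k (e' / 4 * ((b - a) + (k - c))) ch.
  rewrite !ger0_norm ?subr_ge0 //= => h3; apply: le_trans (h3 _) _; last by lra.
  rewrite minEle maxEle ab minEle maxEle ck => s t /andP[s1 s2] /andP[t1 t2].
  have hb : nm (s +i* t - z) <= (b - a) + (k - c).
    apply: le_trans (nm_le_ReIm _) _; rewrite /=.
    move: s1 s2 t1 t2 ap pb cq qk; clear => *.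
    by apply: lerD; rewrite ler_norml; apply/andP; split; lra.
  have := D (s +i* t - z); rewrite (_ : z + (s +i* t - z) = s +i* t); last by ring.
  move=> /(_ _)/wrap[]; first by apply: le_lt_trans hb _; lra.
  rewrite (_ : f (s +i* t) - f z - _ = f (s +i* t) + -1 * g (s +i* t)); last by rewrite /g; ring.
  by move=> h; apply: le_trans h _; rewrite ler_wpM2l // ltW.
Qed.

End Goursat.

(** * Primitives on squares, with one exceptional point *)

Section Primitive2.
Context {R : realType}.
Implicit Types (f F g : R[i] -> R[i]) (x y : R).

Definition btw (a b t : R) := (a <= t <= b) || (b <= t <= a).

Lemma btwE a b t : (Num.min a b <= t <= Num.max a b) = btw a b t.
Proof.
rewrite /btw; have [ab|ba] := leP a b.
- case: (boolP (b <= t <= a)); rewrite ?orbF // => /andP[h1 h2].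
  by rewrite orbT; apply/andP; split; lra.
- case: (boolP (a <= t <= b)); rewrite ?orbF // => /andP[h1 h2].
  by rewrite /=; apply/andP; split; lra.
Qed.

Lemma btw_dist a b t : btw a (a + b) t -> `|t - a| <= `|b|.
Proof.
rewrite /btw => /orP[]/andP[h1 h2]; first by rewrite ger0_norm ?ger0_norm; lra.
by rewrite ler0_norm ?ler0_norm; lra.
Qed.

Lemma goursat_signed f x0 x1 y0 y1 : ccontT f ->
  (forall s t, btw x0 x1 s -> btw y0 y1 t -> exists l, cderiv f (s +i* t) l) ->
  rect_int f x0 x1 y0 y1 = 0.
Proof.
move=> cf H.
wlog hx : x0 x1 H / x0 <= x1 => [W|].
  have [/W|/ltW h] := leP x0 x1; first exact.
  by rewrite rect_int_symx W ?oppr0 // => s t hs; apply: H; rewrite /btw orbC.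
wlog hy : y0 y1 H / y0 <= y1 => [W|].
  have [/W|/ltW h] := leP y0 y1; first exact.
  by rewrite rect_int_symy W ?oppr0 // => s t hs ht; apply: H => //; rewrite /btw orbC.
by apply: goursat => // s t hs ht; apply: H; rewrite /btw ?hs ?ht.
Qed.

(** Cutting off the half-size rectangle at the corner leaves two rectangles that avoid it, whose
    integrals vanish. The integral is therefore unchanged when the rectangle shrinks to the corner,
    where continuity of f makes it tend to 0. *)
Lemma goursat_corner f p q A B : ccontT f ->
  (forall s t, btw p (p + A) s -> btw q (q + B) t -> (s, t) <> (p, q) ->
    exists l, cderiv f (s +i* t) l) ->
  rect_int f p (p + A) q (q + B) = 0.
Proof.
move=> cf H.
have [->|A0] := eqVneq A 0; first by rewrite addr0 /rect_int !cIE; ring.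
have [->|B0] := eqVneq B 0; first by rewrite addr0 /rect_int !cIE; ring.
pose J k := rect_int f p (p + A / 2 ^+ k) q (q + B / 2 ^+ k).
have p2 k : 0 < (2 ^+ k)^-1 :> R by rewrite invr_gt0 exprn_gt0.
have p21 k : (2 ^+ k)^-1 <= 1 :> R by rewrite invf_le1 ?exprn_gt0 // exprn_ege1 // ler1n.
have sub (C d t s : R) : 0 <= d <= 1 -> btw (s + C * d / 2) (s + C * d) t -> btw s (s + C) t.
  rewrite /btw => /andP[d0 d1]; have [C0|/ltW C0] := leP 0 C.
    have : 0 <= C * d <= C by rewrite mulr_ge0 //= ler_piMr.
    by move=> /andP[? ?] /orP[/andP[? ?]|/andP[? ?]]; apply/orP; left; apply/andP; split; lra.
  have : C <= C * d <= 0 by rewrite mulr_le0_ge0 // andbT -[leLHS]mulr1 ler_wnM2l.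
  by move=> /andP[? ?] /orP[/andP[? ?]|/andP[? ?]]; apply/orP; right; apply/andP; split; lra.
have sub2 (C d t s : R) : 0 <= d <= 1 -> btw s (s + C * d) t -> btw s (s + C) t.
  rewrite /btw => /andP[d0 d1]; have [C0|/ltW C0] := leP 0 C.
    have : 0 <= C * d <= C by rewrite mulr_ge0 //= ler_piMr.
    by move=> /andP[? ?] /orP[/andP[? ?]|/andP[? ?]]; apply/orP; left; apply/andP; split; lra.
  have : C <= C * d <= 0 by rewrite mulr_le0_ge0 // andbT -[leLHS]mulr1 ler_wnM2l.
  by move=> /andP[? ?] /orP[/andP[? ?]|/andP[? ?]]; apply/orP; right; apply/andP; split; lra.
have nz (C d t s : R) : C != 0 -> 0 < d -> btw (s + C * d / 2) (s + C * d) t -> t <> s.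
  move=> C0 d0; have : C * d != 0 by rewrite mulf_neq0 // gt_eqF.
  by rewrite /btw neq_lt => /orP[] ? /orP[/andP[? ?]|/andP[? ?]]; lra.
have half k : 2 ^+ k.+1 = 2 ^+ k * 2 :> R by rewrite exprSr.
have hf (C : R) k : C / 2 ^+ k.+1 = C * (2 ^+ k)^-1 / 2 by rewrite half invfM mulrA.
have d01 k : 0 <= (2 ^+ k : R)^-1 <= 1 by rewrite (ltW (p2 k)) p21.
have JS k : J k = J k.+1.
  rewrite /J -(rect_int_splitx f p (p + A / 2 ^+ k.+1)).
  rewrite -(rect_int_splity f p (p + A / 2 ^+ k.+1) q (q + B / 2 ^+ k.+1)).
  rewrite (@goursat_signed f p _ (q + B / 2 ^+ k.+1)) //; last first.
    move=> s t hs ht; apply: H.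
    - by apply: sub2 hs.
    - by apply: (sub _ _ _ _ (d01 k)); rewrite hf in ht.
    - by case=> _; apply: (nz B _ _ _ B0 (p2 k)); rewrite hf in ht.
  rewrite (@goursat_signed f (p + _)) ?addr0 // => s t hs ht; apply: H.
  - by apply: (sub _ _ _ _ (d01 k)); rewrite hf in hs.
  - by apply: sub2 ht.
  - by case=> + _; apply: (nz A _ _ _ A0 (p2 k)); rewrite hf in hs.
have J0 k : rect_int f p (p + A) q (q + B) = J k.
  by elim: k => [|k IH]; [rewrite /J expr0 !divr1|rewrite -JS].
apply: nm_le0; apply/ler_addgt0Pr => e e0; rewrite add0r.
have [d d0 D] := cf (p +i* q) 1 ltr01.
pose M := 4 * (nm (f (p +i* q)) + 1) * (`|A| + `|B|).
have [k1 k1P] := pow2_gt (`|A| + `|B|) d0.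
have [k2 k2P] := pow2_gt M e0.
pose k := maxn k1 k2.
have mono (w : R) i j : 0 <= w -> (i <= j)%N -> w / 2 ^+ j <= w / 2 ^+ i.
  move=> w0 ij; rewrite ler_wpM2l // lef_pV2 ?posrE ?exprn_gt0 //.
  by rewrite ler_eXn2l ?ltr1n.
have M0 : 0 <= M by rewrite !mulr_ge0 ?addr_ge0 ?nm_ge0.
have AB0 : 0 <= `|A| + `|B| by rewrite addr_ge0.
rewrite (J0 k) /J; apply: le_trans (rect_int_bound (B := nm (f (p +i* q)) + 1) cf _) _.
  move=> s t; rewrite !btwE => hs ht.
  have -> : f (s +i* t) = f (s +i* t) - f (p +i* q) + f (p +i* q) by rewrite subrK.
  apply: le_trans (nmD _ _) _; rewrite addrC lerD2l.
  have := D ((s +i* t) - (p +i* q)); rewrite (_ : _ + (_ - _) = s +i* t); [apply|by ring].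
  apply: le_lt_trans (nm_le_ReIm _) _; rewrite /=.
  apply: le_lt_trans (_ : _ <= (`|A| + `|B|) / 2 ^+ k) _; last first.
    by apply: le_lt_trans k1P; apply: mono => //; apply: leq_maxl.
  have := btw_dist hs; have := btw_dist ht.
  by rewrite !normrM (gtr0_norm (p2 k)) mulrDl; lra.
have -> : p + A / 2 ^+ k - p = A / 2 ^+ k by ring.
have -> : q + B / 2 ^+ k - q = B / 2 ^+ k by ring.
rewrite !normrM (gtr0_norm (p2 k)) -mulrDl mulrA -/M.
apply: le_trans (mono _ _ _ M0 (leq_maxr k1 k2)) (ltW k2P).
Qed.

Lemma goursat_except f p q x0 x1 y0 y1 : ccontT f ->
  (forall s t, btw x0 x1 s -> btw y0 y1 t -> (s, t) <> (p, q) ->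
    exists l, cderiv f (s +i* t) l) ->
  rect_int f x0 x1 y0 y1 = 0.
Proof.
move=> cf H.
have [/andP[px py]|nb] := boolP (btw x0 x1 p && btw y0 y1 q); last first.
  apply: goursat_signed => // s t hs ht; apply: H => //.
  by case=> sp tq; move: nb; rewrite -sp -tq hs ht.
have sx x s : x = x0 \/ x = x1 -> btw p x s -> btw x0 x1 s.
  by move: px; rewrite /btw => /orP[]/andP[? ?] [] -> /orP[]/andP[? ?];
    apply/orP; ((left; apply/andP; split; lra) || (right; apply/andP; split; lra)).
have sy x s : x = y0 \/ x = y1 -> btw q x s -> btw y0 y1 s.
  by move: py; rewrite /btw => /orP[]/andP[? ?] [] -> /orP[]/andP[? ?];
    apply/orP; ((left; apply/andP; split; lra) || (right; apply/andP; split; lra)).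
have C x y : x = x0 \/ x = x1 -> y = y0 \/ y = y1 -> rect_int f p x q y = 0.
  move=> hx hy; have := @goursat_corner f p q (x - p) (y - q) cf.
  rewrite !(addrC _ (_ - _)) !subrK; apply => s t hs ht; apply: H.
    exact: sx hs.
  exact: sy ht.
(* A signed decomposition into four rectangles that have the exceptional point as a corner. *)
have E : rect_int f x0 x1 y0 y1 = rect_int f p x1 q y1 - rect_int f p x0 q y1
    - (rect_int f p x1 q y0 - rect_int f p x0 q y0).
  by rewrite /rect_int !cIE; ring.
by rewrite E !C ?subr0 //; by [left|right].
Qed.

Lemma cI_cst (c : R[i]) (a b : R) : cI (fun=> c) a b = c * (b - a)%:C.
Proof.
rewrite (@cI_ftc _ _ (fun t => 0 + t%:C * c)); last 2 first.
- by move=> t e e0; exists 1 => // h _; rewrite subrr nm0 ltW.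
- by move=> t _; apply: rderiv_affine.
by rewrite rmorphB /=; ring.
Qed.

Lemma cI_near_cst (p : R -> R[i]) c (a b e : R) : rcontT p ->
  (forall t, btw a b t -> nm (p t - c) <= e) ->
  nm (cI p a b - c * (b - a)%:C) <= 2 * e * `|b - a|.
Proof.
move=> cp H; rewrite -cI_cst.
have cc : rcontT (fun=> c : R[i]).
  by move=> t e' e0; exists 1 => // h _; rewrite subrr nm0 ltW.
have cs : rcontT (fun t => p t + -1 * c).
  by move=> t e' e0; have [d d0 D] := cp t _ e0; exists d => // h /D; rewrite opprD addrACA subrr addr0.
have := @cI_lin R p (fun=> c) (-1) a b cp cc cs; rewrite -[- cI (fun=> c) a b]mulN1r => <-.
by apply: cI_bound => // t; rewrite btwE mulN1r => /H.
Qed.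

(** Open squares are preferred to discs because they contain the axis-parallel rectangles, and the
    two-segment paths from the centre, spanned by their points. *)
Definition sq (c : R[i]) (r : R) (z : R[i]) :=
  (`|Re (z - c)| < r) && (`|Im (z - c)| < r).

Lemma sq_nm c r z : nm (z - c) < r -> sq c r z.
Proof.
by move=> h; apply/andP; split; apply: le_lt_trans h; rewrite ?Re_nm ?Im_nm.
Qed.

Lemma sq_open c r z : sq c r z -> exists2 d : R, 0 < d & forall w, sq z d w -> sq c r w.
Proof.
move=> /andP[h1 h2].
exists (Num.min (r - `|Re (z - c)|) (r - `|Im (z - c)|)).
  by rewrite lt_min !subr_gt0 h1.
move=> w; rewrite /sq !lt_min => /andP[/andP[a1 a2] /andP[b1 b2]].
have -> : w - c = (w - z) + (z - c) by ring.
rewrite !(cReD (w - z)) !(cImD (w - z)).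
have := ler_normD (Re (w - z)) (Re (z - c)); have := ler_normD (Im (w - z)) (Im (z - c)).
by move=> n1 n2; apply/andP; split; lra.
Qed.

(** The primitive integrates horizontally from the centre, then vertically. The exceptional point,
    where f is merely continuous, is meant for difference quotients. *)
Lemma primitive_sq f z0 c r : ccontT f ->
  (forall z, sq c r z -> z != z0 -> exists l, cderiv f z l) ->
  exists F, forall z, sq c r z -> cderiv F z (f z).
Proof.
move=> cf H.
pose F z := cI (fun s => f (s +i* Im c)) (Re c) (Re z)
  + 'i * cI (fun s => f (Re z +i* s)) (Im c) (Im z).
exists F => z zr e e0; have e4 : 0 < e / 4 by rewrite divr_gt0.
have [d d0 D] := cf z _ e4; have [d' d0' D'] := sq_open zr.
exists (Num.min (d / 2) d'); first by rewrite lt_min d0' divr_gt0.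
move=> h; rewrite lt_min => /andP[hd hd'].
have [uh vh] := (Re_nm h, Im_nm h).
move: uh vh; set x := Re z; set y := Im z; set u := Re h; set v := Im h => uh vh.
have zE : z = x +i* y by rewrite /x /y; case: (z).
have hE : h = u%:C + 'i * v%:C by rewrite -complex_split.
(* This rectangle lies between the paths to z and to z + h; its vanishing reduces the increment of F
   to two short segments starting at z. *)
have R0 : rect_int f x (x + u) (Im c) y = 0.
  apply: (@goursat_except f (Re z0) (Im z0)) => // s t hs ht st.
  apply: H; last by apply/eqP => E; apply: st; rewrite -E.
  have zh : sq c r (z + h) by apply: D'; apply: sq_nm; rewrite addrC addKr.
  move: zr zh; rewrite /sq !(cReD, cReN, cImD, cImN) -/x -/y -/u -/v /=.
  rewrite !ltr_norml => /andP[/andP[a1 a2] /andP[a3 a4]] /andP[/andP[b1 b2] /andP[b3 b4]].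
  apply/andP; split; apply/andP.
    by move: hs a1 a2 b1 b2; clear; rewrite /btw => /orP[]/andP[? ?] *; split; lra.
  by move: ht a3 a4 b3 b4; clear; rewrite /btw => /orP[]/andP[? ?] *; split; lra.
have -> : F (z + h) - F z = cI (fun s => f (s +i* y)) x (x + u)
   + 'i * cI (fun s => f ((x + u) +i* s)) y (y + v).
  rewrite /F !cReD !cImD -/x -/y -/u -/v.
  move: R0; rewrite /rect_int !cIE => R0; apply/eqP; rewrite -subr_eq0 -[X in _ == X]R0.
  by apply/eqP; ring.
have -> : cI (fun s => f (s +i* y)) x (x + u)
   + 'i * cI (fun s => f ((x + u) +i* s)) y (y + v) - f z * h =
   (cI (fun s => f (s +i* y)) x (x + u) - f z * (x + u - x)%:C)
   + 'i * (cI (fun s => f ((x + u) +i* s)) y (y + v) - f z * (y + v - y)%:C).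
  by rewrite {1}hE !(addrC _ (- _)) !addKr; ring.
have close w : nm (w - z) <= nm h + nm h -> nm (f w - f z) <= e / 4.
  move=> wz; have := D (w - z); rewrite (_ : z + (w - z) = w); [apply|by ring].
  by apply: le_lt_trans wz _; lra.
have B1 := @cI_near_cst _ (f z) x (x + u) (e / 4) (rcontT_hor y cf).
have B2 := @cI_near_cst _ (f z) y (y + v) (e / 4) (rcontT_ver (x + u) cf).
apply: le_trans (nmD _ _) _; rewrite nmM nm_i mul1r.
have {}B1 := B1 _; have {}B2 := B2 _.
apply: le_trans (lerD (B1 _) (B2 _)) _.
- move=> t /btw_dist ht; apply: close; apply: le_trans (nm_le_ReIm _) _.
  rewrite zE /= subrr normr0; have := nm_ge0 h; lra.
- move=> t /btw_dist ht; apply: close; apply: le_trans (nm_le_ReIm _) _.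
  by rewrite zE /= (addrC x) addrK; lra.
rewrite (addrC x) (addrC y) !addrK.
have : e * `|u| <= e * nm h by rewrite ler_wpM2l // ltW.
have : e * `|v| <= e * nm h by rewrite ler_wpM2l // ltW.
by lra.
Qed.

End Primitive2.

(** * The unit circle *)

Section Circle.
Context {R : realType}.

Definition circ (t : R) : R[i] := cos t +i* sin t.

Lemma nm_circ t : nm (circ t) = 1.
Proof. by rewrite nm_sqrt /= cos2Dsin2 sqrtr1. Qed.

Lemma circ_neq0 t : circ t != 0.
Proof. by rewrite -nm_gt0 nm_circ. Qed.

Lemma rderiv_circ t : rderiv circ t ('i * circ t).
Proof.
apply: rderiv_ReIm; rewrite /= !(mul0r, mul1r) ?sub0r ?add0r.
- exact: is_derive_cos.
- exact: is_derive_sin.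
Qed.

Lemma circ0 : circ 0 = 1.
Proof. by rewrite /circ cos0 sin0. Qed.

Lemma circ2pi : circ (pi *+ 2) = 1.
Proof. by rewrite /circ cos2pi sin2pi. Qed.

(** For j > 0 the integrand has a primitive of period 2 pi, a multiple of itself. *)
Lemma cI_circ_pow (j : nat) : (0 < j)%N ->
  cI (fun t => (circ t)^-1 ^+ j) 0 (pi *+ 2) = 0.
Proof.
move=> j0; have j0' : j%:R != 0 :> R[i] by rewrite pnatr_eq0 -lt0n.
have i0 : 'i != 0 :> R[i] by rewrite -nm_gt0 nm_i.
have D t := rderiv_comp (cderivX j (cderiv_inv (circ_neq0 t))) (rderiv_circ t).
rewrite (@cI_ftc _ _ (fun t => - (j%:R * 'i)^-1 * (circ t)^-1 ^+ j)).
- by rewrite circ0 circ2pi subrr.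
- by move=> t; exact: rderiv_rcont (D t).
- move=> t _; have := rderivZ (- (j%:R * 'i)^-1) (D t); congr rderiv.
  have E (N I u X : R[i]) : N != 0 -> I != 0 -> u != 0 ->
      - (N * I)^-1 * (N * X * - (u ^+ 2)^-1 * (I * u)) = u^-1 * X.
    by move=> N0 I0 u0; field; rewrite N0 I0 u0.
  case: j j0 j0' D => // j _ j0' _ /=; rewrite [RHS]exprS.
  exact: E j0' i0 (circ_neq0 t).
Qed.

End Circle.

(** * Cauchy's formula and Taylor expansion on a circle *)

Section Cauchy.
Context {R : realType}.
Implicit Types (f F g : R[i] -> R[i]) (c h z w : R[i]).

Lemma rcont_const c t : rcont (fun=> c) t.
Proof. by move=> e e0; exists 1 => // h _; rewrite subrr nm0 ltW. Qed.

Lemma ccont_diff_inv z w : w != z -> ccont (fun v => (v - z)^-1) w.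
Proof.
move=> wz; have wz0 : w - z != 0 by rewrite subr_eq0.
have D := cderiv_comp (cderivB (cderiv_id w) (cderiv_cst z w)) (cderiv_inv wz0).
exact: cderiv_ccont D.
Qed.

Lemma nm_pow_small (q e C : R) : 0 <= q < 1 -> 0 < e -> 0 <= C ->
  exists m : nat, C * q ^+ m <= e.
Proof.
move=> /andP[q0 q1] e0 C0.
have : (fun m => q ^+ m) @ \oo --> (0 : R) by apply: cvg_expr; rewrite ger0_norm.
have e1 : 0 < e / (C + 1) by rewrite divr_gt0 // ltr_wpDl.
move=> /cvgrPdist_le/(_ _ e1)[m _ /(_ m (leqnn m))] /=.
rewrite sub0r normrN ger0_norm ?exprn_ge0 // ler_pdivlMr ?ltr_wpDl // => h.
by exists m; have := exprn_ge0 m q0; nra.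
Qed.

Section OneCircle.
Variables (c : R[i]) (r rho : R).
Hypotheses (rho0 : 0 < rho) (rhor : rho < r).

Let path (t : R) : R[i] := c + rho%:C * circ t.

Lemma rderiv_path t : rderiv path t (rho%:C * ('i * circ t)).
Proof.
have := rderivD (rderivZ (rho%:C) (rderiv_circ t)) (rderivZ 0 (rderiv_circ t)).
rewrite mul0r addr0 => H e /H[d d0 D]; exists d => // h /D.
by congr (nm _ <= _); rewrite /path; ring.
Qed.

Lemma rho_neq0 : rho%:C != 0 :> R[i].
Proof. by rewrite -nm_eq0 nm_real normr_eq0 gt_eqF. Qed.

Lemma path_sq t : sq c r (path t).
Proof.
apply: sq_nm; rewrite /path addrC addKr nmM nm_circ mulr1 nm_real.
by rewrite ger0_norm // ltW.
Qed.

Lemma path_far h t : nm h < rho -> rho - nm h <= nm (rho%:C * circ t - h).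
Proof.
move=> hr; apply: le_trans (nm_lerB _ _).
by rewrite nmM nm_circ mulr1 nm_real ger0_norm // ltW.
Qed.

Lemma path_neq h t : nm h < rho -> rho%:C * circ t - h != 0.
Proof.
by move=> hr; rewrite -nm_gt0; apply: lt_le_trans (path_far t hr); rewrite subr_gt0.
Qed.

(** With w = rho e^(it), this is w / (w - h): the Cauchy kernel dw / (w - h) on the circle, divided
    by i dt. *)
Let kern h t := rho%:C * circ t / (rho%:C * circ t - h).

Lemma rcont_inv_circ (j : nat) (t : R) : rcont (fun t => (circ t)^-1 ^+ j) t.
Proof.
exact: rderiv_rcont (rderiv_comp (cderivX j (cderiv_inv (circ_neq0 t))) (rderiv_circ t)).
Qed.

Lemma rcont_kern h : nm h < rho -> rcontT (kern h).
Proof.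
move=> hr t; apply: rcontM.
  by apply: rcontM; [exact: rcont_const|exact: rderiv_rcont (rderiv_circ t)].
have := rcont_comp (f := fun w => (w - h)^-1) (p := fun t => rho%:C * circ t) (t := t).
apply; last first.
  by apply: rcontM; [exact: rcont_const|exact: rderiv_rcont (rderiv_circ t)].
by apply: ccont_diff_inv; rewrite -subr_eq0 path_neq.
Qed.

Lemma nm_kern h t : nm h < rho -> nm (kern h t) <= rho / (rho - nm h).
Proof.
move=> hr; rewrite nmM nmV nmM nm_circ mulr1 nm_real gtr0_norm //.
rewrite ler_wpM2l ?(ltW rho0) // lef_pV2 ?path_far //.
  by rewrite posrE nm_gt0 path_neq.
by rewrite posrE subr_gt0.
Qed.

(** The difference quotient of f at c + h has a primitive on the square, so its integral over the
    circle vanishes; written out, this is the claim. *)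
Lemma cauchy_kern f h : ccontT f ->
  (forall z, sq c r z -> exists l, cderiv f z l) -> nm h < rho ->
  cI (fun t => f (path t) * kern h t) 0 (pi *+ 2) =
  f (c + h) * cI (kern h) 0 (pi *+ 2).
Proof.
move=> cf df hr; set z := c + h.
have [l lP] : exists l, cderiv f z l.
  by apply: df; apply: sq_nm; rewrite /z addrC addKr; apply: lt_trans rhor.
(* Given the value l at z, the quotient is continuous everywhere and differentiable in the square
   outside z, as [primitive_sq] asks. *)
pose G w := if w == z then l else (f w - f z) * (w - z)^-1.
have GN w : w != z -> ccont G w /\ forall m, cderiv f w m -> exists l', cderiv G w l'.
  move=> wz; have dw : 0 < nm (w - z) by rewrite nm_gt0 subr_eq0.
  have E v : nm (v - w) < nm (w - z) -> (f v - f z) * (v - z)^-1 = G v.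
    rewrite /G; case: eqP => // ->; rewrite nmBC ltxx //.
  split.
    apply: ccont_near dw E _; apply: ccontM; last exact: ccont_diff_inv.
    by apply: ccontD; [exact: cf|exact: ccont_cst].
  move=> m mP.
  have wz0 : w - z != 0 by rewrite subr_eq0.
  have D := cderiv_comp (cderivB (cderiv_id w) (cderiv_cst z w)) (cderiv_inv wz0).
  by eexists; apply: cderiv_near dw E (cderivM (cderivB mP (cderiv_cst (f z) w)) D).
have cG : ccontT G.
  move=> w; have [->|wz] := eqVneq w z; last by have [] := GN w wz.
  move=> e e0; have [d d0 D] := lP _ e0; exists d => // v /D hv.
  rewrite /G eqxx; have [vz|vz] := eqVneq (z + v) z; first by rewrite subrr nm0 ltW.
  have v0 : v != 0 by apply: contra vz => /eqP ->; rewrite addr0.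
  have -> : (f (z + v) - f z) / (z + v - z) - l = (f (z + v) - f z - l * v) / v.
    by rewrite (_ : z + v - z = v); [field|ring].
  by rewrite nmM nmV ler_pdivrMr ?nm_gt0.
have [Phi HPhi] : exists Phi, forall w, sq c r w -> cderiv Phi w (G w).
  apply: (@primitive_sq _ _ z) => // w ws wz; have [m mP] := df _ ws.
  by have [_ /(_ m mP)] := GN w wz.
have D t := rderiv_comp (HPhi _ (path_sq t)) (rderiv_path t).
have cD : rcontT (fun t => G (path t) * (rho%:C * ('i * circ t))).
  move=> t; apply: rcontM; first exact: rcont_comp (cG _) (rderiv_rcont (rderiv_path t)).
  apply: rcontM; first exact: rcont_const.
  by apply: rcontM; [exact: rcont_const|exact: rderiv_rcont (rderiv_circ t)].
have : cI (fun t => G (path t) * (rho%:C * ('i * circ t))) 0 (pi *+ 2) = 0.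
  rewrite (cI_ftc cD (fun t _ => D t)).
  by rewrite /path circ0 circ2pi subrr.
have i0 : 'i != 0 :> R[i] by rewrite -nm_gt0 nm_i.
have ck := rcont_kern hr.
have cfk : rcontT (fun t => f (path t) * kern h t).
  by move=> t; apply: rcontM; [exact: rcont_comp (cf _) (rderiv_rcont (rderiv_path t))|].
have cl : rcontT (fun t => f (path t) * kern h t + - f z * kern h t).
  move=> t e e0.
  have C : rcont (fun t => (f (path t) - f z) * kern h t) t.
    apply: rcontM => //.
    have := rcont_comp (f := fun w => f w - f z) (p := path) (t := t).
    apply; last exact: rderiv_rcont (rderiv_path t).
    by apply: ccontD; [exact: cf|exact: ccont_cst].
  by have [d d0 X] := C _ e0; exists d => // v /X; congr (nm _ <= _); ring.
have E t : G (path t) * (rho%:C * ('i * circ t)) =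
    0 + 'i * (f (path t) * kern h t + - f z * kern h t).
  have p0 := path_neq t hr.
  have pz : path t - z = rho%:C * circ t - h by rewrite /path /z; ring.
  rewrite /G -subr_eq0 pz (negPf p0) /kern; move: (f _) (f _) => u v.
  by rewrite add0r; field.
under eq_fun do rewrite E.
rewrite (cI_lin (p := fun=> 0)) //; last 2 first.
- by move=> t; apply: rcont_const.
- by move=> t; have := cD t; congr (rcont _ t); apply/funext => s; exact: E.
rewrite cI_cst mul0r add0r (cI_lin _ _ cfk ck cl) => /eqP.
by rewrite mulf_eq0 (negPf i0) /= mulNr subr_eq0 => /eqP.
Qed.

Lemma kern_expand h t m : nm h < rho -> kern h t =
  \sum_(j < m) h ^+ j * ((rho%:C * circ t)^-1 ^+ j) + (h * (rho%:C * circ t)^-1) ^+ m * kern h t.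
Proof.
move=> hr; have p0 := path_neq t hr.
have w0 : rho%:C * circ t != 0 by rewrite mulf_neq0 ?rho_neq0 ?circ_neq0.
rewrite /kern; move: p0 w0; set w := rho%:C * circ t => p0 w0.
elim: m => [|m IH]; first by rewrite big_ord0 add0r mul1r.
rewrite big_ord_recr /= {1}IH -addrA; congr (_ + _).
rewrite exprSr !exprMn; set X := h ^+ m; set Y := w^-1 ^+ m.
by field; rewrite p0 w0.
Qed.

Lemma circle_expand f h m : ccontT f -> nm h < rho ->
  forall B, (forall t, nm (f (path t)) <= B) ->
  nm (cI (fun t => f (path t) * kern h t) 0 (pi *+ 2) -
      \sum_(j < m) h ^+ j * cI (fun t => f (path t) * (rho%:C * circ t)^-1 ^+ j) 0 (pi *+ 2))
  <= 2 * (B * ((nm h / rho) ^+ m * (rho / (rho - nm h)))) * (pi *+ 2).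
Proof.
move=> cf hr B HB.
have cfp t : rcont (fun t => f (path t)) t.
  exact: rcont_comp (cf _) (rderiv_rcont (rderiv_path t)).
have cp (j : nat) t : rcont (fun t => (rho%:C * circ t)^-1 ^+ j) t.
  have w0 : rho%:C * circ t != 0 by rewrite mulf_neq0 ?rho_neq0 ?circ_neq0.
  have := rcont_comp (f := fun w => w^-1 ^+ j) (p := fun t => rho%:C * circ t) (t := t).
  apply; first exact: cderiv_ccont (cderivX j (cderiv_inv w0)).
  by apply: rcontM; [exact: rcont_const|exact: rderiv_rcont (rderiv_circ t)].
have cfj (j : nat) : rcontT (fun t => f (path t) * (rho%:C * circ t)^-1 ^+ j).
  by move=> t; apply: rcontM.
pose rem t := f (path t) * ((h * (rho%:C * circ t)^-1) ^+ m * kern h t).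
have crem : rcontT rem.
  move=> t; apply: rcontM => //; apply: rcontM; last exact: rcont_kern.
  under eq_fun do rewrite exprMn.
  exact: rcontM (@rcont_const (h ^+ m) t) (cp m t).
have csum (k : nat) : rcontT (fun t => rem t + \sum_(j < k) h ^+ j * (f (path t) * (rho%:C * circ t)^-1 ^+ j)).
  elim: k => [|k IH] t.
    by under eq_fun do rewrite big_ord0 addr0; exact: crem.
  have := rcontD (IH t) (rcontM (@rcont_const (h ^+ k) t) (cfj k t)).
  by congr (rcont _ t); apply/funext => s; rewrite big_ord_recr /= addrA.
have S (k : nat) : cI (fun t => rem t + \sum_(j < k) h ^+ j * (f (path t) * (rho%:C * circ t)^-1 ^+ j)) 0 (pi *+ 2)
   = cI rem 0 (pi *+ 2) + \sum_(j < k) h ^+ j * cI (fun t => f (path t) * (rho%:C * circ t)^-1 ^+ j) 0 (pi *+ 2).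
  elim: k => [|k IH].
    by rewrite big_ord0 addr0; apply: cI_ext => t; rewrite big_ord0 addr0.
  have := cI_lin (c := h ^+ k) 0 (pi *+ 2) (csum k) (cfj k) => L.
  rewrite big_ord_recr /= addrA -IH -L; last first.
    by move=> t; have := csum k.+1 t; congr (rcont _ t); apply/funext => s; rewrite big_ord_recr /= addrA.
  by apply: cI_ext => t; rewrite big_ord_recr /= addrA.
have -> : cI (fun t => f (path t) * kern h t) 0 (pi *+ 2) =
  cI (fun t => rem t + \sum_(j < m) h ^+ j * (f (path t) * (rho%:C * circ t)^-1 ^+ j)) 0 (pi *+ 2).
  apply: cI_ext => t; rewrite (kern_expand t m hr) mulrDr addrC; congr (_ + _).
  by rewrite mulr_sumr; apply: eq_bigr => j _; ring.
have pi20 : 0 <= pi *+ 2 :> R by rewrite mulrn_wge0 // pi_ge0.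
rewrite S addrK -{2}(subr0 (pi *+ 2)) -[X in _ * X](ger0_norm (x := pi *+ 2 - 0)) ?subr0 //.
rewrite -{2}(subr0 (pi *+ 2)); apply: cI_bound => // t _.
rewrite nmM; apply: ler_pM; rewrite ?nm_ge0 // nmM; apply: ler_pM; rewrite ?nm_ge0 //.
  by rewrite nmX nmM nmV nmM nm_circ mulr1 nm_real gtr0_norm.
exact: nm_kern.
Qed.

(** In the geometric expansion of the kernel only the constant term has a nonzero integral, and the
    remainder tends to 0. *)
Lemma kern_int h : nm h < rho -> cI (kern h) 0 (pi *+ 2) = (pi *+ 2)%:C.
Proof.
move=> hr; apply/eqP; rewrite -subr_eq0; apply/eqP/nm_le0/ler_addgt0Pr => e e0.
rewrite add0r.
have pi20 : 0 <= pi *+ 2 :> R by rewrite mulrn_wge0 // pi_ge0.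
have q1 : 0 <= nm h / rho < 1.
  by rewrite divr_ge0 ?nm_ge0 ?(ltW rho0) //= ltr_pdivrMr // mul1r.
have C0 : 0 <= 2 * (rho / (rho - nm h)) * (pi *+ 2).
  by rewrite !mulr_ge0 // ?(ltW rho0) // invr_ge0 subr_ge0 ltW.
have [m mP] := nm_pow_small q1 e0 C0.
(* At least one term is needed for the constant term to be present. *)
have [m' m'E] : exists m', (nm h / rho) ^+ m'.+1 <= (nm h / rho) ^+ m.
  exists m; rewrite exprS -[leRHS]mul1r ler_wpM2r ?exprn_ge0 //; case/andP: q1 => // _ /ltW //.
have := @circle_expand (fun=> 1) h m'.+1 (fun z => ccont_cst 1 z) hr 1 (fun t => _).
under eq_fun do rewrite mul1r.
rewrite big_ord_recl big1 => [|j _]; last first.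
  rewrite (_ : (fun t => _) = (fun t => 0 + rho%:C^-1 ^+ j.+1 * (circ t)^-1 ^+ j.+1)); last first.
    by apply/funext => t; rewrite mul1r add0r invfM exprMn.
  rewrite (cI_lin (p := fun=> 0)); last 3 first.
  - by move=> t; apply: rcont_const.
  - exact: rcont_inv_circ.
  - under eq_fun do rewrite add0r; move=> t.
    exact: rcontM (@rcont_const (rho%:C^-1 ^+ j.+1) t) (@rcont_inv_circ j.+1 t).
  by rewrite cI_circ_pow // cI_cst !(mul0r, mulr0, addr0).
under [in X in _ - X]eq_fun do rewrite mul1r expr0.
rewrite cI_cst expr0 !mul1r subr0 addr0 => H.
apply: le_trans (H _) _; first by rewrite nm1.
apply: le_trans mP; apply: le_trans (ler_wpM2l C0 m'E).
by rewrite le_eqVlt; apply/orP; left; apply/eqP; ring.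
Qed.

Lemma taylor_circle f B : ccontT f ->
  (forall z, sq c r z -> exists l, cderiv f z l) ->
  (forall t, nm (f (path t)) <= B) ->
  exists A : nat -> R[i], forall m h, nm h < rho ->
    nm (f (c + h) - \sum_(j < m) A j * h ^+ j) <=
    2 * B * (nm h / rho) ^+ m * (rho / (rho - nm h)).
Proof.
move=> cf df HB.
have pi20 : 0 < pi *+ 2 :> R by rewrite pmulrn_rgt0 // pi_gt0.
have p20 : (pi *+ 2)%:C != 0 :> R[i] by rewrite -nm_eq0 nm_real normr_eq0 gt_eqF.
exists (fun j => (pi *+ 2)%:C^-1 * cI (fun t => f (path t) * (rho%:C * circ t)^-1 ^+ j) 0 (pi *+ 2)).
move=> m h hr; have := circle_expand m cf hr HB.
rewrite cauchy_kern // kern_int // -(ler_pM2r (_ : 0 < (pi *+ 2)^-1)) ?invr_gt0 //.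
set S := \sum_(j < m) _; set T := \sum_(j < m) _.
have -> : T = (pi *+ 2)%:C^-1 * S by rewrite mulr_sumr; apply: eq_bigr => j _; ring.
have -> : nm (f (c + h) * (pi *+ 2)%:C - S) / (pi *+ 2) = nm (f (c + h) - (pi *+ 2)%:C^-1 * S).
  rewrite -{2}(gtr0_norm pi20) -nm_real -nmV -nmM; congr nm.
  by rewrite mulrBl mulfK // mulrC.
by move=> H; apply: le_trans H _; rewrite mulfK ?gt_eqF // !mulrA.
Qed.

End OneCircle.

End Cauchy.

(** * Consequences of the Taylor expansion *)

Section Holomorphy.
Context {R : realType}.
Implicit Types (f F g : R[i] -> R[i]) (c h z w : R[i]).

Definition holo_on (D : R[i] -> bool) f := forall z, D z -> exists l, cderiv f z l.

Definition clip (rho x : R) := Num.max (- rho) (Num.min rho x).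

Lemma clip_lip rho x y : `|clip rho x - clip rho y| <= `|x - y|.
Proof.
have lip (u v w : R) : `|Num.max w u - Num.max w v| <= `|u - v| /\ `|Num.min w u - Num.min w v| <= `|u - v|.
  have := ler_norm (u - v); have := ler_norm (- (u - v)); rewrite normrN !ler_norml.
  by case: (leP w u) => a1; case: (leP w v) => a2 h2 h1; split; apply/andP; split; lra.
exact: le_trans (lip _ _ _).1 (lip _ _ _).2.
Qed.

Lemma clip_id rho x : `|x| <= rho -> clip rho x = x.
Proof.
rewrite ler_norml => /andP[h1 h2]; rewrite /clip (min_idPr h2).
by apply/max_idPr.
Qed.

Lemma clip_le rho x : 0 <= rho -> `|clip rho x| <= rho.
Proof.
move=> r0; rewrite /clip ler_norml le_max lexx /= ge_max ge_min lexx /= andbT.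
by lra.
Qed.

(** A continuous retraction of the plane onto a closed square. Composed with it, a function
    holomorphic on a larger square becomes continuous everywhere, as the integrals [cI] require, and
    keeps its derivatives inside. *)
Definition clamp c rho z : R[i] := c + (clip rho (Re (z - c)) +i* clip rho (Im (z - c))).

Lemma clamp_id c rho z : `|Re (z - c)| <= rho -> `|Im (z - c)| <= rho -> clamp c rho z = z.
Proof.
move=> h1 h2; rewrite /clamp !clip_id //.
by case: z c {h1 h2} => a b [a' b'] /=; rewrite /GRing.add /= !subrKC.
Qed.

Lemma ccont_clamp c rho : ccontT (clamp c rho).
Proof.
move=> z e e0; exists (e / 2); first by rewrite divr_gt0.
move=> h he; rewrite /clamp opprD addrACA subrr add0r.
apply: le_trans (nm_le_ReIm _) _; rewrite /=.
apply: le_trans (lerD (clip_lip _ _ _) (clip_lip _ _ _)) _.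
have -> : Re (z + h - c) - Re (z - c) = Re h by rewrite !(cReD, cReN); ring.
have -> : Im (z + h - c) - Im (z - c) = Im h by rewrite !(cImD, cImN); ring.
by have := Re_nm h; have := Im_nm h; lra.
Qed.

Lemma sqW c r r' z : r <= r' -> sq c r z -> sq c r' z.
Proof. by move=> rr /andP[h1 h2]; apply/andP; split; apply: lt_le_trans rr. Qed.

Lemma clamp_sq c rho r z : 0 <= rho -> rho < r -> sq c r (clamp c rho z).
Proof.
move=> r0 rr; apply/andP; rewrite /clamp addrC addKr /=.
by split; apply: le_lt_trans rr; apply: clip_le.
Qed.

Lemma sq_center c r : 0 < r -> sq c r c.
Proof. by move=> r0; rewrite /sq subrr /= normr0 r0. Qed.

Lemma sq_trans c r z s w : `|Re (z - c)| <= r -> `|Im (z - c)| <= r -> sq z s w -> sq c (r + s) w.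
Proof.
move=> h1 h2 /andP[h3 h4]; rewrite /sq (_ : w - c = (z - c) + (w - z)); last by ring.
rewrite (cReD (z - c)) (cImD (z - c)); apply/andP; split.
  by apply: le_lt_trans (ler_normD _ _) _; apply: ler_ltD.
by apply: le_lt_trans (ler_normD _ _) _; apply: ler_ltD.
Qed.

Lemma clamp_comp f c rho r : 0 < rho -> rho < r -> holo_on (sq c r) f ->
  ccontT (fun z => f (clamp c rho z)) /\
  (forall z, sq c rho z -> forall l, cderiv f z l -> cderiv (fun z => f (clamp c rho z)) z l).
Proof.
move=> r0 rr hf; split.
  move=> z; have [l lP] := hf _ (clamp_sq c z (ltW r0) rr).
  exact: ccont_comp (ccont_clamp _ _ _) (cderiv_ccont lP).
move=> z zr l lP; have [d d0 D] := sq_open zr.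
apply: cderiv_near d0 _ lP => w wd.
by have /andP[/ltW h1 /ltW h2] := D _ (sq_nm wd); rewrite clamp_id.
Qed.

Lemma ccont_bounded f (x0 x1 y0 y1 : R) : ccontT f -> x0 <= x1 -> y0 <= y1 ->
  exists B, forall s t, x0 <= s <= x1 -> y0 <= t <= y1 -> nm (f (s +i* t)) <= B.
Proof.
move=> cf hx hy.
pose P (I J : R * R) := exists B, forall s t, I.1 <= s <= I.2 -> J.1 <= t <= J.2 ->
  nm (f (s +i* t)) <= B.
suff : P (x0, x1) (y0, y1) by [].
apply: bisection => // [[a b] [c d] K|p q _ _].
- have [B1 H1] := K (_, _) (_, _) (or_introl erefl) (or_introl erefl).
  have [B2 H2] := K (_, _) (_, _) (or_intror erefl) (or_introl erefl).
  have [B3 H3] := K (_, _) (_, _) (or_introl erefl) (or_intror erefl).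
  have [B4 H4] := K (_, _) (_, _) (or_intror erefl) (or_intror erefl).
  exists (Num.max (Num.max B1 B2) (Num.max B3 B4)) => s t /= /andP[s1 s2] /andP[t1 t2].
  rewrite !le_max.
  have [sl|/ltW sl] := leP s ((a + b) / 2); have [tl|/ltW tl] := leP t ((c + d) / 2).
  + by rewrite H1 //= ?s1 ?s2 ?t1 ?t2.
  + by rewrite H3 ?orbT //= ?s1 ?s2 ?t1 ?t2 ?sl ?tl.
  + by rewrite H2 ?orbT //= ?s1 ?s2 ?t1 ?t2 ?sl ?tl.
  + by rewrite H4 ?orbT //= ?s1 ?s2 ?t1 ?t2 ?sl ?tl.
- have [d d0 D] := cf (p +i* q) 1 ltr01; exists (d / 2); first by rewrite divr_gt0.
  move=> [a b] [c k] /= /andP[ap pb] /andP[cq qk] _ _ _ _ h1 h2.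
  exists (nm (f (p +i* q)) + 1) => s t /= /andP[s1 s2] /andP[t1 t2].
  have -> : f (s +i* t) = f (s +i* t) - f (p +i* q) + f (p +i* q) by rewrite subrK.
  apply: le_trans (nmD _ _) _; rewrite addrC lerD2l.
  have := D ((s +i* t) - (p +i* q)); rewrite (_ : _ + (_ - _) = s +i* t); [apply|by ring].
  apply: le_lt_trans (nm_le_ReIm _) _; rewrite /=.
  have b1 : `|s - p| < d / 2 by rewrite ltr_norml; apply/andP; split; lra.
  have b2 : `|t - q| < d / 2 by rewrite ltr_norml; apply/andP; split; lra.
  by lra.
Qed.

Lemma holo_bounded f c r rho : 0 < rho -> rho < r -> holo_on (sq c r) f ->
  exists2 B, 0 <= B & forall z, sq c rho z -> nm (f z) <= B.
Proof.
move=> r0 rr /(clamp_comp r0 rr)[cf _].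
have [||B HB] := @ccont_bounded _ (Re c - rho) (Re c + rho) (Im c - rho) (Im c + rho) cf; [lra|lra|].
have HB' z : sq c rho z -> nm (f z) <= B.
  move=> /andP[/ltW h1 /ltW h2]; rewrite -(clamp_id h1 h2) [in X in clamp _ _ X](complex_split z).
  have -> : (Re z)%:C + 'i * (Im z)%:C = Re z +i* Im z by rewrite -complex_split; case: (z).
  move: h1 h2; rewrite !(cReD, cReN, cImD, cImN) !ler_norml => /andP[? ?] /andP[? ?].
  by apply: HB; apply/andP; split; lra.
exists B => //; apply: le_trans (nm_ge0 _) (HB' c (sq_center c r0)).
Qed.

Lemma taylor_bd f c r rho B : 0 < rho -> rho < r -> holo_on (sq c r) f ->
  (forall z, sq c r z -> nm (f z) <= B) ->
  exists A : nat -> R[i], forall m h, nm h < rho ->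
    nm (f (c + h) - \sum_(j < m) A j * h ^+ j) <=
    2 * B * (nm h / rho) ^+ m * (rho / (rho - nm h)).
Proof.
move=> r0 rr hf HB; pose r' := (rho + r) / 2.
have [r1 r2 r3] : [/\ rho < r', r' < r & 0 < r'] by rewrite /r'; split; lra.
have [cf df] := clamp_comp r3 r2 hf.
have [A HA] := taylor_circle (B := B) r0 r1 cf
  (fun z zr => let: ex_intro l lP := hf z (sqW (ltW r2) zr) in ex_intro _ l (df z zr l lP))
  (fun t => HB _ (clamp_sq _ _ (ltW r3) r2)).
exists A => m h hr; have := HA m h hr; rewrite clamp_id //.
  by rewrite addrC addKr; apply: le_trans (Re_nm _) _; lra.
by rewrite addrC addKr; apply: le_trans (Im_nm _) _; lra.
Qed.

Lemma quad_cderiv f c l (d K : R) : 0 < d -> 0 <= K ->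
  (forall h, nm h < d -> nm (f (c + h) - f c - l * h) <= K * nm h ^+ 2) -> cderiv f c l.
Proof.
move=> d0 K0 H e e0; exists (Num.min d (e / (K + 1))).
  by rewrite lt_min d0 divr_gt0 // ltr_wpDl.
move=> h; rewrite lt_min => /andP[/H hd]; rewrite ltr_pdivlMr ?ltr_wpDl // => he.
apply: le_trans hd _; rewrite expr2 mulrA ler_wpM2r ?nm_ge0 //.
by have := nm_ge0 h; nra.
Qed.

(** Taylor expansion on the circle of radius r/2: for |h| <= r/4 the kernel factor is at most 2,
    which gives 16 B. At h = r/4 the quadratic error is at most B, so the linear term is at most 3
    B, whence 12 B / r. *)
Lemma holo_quad f c r B : 0 < r -> holo_on (sq c r) f ->
  (forall z, sq c r z -> nm (f z) <= B) ->
  exists l, [/\ cderiv f c l, nm l <= 12 * B / r &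
    forall h, nm h <= r / 4 -> nm (f (c + h) - f c - l * h) <= 16 * B * (nm h / r) ^+ 2].
Proof.
move=> r0 hf HB; have [h0 h1] : 0 < r / 2 /\ r / 2 < r by split; lra.
have B0 : 0 <= B := le_trans (nm_ge0 _) (HB c (sq_center c r0)).
have [A HA] := taylor_bd h0 h1 hf HB.
have A0 : A 0%N = f c.
  have := HA 1%N 0; rewrite nm0 mul0r expr0n mulr0 mul0r addr0 => /(_ h0)/nm_le0.
  by rewrite big_ord1 expr0 mulr1 => /eqP; rewrite subr_eq0 => /eqP.
have Q h : nm h <= r / 4 -> nm (f (c + h) - f c - A 1%N * h) <= 16 * B * (nm h / r) ^+ 2.
  move=> hr; have := HA 2%N h; rewrite !big_ord_recl big_ord0 /= /bump /= A0 expr0 mulr1 expr1 addr0.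
  rewrite opprD addrA => H; apply: le_trans (H _) _; first by lra.
  have -> : 2 * B * (nm h / (r / 2)) ^+ 2 * (r / 2 / (r / 2 - nm h)) =
     8 * B * (nm h / r) ^+ 2 * (r / 2 / (r / 2 - nm h)) by field; lra.
  have K : r / 2 / (r / 2 - nm h) <= 2 by rewrite ler_pdivrMr; lra.
  have P0 : 0 <= 8 * B * (nm h / r) ^+ 2.
    by rewrite mulr_ge0 ?exprn_ge0 ?divr_ge0 ?nm_ge0 ?(ltW r0) // mulr_ge0.
  by have := ler_wpM2l P0 K; lra.
exists (A 1%N); split=> //.
- apply: (@quad_cderiv _ _ _ (r / 4) (16 * B / r ^+ 2)); first by rewrite divr_gt0.
    by rewrite divr_ge0 ?exprn_ge0 ?mulr_ge0 ?(ltW r0).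
  by move=> h /ltW /Q; rewrite expr_div_n; congr (_ <= _); field; lra.
- have n4 : nm (r / 4)%:C = r / 4 by rewrite nm_real ger0_norm; lra.
  have := Q (r / 4)%:C; rewrite n4 lexx => /(_ isT) q.
  have b1 : nm (f (c + (r / 4)%:C)) <= B.
    by apply: HB; apply: sq_nm; rewrite addrC addKr n4; lra.
  have b2 : nm (f c) <= B by apply: HB; apply: sq_center.
  have : nm (A 1%N * (r / 4)%:C) <= 3 * B.
    have -> : A 1%N * (r / 4)%:C = f (c + (r / 4)%:C) - f c -
      (f (c + (r / 4)%:C) - f c - A 1%N * (r / 4)%:C) by ring.
    apply: le_trans (nmB _ _) _; apply: le_trans (lerD (nmB _ _) q) _.
    have -> : 16 * B * (r / 4 / r) ^+ 2 = B by field; lra.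
    by lra.
  by rewrite nmM n4 ler_pdivlMr //; lra.
Qed.

Lemma complex_cauchy_cvg (u : nat -> R[i]) :
  (forall e : R, 0 < e -> exists N0 : nat, forall N M, (N0 <= N)%N -> (N0 <= M)%N ->
     nm (u N - u M) <= e) ->
  exists l, forall e : R, 0 < e -> exists N0 : nat, forall N, (N0 <= N)%N -> nm (u N - l) <= e.
Proof.
move=> H.
have C (p : R[i] -> R) : (forall z, `|p z| <= nm z) -> {morph p : x y / x - y} ->
    cvg (p (u n) @[n --> \oo]).
  move=> pn pB; apply/cauchy_cvgP/cauchy_exP => e e0.
  have e2 : 0 < e / 2 by rewrite divr_gt0.
  have [N0 HN] := H _ e2; exists (p (u N0)); exists N0 => // n /= Nn.
  rewrite /ball /= -pB; apply: le_lt_trans (pn _) _.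
  by apply: le_lt_trans (HN _ _ (leqnn _) Nn) _; lra.
have cr := C (@complex.Re R) Re_nm (fun x y => etrans (cReD _ _) (congr1 _ (cReN _))).
have ci := C (@complex.Im R) Im_nm (fun x y => etrans (cImD _ _) (congr1 _ (cImN _))).
exists (lim (Re (u n) @[n --> \oo]) +i* lim (Im (u n) @[n --> \oo])) => e e0.
have e2 : 0 < e / 2 by rewrite divr_gt0.
move: cr => /cvgrPdist_le/(_ _ e2)[N1 _ H1]; move: ci => /cvgrPdist_le/(_ _ e2)[N2 _ H2].
exists (maxn N1 N2) => N; rewrite geq_max => /andP[/H1 h1 /H2 h2].
rewrite nmBC; apply: le_trans (nm_le_ReIm _) _; move: h1 h2 => /=.
by case: (u N) => a b /=; lra.
Qed.

(** The estimates of [holo_quad] for the differences fs N - fs M make the derivatives at c a Cauchy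
    sequence and bound the second-order errors uniformly. The convergence of the derivatives is part
    of the conclusion because zeta'(-j) is obtained through it. *)
Lemma weierstrass (fs : nat -> R[i] -> R[i]) f c r : 0 < r ->
  (forall N, holo_on (sq c r) (fs N)) ->
  (forall e : R, 0 < e -> exists N0 : nat, forall N, (N0 <= N)%N ->
     forall z, sq c r z -> nm (fs N z - f z) <= e) ->
  exists2 l, cderiv f c l & forall ds, (forall N, cderiv (fs N) c (ds N)) ->
    forall e : R, 0 < e -> exists N0 : nat, forall N, (N0 <= N)%N -> nm (ds N - l) <= e.
Proof.
move=> r0 hfs H.
have /choice[ds dsP] N : exists l, cderiv (fs N) c l.
  by apply: hfs; apply: sq_center.
have hB N M : holo_on (sq c r) (fun z => fs N z - fs M z).
  by move=> z zr; have [l lP] := hfs N z zr; have [m mP] := hfs M z zr;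
    exists (l - m); apply: cderivB.
have dist e N0 : (forall N, (N0 <= N)%N -> forall z, sq c r z -> nm (fs N z - f z) <= e) ->
    forall N M, (N0 <= N)%N -> (N0 <= M)%N -> forall z, sq c r z -> nm (fs N z - fs M z) <= 2 * e.
  move=> HN N M hN hM z zr; apply: le_trans (nm_dist (f z) _ _) _.
  by rewrite (nmBC (f z)); have := HN N hN z zr; have := HN M hM z zr; lra.
have Q e N0 : (forall N, (N0 <= N)%N -> forall z, sq c r z -> nm (fs N z - f z) <= e) ->
    forall N M, (N0 <= N)%N -> (N0 <= M)%N ->
    nm (ds N - ds M) <= 12 * (2 * e) / r /\
    forall h, nm h <= r / 4 -> nm ((fs N (c + h) - fs M (c + h)) - (fs N c - fs M c) - (ds N - ds M) * h)
      <= 16 * (2 * e) * (nm h / r) ^+ 2.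
  move=> HN N M hN hM; have [l [l1 l2 l3]] := holo_quad r0 (hB N M) (dist _ _ HN N M hN hM).
  by have E := cderiv_uniq l1 (cderivB (dsP N) (dsP M)); rewrite E in l2 l3.
have [l lP] : exists l, forall e : R, 0 < e ->
    exists N0 : nat, forall N, (N0 <= N)%N -> nm (ds N - l) <= e.
  apply: complex_cauchy_cvg => e e0.
  have e1 : 0 < e * r / 24 by rewrite divr_gt0 ?mulr_gt0.
  have [N0 HN0] := H _ e1; exists N0 => N M hN hM.
  have [h1 _] := Q _ _ HN0 N M hN hM; apply: le_trans h1 _.
  by rewrite ler_pdivrMr //; lra.
exists l; last first.
  move=> ds' ds'P e /lP[N0 HN]; exists N0 => N /HN.
  by rewrite (cderiv_uniq (ds'P N) (dsP N)).
have [N0 HN0] := H 1 ltr01.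
(* For fs N - fs N0 the quadratic estimate is uniform in N >= N0, with constant 16 times 2, and it
   passes to the limit in N. *)
suff D : cderiv (fun z => f z - fs N0 z) c (l - ds N0).
  have := cderivD D (dsP N0); rewrite subrK; congr (cderiv _ c l).
  by apply/funext => z; rewrite subrK.
apply: (@quad_cderiv _ _ _ (r / 4) (32 / r ^+ 2)); first by rewrite divr_gt0.
  by rewrite divr_ge0 ?exprn_ge0 ?(ltW r0).
move=> h hr; apply/ler_addgt0Pr => e e0.
have K0 : 0 < 2 + nm h by have := nm_ge0 h; lra.
have e1 : 0 < e / (2 + nm h) by rewrite divr_gt0.
have [N1 HN1] := H _ e1; have [N2 HN2] := lP _ e1.
pose N := maxn N0 (maxn N1 N2).
have [n0 n1 n2] : [/\ (N0 <= N)%N, (N1 <= N)%N & (N2 <= N)%N].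
  by rewrite /N !leq_max !leqnn !orbT.
have [_ /(_ h (ltW hr)) q] := Q _ _ HN0 N N0 n0 (leqnn _).
have s1 : sq c r (c + h) by apply: sq_nm; rewrite addrC addKr; lra.
have t1 := HN1 N n1 _ s1; have t2 := HN1 N n1 c (sq_center c r0); have t3 := HN2 N n2.
set X := _ - _ - _ in q.
have -> : f (c + h) - fs N0 (c + h) - (f c - fs N0 c) - (l - ds N0) * h =
  X - ((fs N (c + h) - f (c + h)) - (fs N c - f c) - (ds N - l) * h) by rewrite /X; ring.
apply: le_trans (nmB _ _) _; apply: lerD.
  by apply: le_trans q _; rewrite le_eqVlt; apply/orP; left; apply/eqP; field; lra.
apply: le_trans (nmB _ _) _; apply: le_trans (lerD (nmB _ _) (lexx _)) _; rewrite nmM.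
apply: le_trans (lerD (lerD t1 t2) (ler_wpM2r (nm_ge0 h) t3)) _.
by rewrite le_eqVlt; apply/orP; left; apply/eqP; field; lra.
Qed.

(** On a smaller square the derivative is the uniform limit of difference quotients with real steps
    tending to 0, by the quadratic estimate, so Weierstrass' theorem applies to it. *)
Lemma holo_derive1 f c r : 0 < r -> holo_on (sq c r) f ->
  exists l, cderiv (derive1 f) c l.
Proof.
move=> r0 hf; have [a0 a1] : 0 < r * (3 / 4) /\ r * (3 / 4) < r by split; lra.
have [B B0 HB] := holo_bounded a0 a1 hf.
pose s N : R := r / 8 / N.+1%:R.
have s0 N : 0 < s N by rewrite /s !divr_gt0.
have s1 N : s N <= r / 8.
  by rewrite /s ler_pdivrMr // ler_peMr ?ler1n //; lra.
have sn N : nm (s N)%:C = s N by rewrite nm_real gtr0_norm.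
have sN0 N : (s N)%:C != 0 :> R[i] by rewrite -nm_gt0 sn.
pose fs N z := (s N)%:C^-1 * (f (z + (s N)%:C) - f z).
have r4 : 0 < r / 4 by rewrite divr_gt0.
have sh N z : sq c (r / 4) z -> sq c r (z + (s N)%:C).
  move=> /andP[/ltW h1 /ltW h2]; have := sq_trans (s := r / 4) (w := z + (s N)%:C) h1 h2.
  move=> h; apply: (sqW _ (h _)); first by lra.
  by apply: sq_nm; rewrite addrC addKr sn; have := s1 N; lra.
have [l lP _] : exists2 l, cderiv (derive1 f) c l & forall ds, (forall N, cderiv (fs N) c (ds N)) ->
    forall e : R, 0 < e -> exists N0 : nat, forall N, (N0 <= N)%N -> nm (ds N - l) <= e.
  apply: (weierstrass r4) => [N z zr|e e0].
    have [l1 l1P] := hf _ (sh N _ zr).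
    have [l2 l2P] : exists l, cderiv f z l by apply: hf; apply: sqW zr; lra.
    exists ((s N)%:C^-1 * (l1 - l2)); apply: cderivZ; apply: cderivB => //.
    move=> e /l1P[d d0 D]; exists d => // h /D.
    by congr (nm (f _ - _ - _) <= _); ring.
  pose K := 16 * B * (r / 8) / (r / 2) ^+ 2.
  have K0 : 0 <= K by rewrite /K divr_ge0 ?exprn_ge0 ?mulr_ge0 // ltW; lra.
  exists (Num.bound (K / e)) => N hN z zr.
  have [h1 h2] : `|Re (z - c)| <= r / 4 /\ `|Im (z - c)| <= r / 4.
    by move: zr => /andP[/ltW ? /ltW ?].
  have sub w : sq z (r / 2) w -> sq c (r * (3 / 4)) w.
    by move=> zw; have := sq_trans h1 h2 zw; apply: sqW; lra.
  have [l [l1 _ l3]] : exists l, [/\ cderiv f z l, nm l <= 12 * B / (r / 2) &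
    forall h, nm h <= r / 2 / 4 -> nm (f (z + h) - f z - l * h) <= 16 * B * (nm h / (r / 2)) ^+ 2].
    apply: holo_quad; first by rewrite divr_gt0.
      by move=> w /sub /(sqW (ltW a1)); apply: hf.
    by move=> w /sub; apply: HB.
  rewrite (cderiv_derive1 l1) /fs.
  have -> : (s N)%:C^-1 * (f (z + (s N)%:C) - f z) - l =
    (s N)%:C^-1 * (f (z + (s N)%:C) - f z - l * (s N)%:C) by field; apply: sN0.
  rewrite nmM nmV sn ler_pdivrMl //; apply: le_trans (l3 _ _) _.
    by rewrite sn; have := s1 N; lra.
  rewrite sn.
  have -> : 16 * B * (s N / (r / 2)) ^+ 2 = s N * (K / N.+1%:R).
    rewrite /K /s; field; rewrite lt0r_neq0 //=.
    by rewrite gt_eqF.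
  rewrite ler_wpM2l ?(ltW (s0 N)) // ler_pdivrMr // mulrC -ler_pdivrMr //.
  have Ke : 0 <= K / e by rewrite divr_ge0 // ltW.
  apply: le_trans (ltW (archi_boundP Ke)) _.
  by rewrite ler_nat; apply: leq_trans hN _.
by exists l.
Qed.

Lemma holo_derive1n f c r k : holo_on (sq c r) f -> holo_on (sq c r) (derive1n k f).
Proof.
elim: k => // k IH hf z zr; rewrite derive1nS.
have [d d0 D] := sq_open zr; apply: (holo_derive1 d0) => w /D; exact: IH.
Qed.

(** Zeros on a real segment starting at c annihilate the Taylor coefficients one after the other;
    the expansion then gives 0 on the disc inscribed in the square. *)
Lemma identity_sq f c r (d : R) : 0 < d -> holo_on (sq c r) f ->
  (forall t : R, 0 < t < d -> f (c + t%:C) = 0) ->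
  forall h, nm h < r -> f (c + h) = 0.
Proof.
move=> d0 hf fz h hr; pose rho := (nm h + r) / 2; pose r' := (rho + r) / 2.
have [p1 p2 p3 p4 p5] : [/\ nm h < rho, rho < r', r' < r, 0 < rho & 0 < r'].
  by rewrite /r' /rho; have := nm_ge0 h; split; lra.
have [B B0 HB] := holo_bounded p5 p3 hf.
have hf' : holo_on (sq c r') f by move=> z /(sqW (ltW p3)) /hf.
have [A HA] := taylor_bd p4 p2 hf' HB.
have Az j : A j = 0.
  have [m] := ubnP j; elim: m j => // m IH j; rewrite ltnS => jm.
  apply: nm_le0; apply/ler_addgt0Pr => e e0; rewrite add0r.
  (* The lower coefficients being 0, |A_j| t^j <= K t^(j+1) for 0 < t <= rho/2; taking t <= e / (K +
     1) makes K t <= e. *)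
  pose K := 4 * B / rho ^+ j.+1.
  have K0 : 0 <= K by rewrite /K; apply: divr_ge0; [lra|rewrite exprn_ge0 // ltW].
  have K1 : 0 < K + 1 by lra.
  pose t := Num.min (Num.min (d / 2) (rho / 2)) (e / (K + 1)).
  have t0 : 0 < t.
    by rewrite !lt_min; apply/andP; split; [apply/andP; split; lra|rewrite divr_gt0].
  have [t1 t2 t3] : [/\ t <= d / 2, t <= rho / 2 & t <= e / (K + 1)].
    by rewrite /t !ge_min !lexx !orbT.
  have tn : nm t%:C = t by rewrite nm_real gtr0_norm.
  have := HA j.+1 t%:C; rewrite tn fz; last by apply/andP; split; lra.
  rewrite big_ord_recr /= big1 => [|i _]; last by rewrite IH ?mul0r //; apply: leq_trans jm.
  rewrite !add0r nmN nmM nmX tn => H.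
  have {}H : nm (A j) * t ^+ j <= K * t * t ^+ j.
    apply: le_trans (H _) _; first by lra.
    have c2 : rho / (rho - t) <= 2 by rewrite ler_pdivrMr; lra.
    have -> : K * t * t ^+ j = 2 * B * (t / rho) ^+ j.+1 * 2.
      have E (x y : R) : y != 0 ->
          4 * B / y ^+ j.+1 * x * x ^+ j = 2 * B * (x / y) ^+ j.+1 * 2.
        by move=> y0; rewrite expr_div_n [x ^+ j.+1]exprS; field; rewrite expf_neq0.
      by apply: E; rewrite gt_eqF.
    rewrite ler_wpM2l // !mulr_ge0 // exprn_ge0 // divr_ge0 // ltW //.
  move: H; rewrite ler_pM2r ?exprn_gt0 // => H; apply: le_trans H _.
  move: t3; rewrite ler_pdivlMr //; nra.
apply: nm_le0; apply/ler_addgt0Pr => e e0; rewrite add0r.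
have C0 : 0 <= 2 * B * (rho / (rho - nm h)).
  by apply: mulr_ge0; [lra|apply: divr_ge0; lra].
have q1 : 0 <= nm h / rho < 1.
  by rewrite divr_ge0 ?nm_ge0 ?(ltW p4) //= ltr_pdivrMr // mul1r.
have [m mP] := nm_pow_small q1 e0 C0.
have := HA m h p1; rewrite big1 ?subr0 => [H|j _]; last by rewrite Az mul0r.
by apply: le_trans H _; apply: le_trans mP; rewrite mulrAC.
Qed.

End Holomorphy.

(** * Exponential and logarithm *)

Section ExpLog.
Context {R : realType}.
Implicit Types (c h z w : R[i]).

Lemma cexpD z w : cexp (z + w) = cexp z * cexp w.
Proof.
rewrite /cexp cReD cImD expRD cosD sinD rmorphM /=.
by rewrite mulrACA; congr (_ * _); apply/eqP; rewrite eq_complex /=; apply/andP; split; apply/eqP; ring.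
Qed.

Lemma cexp_real (x : R) : cexp x%:C = (expR x)%:C.
Proof. by rewrite /cexp /= cos0 sin0 mulr1. Qed.

Lemma cexp0 : cexp 0 = 1 :> R[i].
Proof. by rewrite (cexp_real 0) expR0. Qed.

Lemma nm_cexp z : nm (cexp z) = expR (Re z).
Proof. by rewrite nmM nm_real (nm_circ (Im z)) mulr1 ger0_norm ?expR_ge0. Qed.

Lemma cexp_neq0 z : cexp z != 0.
Proof. by rewrite -nm_gt0 nm_cexp expR_gt0. Qed.

Lemma cexpN z : cexp (- z) = (cexp z)^-1.
Proof.
by apply: (mulfI (cexp_neq0 z)); rewrite -cexpD subrr cexp0 divff ?cexp_neq0.
Qed.

(** The real and imaginary parts of exp(h) - 1 - h are regrouped around the first-order expansions
    of exp, cos and sin at 0. *)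
Lemma cexp_small (e : R) : 0 < e ->
  exists2 d : R, 0 < d & forall h, nm h < d -> nm (cexp h - 1 - h) <= e * nm h.
Proof.
move=> e0; have e1 : 0 < Num.min 1 (e / 16) by rewrite lt_min ltr01 divr_gt0.
have [d1 d10 D1] := (derive_epsP _ _ _).1 (is_derive_expR (0 : R)) _ e1.
have [d2 d20 D2] := (derive_epsP _ _ _).1 (is_derive_cos (0 : R)) _ e1.
have [d3 d30 D3] := (derive_epsP _ _ _).1 (is_derive_sin (0 : R)) _ e1.
move: e1 D1 D2 D3; set e' := Num.min 1 _ => e1 D1 D2 D3.
have [e'1 e'8] : e' <= 1 /\ e' <= e / 16 by rewrite /e' !ge_min !lexx orbT.
exists (Num.min (Num.min d1 d2) (Num.min d3 (Num.min 1 (e / 16)))).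
  by rewrite !lt_min d10 d20 d30 ltr01 divr_gt0.
move=> h; rewrite !lt_min => /andP[/andP[h1 h2] /and3P[h3 h4 h5]].
move: (D1 (Re h)) (D2 (Im h)) (D3 (Im h)).
rewrite !add0r expR0 cos0 sin0 oppr0 mul0r !mul1r !subr0 !addr0.
move=> /(_ (le_lt_trans (Re_nm h) h1)) a1 /(_ (le_lt_trans (Im_nm h) h2)) a2.
move=> /(_ (le_lt_trans (Im_nm h) h3)) a3.
apply: le_trans (nm_le_ReIm _) _.
have -> : Re (cexp h - 1 - h) = (expR (Re h) - 1 - Re h) + expR (Re h) * (cos (Im h) - 1).
  by rewrite !(cReD, cReN) /cexp /=; ring.
have -> : Im (cexp h - 1 - h) = expR (Re h) * (sin (Im h) - Im h) + (expR (Re h) - 1) * Im h.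
  by rewrite !(cImD, cImN) /cexp /=; ring.
have [r i] := (Re_nm h, Im_nm h); have n0 := nm_ge0 h.
move: (Re h) (Im h) r i a1 a2 a3 => x y r i a1 a2 a3.
have [x0 y0] := (normr_ge0 x, normr_ge0 y).
have b1 : `|expR x - 1| <= 2 * `|x|.
  have -> : expR x - 1 = (expR x - 1 - x) + x by ring.
  by apply: le_trans (ler_normD _ _) _; have := ler_wpM2r x0 e'1; lra.
have b2 : expR x <= 3 by have := ler_norm (expR x - 1); lra.
have E0 := expR_ge0 x.
have c1 := ler_pM E0 (normr_ge0 _) b2 a2; have c2 := ler_pM E0 (normr_ge0 _) b2 a3.
have c3 : `|expR x - 1| * `|y| <= e / 4 * nm h.
  apply: ler_pM => //; lra.
apply: le_trans (lerD (ler_normD _ _) (ler_normD _ _)) _.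
rewrite !normrM (ger0_norm E0).
have d1' := ler_wpM2r x0 e'8; have d2' := ler_wpM2r y0 e'8.
have f1 : e * `|x| <= e * nm h by rewrite ler_wpM2l // ltW.
have f2 : e * `|y| <= e * nm h by rewrite ler_wpM2l // ltW.
have f3 : 0 <= e * nm h by rewrite mulr_ge0 // ltW.
lra.
Qed.

Lemma cderiv_cexp z : cderiv (@cexp R) z (cexp z).
Proof.
move=> e e0; have N0 : 0 < nm (cexp z) by rewrite nm_gt0 cexp_neq0.
have [d d0 D] := cexp_small (divr_gt0 e0 N0); exists d => // h /D H.
have -> : cexp (z + h) - cexp z - cexp z * h = cexp z * (cexp h - 1 - h).
  by rewrite cexpD; ring.
rewrite nmM; have := ler_wpM2l (ltW N0) H; congr (_ <= _).
by field; rewrite gt_eqF.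
Qed.

Lemma carg_range z : z != 0 -> -1 <= Re z / nm z <= 1.
Proof.
rewrite -nm_gt0 => z0; rewrite -ler_norml normrM normfV (gtr0_norm z0).
by rewrite ler_pdivrMr // mul1r Re_nm.
Qed.

Lemma cos_carg z : z != 0 -> cos (carg z) = Re z / nm z.
Proof.
move=> z0; have := carg_range z0 => zr; rewrite /carg -/(nm z).
by case: ifP => _; rewrite ?cosN acosK // in_itv /=.
Qed.

Lemma sin_carg z : z != 0 -> sin (carg z) = Im z / nm z.
Proof.
move=> z0; have zr := carg_range z0; rewrite /carg -/(nm z).
have n0 : 0 < nm z by rewrite nm_gt0.
have E : Num.sqrt (1 - (Re z / nm z) ^+ 2) = `|Im z| / nm z.
  have -> : 1 - (Re z / nm z) ^+ 2 = (Im z / nm z) ^+ 2.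
    have := sqr_nm z; rewrite !expr_div_n => h.
    have -> : Re z ^+ 2 = nm z ^+ 2 - Im z ^+ 2 by rewrite h; ring.
    by field; rewrite gt_eqF.
  by rewrite sqrtr_sqr normrM normfV (gtr0_norm n0).
case: ifPn => [i0|]; first by rewrite sin_acos // E ger0_norm.
by rewrite -ltNge => /ltr0_norm i0; rewrite sinN sin_acos // E i0 mulNr opprK.
Qed.

Lemma clogK z : z != 0 -> cexp (clog z) = z.
Proof.
move=> z0; have n0 : 0 < nm z by rewrite nm_gt0.
rewrite /cexp /clog -/(nm z) /= lnK ?posrE // cos_carg // sin_carg //.
apply/eqP; rewrite eq_complex /=.
have n1 : nm z != 0 by rewrite gt_eqF.
by rewrite !mul0r subr0 addr0 !(mulrC (nm z)) !divfK // !eqxx.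
Qed.

Lemma carg_unique z (rr t : R) : 0 < rr -> - pi < t <= pi ->
  Re z = rr * cos t -> Im z = rr * sin t -> nm z = rr /\ carg z = t.
Proof.
move=> r0 /andP[t1 t2] hr hi.
have nz : nm z = rr.
  rewrite nm_sqrt hr hi !exprMn -mulrDr cos2Dsin2 mulr1 sqrtr_sqr gtr0_norm //.
split=> //; rewrite /carg -/(nm z) nz hr mulrAC divff ?gt_eqF // mul1r.
have [t0|t0] := leP 0 t.
  have s0 : 0 <= sin t by apply: sin_ge0_pi; rewrite t0.
  by rewrite hi mulr_ge0 ?(ltW r0) // cosK // in_itv /= t0.
have s0 : 0 < sin (- t) by apply: sin_gt0_pi; apply/andP; split; lra.
have h : Im z < 0 by rewrite hi -oppr_gt0 -mulrN -sinN mulr_gt0.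
by rewrite leNgt h /= cosKN ?opprK // (ltW t1) ltW.
Qed.

Lemma clog_mul z w : z != 0 -> w != 0 -> - pi < carg z + carg w <= pi ->
  clog (z * w) = clog z + clog w.
Proof.
move=> z0 w0 H; have nz : 0 < nm z by rewrite nm_gt0.
have nw : 0 < nm w by rewrite nm_gt0.
have [] := carg_unique (z := z * w) (mulr_gt0 nz nw) H.
- rewrite cosD !cos_carg // !sin_carg // cReM; field.
  by rewrite !gt_eqF.
- rewrite sinD !cos_carg // !sin_carg // cImM; field.
  by rewrite !gt_eqF.
move=> h1 h2; rewrite /clog -!/(nm _) h1 h2 lnM ?posrE //.
Qed.

Lemma clog_real (x : R) : 0 < x -> clog x%:C = (ln x)%:C.
Proof.
move=> x0; rewrite /clog /carg -/(nm _) nm_real gtr0_norm //= lexx divff ?gt_eqF //.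
by rewrite acos1.
Qed.

Lemma clog1 : clog 1 = 0 :> R[i].
Proof. by rewrite (clog_real ltr01) ln1. Qed.

(** On the positive real axis the two cases of [carg] meet and acos is taken at the end of its
    domain; asin is taken in the interior of its own, which gives continuity of the argument at
    1. *)
Lemma carg_asin z : 0 < Re z -> carg z = asin (Im z / nm z).
Proof.
move=> r0; have z0 : z != 0 by apply/eqP => z0; move: r0; rewrite z0 ltxx.
rewrite -(sin_carg z0) sinK // in_itv /=.
have c0 : 0 < Re z / nm z by rewrite divr_gt0 // nm_gt0.
have /andP[_ c1] := carg_range z0.
have P := pi_gt0 R.
have a2 : acos (Re z / nm z) <= pi / 2.
  rewrite leNgt; apply/negP => h.
  have c2 : -1 <= Re z / nm z <= 1 by exact: carg_range.
  have := ltr_cos (R := R) (x := pi / 2) (y := acos (Re z / nm z)).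
  rewrite !in_itv /= acos_ge0 // acos_lepi // => /(_ _ isT); rewrite h acosK ?in_itv //= cos_pihalf.
  by move=> /(_ _)/esym; rewrite ltNge (ltW c0) /= => /(_ _)/wrap[] //; apply/andP; split; lra.
have a1 := acos_ge0 (carg_range z0).
by rewrite /carg -/(nm z); case: ifP => _; apply/andP; split; lra.
Qed.

Lemma clog_cont1 (e : R) : 0 < e ->
  exists2 d : R, 0 < d & forall h, nm h < d -> nm (clog (1 + h)) <= e.
Proof.
move=> e0; have e2 : 0 < e / 2 by rewrite divr_gt0.
have := @continuous_ln R 1 ltr01; move=> /cvgrPdist_le/(_ _ e2)/nbhs_ballP[d1 /= d10 D1].
have a0 : -1 < (0 : R) < 1 by apply/andP; split; lra.
have := @continuous_asin R 0 a0; move=> /cvgrPdist_le/(_ _ e2)/nbhs_ballP[d2 /= d20 D2].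
exists (Num.min d1 (Num.min (1 / 2) (d2 / 2))); first by rewrite !lt_min d10 !divr_gt0.
move=> h; rewrite !lt_min => /and3P[h1 h2 h3].
have n1 : 1 - nm h <= nm (1 + h).
  by have := nm_lerB 1 (- h); rewrite opprK nmN nm1.
have n2 : nm (1 + h) <= 1 + nm h by have := nmD 1 h; rewrite nm1.
have r0 : 0 < Re (1 + h).
  rewrite cReD /=; have := Re_nm h; rewrite ler_norml => /andP[? _]; lra.
apply: le_trans (nm_le_ReIm _) _; rewrite /clog -/(nm _) /= carg_asin //.
have t1 : `|ln (nm (1 + h))| <= e / 2.
  have := D1 (nm (1 + h)); rewrite ln1 sub0r normrN; apply; rewrite /ball /=.
  by rewrite ltr_norml; apply/andP; split; lra.
have t2 : `|asin (Im (1 + h) / nm (1 + h))| <= e / 2.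
  have := D2 (Im (1 + h) / nm (1 + h)).
  have as0 : asin (0 : R) = 0.
    have := @sinK R 0; rewrite in_itv /= sin0 => -> //.
    by rewrite oppr_le0 divr_ge0 ?pi_ge0.
  rewrite as0 sub0r normrN; apply; rewrite /ball /= sub0r normrN normrM normfV.
  rewrite (ger0_norm (nm_ge0 _)) ltr_pdivrMr; last by lra.
  have -> : Im (1 + h) = Im h by rewrite cImD /= add0r.
  apply: le_lt_trans (Im_nm h) _; nra.
by lra.
Qed.

(** Derivative of an inverse: for w = log(1 + h), small by [clog_cont1], [cexp_small] bounds h - w
    by a small multiple of |w|, and then |w| <= 2 |h|. *)
Lemma cderiv_clog1 : cderiv (@clog R) (1 : R[i]) 1.
Proof.
move=> e e0; have e1 : 0 < Num.min (1 / 2) (e / 2) by rewrite lt_min !divr_gt0.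
have [d1 d10 D1] := cexp_small e1.
have d12 : 0 < d1 / 2 by rewrite divr_gt0.
have [d2 d20 D2] := clog_cont1 d12.
exists (Num.min d2 1); first by rewrite lt_min d20 ltr01.
move=> h; rewrite lt_min => /andP[/D2 h2 h3].
have n1 : 1 + h != 0.
  rewrite -nm_gt0; have := nm_lerB 1 (- h); rewrite opprK nmN nm1; lra.
have := D1 (clog (1 + h)); rewrite clogK // => H.
have {}H := H (le_lt_trans h2 _); have {}H := H ltac:(lra).
move: H; have -> : 1 + h - 1 - clog (1 + h) = h - clog (1 + h) by ring.
rewrite clog1 subr0 (mul1r h) nmBC; set w := clog _ => H.
have [m1 m2] : Num.min (1 / 2) (e / 2) <= 1 / 2 /\ Num.min (1 / 2) (e / 2) <= e / 2.
  by rewrite !ge_min !lexx orbT.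
have w0 := nm_ge0 w.
have b1 : nm w <= 2 * nm h.
  have H2 := nm_lerB w h; have := ler_wpM2r w0 m1; lra.
by apply: le_trans H _; have := ler_wpM2r w0 m2; have := ler_wpM2l (ltW e0) b1; lra.
Qed.

(** The domain of analyticity of the principal logarithm; [slit_plane] is its translate by -1,
    whence the conditions [slit (z + 1)] below. *)
Definition slit z := (0 < Re z) || (Im z != 0).

Lemma slit_neq0 z : slit z -> z != 0.
Proof. by apply: contraTneq => ->; rewrite /slit ltxx eqxx. Qed.

Lemma slit_carg z : slit z -> `|carg z| < pi.
Proof.
move=> sz; have z0 := slit_neq0 sz; have zr := carg_range z0.
have n0 : 0 < nm z by rewrite nm_gt0.
have a : -1 < Re z / nm z <= 1.
  case/andP: zr => z1 ->; rewrite andbT ltr_pdivlMr // mulN1r.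
  case/orP: sz => [h|h]; first by lra.
  have := sqr_nm z; have : 0 < Im z ^+ 2 by rewrite exprn_even_gt0.
  by move=> h1 h2; rewrite ltNge; apply/negP => h3; nra.
rewrite /carg -/(nm z); case: ifP => _; rewrite ?normrN ger0_norm ?acos_ge0 ?acos_ltpi //.
Qed.

(** Off the cut there is room in the argument of z, so that log w = log z + log(w/z) for w near z;
    this reduces the claim to the point 1. *)
Lemma cderiv_clog z : slit z -> cderiv (@clog R) z z^-1.
Proof.
move=> sz; have z0 := slit_neq0 sz; have cz := slit_carg sz.
have e0 : 0 < pi - `|carg z| by rewrite subr_gt0.
have e2 : 0 < (pi - `|carg z|) / 2 by rewrite divr_gt0.
have [d d0 D] := clog_cont1 e2.
have nz : 0 < nm z by rewrite nm_gt0.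
have dd : 0 < Num.min (d * nm z) (nm z) by rewrite lt_min mulr_gt0.
apply: (@cderiv_near _ (fun w => clog z + clog (w / z)) _ _ _ _ dd) => [w|].
  rewrite lt_min => /andP[h1 h2].
  have E : w / z = 1 + (w - z) / z by field.
  have w0 : w != 0 by apply: contraTneq h2 => ->; rewrite sub0r nmN ltxx.
  have := D ((w - z) / z); rewrite nmM nmV ltr_pdivrMr // => /(_ h1).
  rewrite -E => h3; rewrite -clog_mul //; last 2 first.
  - by rewrite mulf_neq0 // invr_eq0.
  - have := le_trans (Im_nm _) h3; rewrite /clog /= => h4.
    have := ler_norm (carg z); have := ler_norm (- carg z).
    have := ler_norm (carg (w / z)); have := ler_norm (- carg (w / z)).
    by rewrite !normrN => ? ? ? ?; apply/andP; split; lra.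
  by rewrite mulrC divfK.
have D1 : cderiv (fun w => w / z) z (z^-1).
  have := cderivM (cderiv_id z) (cderiv_cst z^-1 z).
  by rewrite mul1r mulr0 addr0.
have D2 : cderiv (@clog R) (z / z) 1 by rewrite divff //; exact: cderiv_clog1.
by have := cderivD (cderiv_cst (clog z) z) (cderiv_comp D1 D2); rewrite mul1r add0r.
Qed.

End ExpLog.

(** * Bernoulli numbers and Euler-Maclaurin summation *)

Section EulerMaclaurin.
Context {R : realType}.

Lemma rderiv_real (t : R) : rderiv (fun s : R => s%:C) t (1 : R[i]).
Proof.
have := @rderiv_affine R 0 1 t; congr rderiv.
by apply/funext => s; rewrite add0r mulr1.
Qed.

Lemma rderiv_sum (I : Type) (s : seq I) (F : I -> R -> R[i]) (L : I -> R[i]) (t : R) :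
  (forall i, rderiv (F i) t (L i)) ->
  rderiv (fun u => \sum_(i <- s) F i u) t (\sum_(i <- s) L i).
Proof.
move=> H; elim: s => [|i s IH].
  rewrite big_nil; under eq_fun do rewrite big_nil.
  by move=> e e0; exists 1 => // h _; rewrite subrr mul0r subr0 nm0 mulr_ge0 // ltW.
by rewrite big_cons; under eq_fun do rewrite big_cons; exact: rderivD (H i) IH.
Qed.

(** The derivative of the remainder is the remainder of the shifted chain. Each mean value
    inequality costs a factor 2. *)
Lemma taylor_chain (n : nat) (phi : nat -> R -> R[i]) (B : R) :
  (forall k t, (k < n)%N -> 0 <= t <= 1 -> rderiv (phi k) t (phi k.+1 t)) ->
  (forall t, 0 <= t <= 1 -> nm (phi n t) <= B) ->
  forall t, 0 <= t <= 1 ->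
    nm (phi 0%N t - \sum_(k < n) phi k 0 * (k`!%:R)^-1 * t%:C ^+ k) <= 2 ^+ n * B.
Proof.
elim: n phi => [|n IH] phi H HB t t01; first by rewrite big_ord0 subr0 mul1r; apply: HB.
pose psi k t := phi k t - \sum_(j < n.+1 - k) phi (k + j)%N 0 * (j`!%:R)^-1 * t%:C ^+ j.
have IH1 := IH (fun k => phi k.+1) (fun k s kn => H k.+1 s kn) HB.
have B0 : 0 <= 2 ^+ n * B.
  by rewrite mulr_ge0 ?exprn_ge0 //; apply: le_trans (nm_ge0 _) (HB 0 _); rewrite lexx ler01.
have D s : 0 <= s <= 1 -> rderiv (fun t => phi 0%N t - \sum_(k < n.+1) phi k 0 * (k`!%:R)^-1 * t%:C ^+ k) s
    (phi 1%N s - \sum_(k < n) phi k.+1 0 * (k`!%:R)^-1 * s%:C ^+ k).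
  move=> s01; apply: rderivB; first exact: H.
  rewrite (_ : \sum_(k < n) _ = \sum_(k < n.+1) phi k 0 * (k`!%:R)^-1 * (k%:R * s%:C ^+ k.-1 * 1 * 1)).
    apply: rderiv_sum => k; apply: rderivZ.
    have := rderiv_comp (cderivX k (cderiv_id s%:C)) (rderiv_real s).
    by [].
  rewrite big_ord_recl !mul0r mulr0 add0r; apply: eq_bigr => k _.
  rewrite lift0 factS natrM !mulr1 invfM /=.
  have k0 : k.+1%:R != 0 :> R[i] by rewrite pnatr_eq0.
  by field; rewrite nat1r k0 pnatr_eq0 -lt0n fact_gt0.
have /andP[t0 t1] := t01.
have st01 s : 0 <= s <= t -> 0 <= s <= 1.
  by move=> /andP[s0 st]; rewrite s0 (le_trans st).
have := @mean_value _ _ _ 0 t (2 ^+ n * B) t0 (fun s st => D s (st01 s st))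
  (fun s st => IH1 s (st01 s st)).
have E0 : phi 0%N 0 - \sum_(k < n.+1) phi k 0 / k`!%:R * 0%:C ^+ k = 0.
  rewrite big_ord_recl /= expr0 fact0 invr1 !mulr1 big1 ?addr0 ?subrr // => k _.
  by rewrite rmorph0 exprS mul0r mulr0.
rewrite /= E0 subr0 => h.
apply: le_trans h _; rewrite exprS -[leRHS]mulr1 [leRHS]mulrAC -mulrA -!mulrA ler_wpM2l //.
by move: B0; nra.
Qed.

Lemma sum_ord_shift (V : nmodType) (F : nat -> V) (r n : nat) :
  \sum_(m < n | (r <= m)%N) F m = \sum_(k < n - r) F (r + k)%N.
Proof.
rewrite -(big_mkord (fun m => (r <= m)%N)) -(big_mkord xpredT (fun k => F (r + k)%N)).
have := @big_nat_widenl _ _ (@GRing.add V) r 0 n xpredT F (leq0n r) => /= <-.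
by rewrite -{1}[r]add0n big_addn; apply: eq_bigr => i _; rewrite addnC.
Qed.

(** The hypothesis on b says that its generating series times e^x - 1 equals x. Expand each phi r at
    0 up to order N + 1 - r, evaluate at 1 and sum with the weights b r: the coefficient of phi m 0
    is b m, plus 1 when m = 1, and only Taylor remainders are left. *)
Lemma euler_maclaurin (b : nat -> R[i]) (N : nat) :
  (0 < N)%N ->
  (forall m, \sum_(r < m) b r * ((m - r)`!%:R)^-1 = (m == 1%N)%:R) ->
  forall (phi : nat -> R -> R[i]) (B : R),
  (forall k t, (k <= N)%N -> 0 <= t <= 1 -> rderiv (phi k) t (phi k.+1 t)) ->
  (forall t, 0 <= t <= 1 -> nm (phi N.+1 t) <= B) ->
  nm (\sum_(r < N.+1) b r * phi r 1 - \sum_(r < N.+1) b r * phi r 0 - phi 1%N 0) <=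
    (\sum_(r < N.+1) nm (b r) * 2 ^+ (N.+1 - r)) * B.
Proof.
move=> N0 Hb phi B H HB.
have T (r : 'I_N.+1) : nm (phi r 1 - \sum_(m < N.+1 | (r <= m)%N) phi m 0 * ((m - r)`!%:R)^-1) <= 2 ^+ (N.+1 - r) * B.
  have rN : (r <= N.+1)%N by apply: ltnW.
  have Hr k t : (k < N.+1 - r)%N -> 0 <= t <= 1 -> rderiv (phi (r + k)%N) t (phi (r + k).+1 t).
    by rewrite ltn_subRL ltnS; apply: H.
  have HBr t : 0 <= t <= 1 -> nm (phi (r + (N.+1 - r))%N t) <= B by rewrite subnKC //; apply: HB.
  have h01 : 0 <= (1 : R) <= 1 by rewrite ler01 lexx.
  have := @taylor_chain (N.+1 - r) (fun k => phi (r + k)%N) B _ HBr 1 h01.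
  move=> /(_ _)/wrap[].
    by move=> k t kn t01; rewrite addnS; apply: Hr.
  rewrite addn0 (sum_ord_shift (fun m => phi m 0 * ((m - r)`!%:R)^-1)).
  by congr (nm (_ - _) <= _); apply: eq_bigr => k _; rewrite addKn expr1n mulr1.
have -> : \sum_(r < N.+1) b r * phi r 1 - \sum_(r < N.+1) b r * phi r 0 - phi 1%N 0 =
  \sum_(r < N.+1) b r * (phi r 1 - \sum_(m < N.+1 | (r <= m)%N) phi m 0 * ((m - r)`!%:R)^-1).
  under [RHS]eq_bigr do rewrite mulrBr.
  rewrite sumrB -addrA; congr (_ + _); rewrite -opprD; congr (- _).
  under [RHS]eq_bigr do rewrite mulr_sumr big_mkcond /=.
  rewrite exchange_big /=.
  have -> : phi 1%N 0 = \sum_(m < N.+1) (val m == 1%N)%:R * phi m 0.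
    have h1 : (1 < N.+1)%N by [].
    rewrite (bigD1 (Ordinal h1)) //= mul1r big1 ?addr0 // => m.
    by rewrite -val_eqE /= => /negPf ->; rewrite mul0r.
  rewrite -big_split /=; apply: eq_bigr => m _.
  rewrite -Hb -big_mkcond /= (bigD1 m) //= subnn fact0 invr1 mulr1; congr (_ + _).
  rewrite mulr_suml.
  rewrite (big_ord_widen_cond N.+1 xpredT (fun r => b r * ((m - r)`!%:R)^-1 * phi m 0)) 1?ltnW //=.
  apply: eq_big => [r|r _]; last by ring.
  by rewrite ltn_neqAle andbC -val_eqE.
apply: le_trans (nm_sum _ _ _) _; rewrite mulr_suml; apply: ler_sum => r _.
by rewrite nmM -mulrA ler_wpM2l ?nm_ge0.
Qed.

End EulerMaclaurin.

(** * Bernoulli numbers from their generating function *)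

Section Bernoulli.
Context {R : realType}.
Implicit Types (f g : R[i] -> R[i]).

Lemma cderiv_derive1n f k z c r : holo_on (sq c r) f -> sq c r z ->
  cderiv (derive1n k f) z (derive1n k.+1 f z).
Proof.
move=> hf zr; have [l lP] := holo_derive1n k hf zr.
by rewrite derive1nS (cderiv_derive1 lP).
Qed.

(** Transfers iterated real derivatives, as they occur in the statement for [bernoulli_gen] and for
    the logarithm of G, to complex ones, which exist to all orders. *)
Lemma real_restriction (g : R -> R) f (c r : R) k : holo_on (sq c%:C r) f ->
  (forall x, `|x - c| < r -> g x = Re (f x%:C)) ->
  forall x : R, `|x - c| < r ->
   is_derive x 1 (derive1n k g) (Re (derive1n k.+1 f x%:C)) /\
   derive1n k g x = Re (derive1n k f x%:C).
Proof.
move=> hf gf.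
have sqx x : `|x - c| < r -> sq c%:C r x%:C.
  by move=> h; apply: sq_nm; rewrite -rmorphB nm_real.
have D j (x : R) : `|x - c| < r ->
    is_derive x 1 (fun t => Re (derive1n j f t%:C)) (Re (derive1n j.+1 f x%:C)).
  move=> /sqx h; have := rderiv_Re (rderiv_comp (cderiv_derive1n j hf h) (rderiv_real x)).
  by rewrite mulr1.
have step j : (forall x : R, `|x - c| < r -> derive1n j g x = Re (derive1n j f x%:C)) ->
    forall x : R, `|x - c| < r -> is_derive x 1 (derive1n j g) (Re (derive1n j.+1 f x%:C)).
  move=> E x xr; apply/derive_epsP => e e0.
  have [d d0 H] := (derive_epsP _ _ _).1 (D j x xr) e e0.
  exists (Num.min d (r - `|x - c|)); first by rewrite lt_min d0 subr_gt0.
  move=> h; rewrite lt_min => /andP[/H h1 h2]; rewrite !E //.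
  by rewrite addrAC; apply: le_lt_trans (ler_normD _ _) _; rewrite -ltrBrDl.
have E j : forall x : R, `|x - c| < r -> derive1n j g x = Re (derive1n j f x%:C).
  elim: j => [|j IH] x xr; first exact: gf.
  by rewrite derive1nS derive1E; have [_ ->] := step j IH x xr.
by move=> x xr; split; [apply: step => //; apply: E|apply: E].
Qed.

(** Removable singularity: dividing the third-order Taylor estimate of f by h gives a quadratic
    estimate for the quotient. *)
Lemma holo_diffquot f c r l : 0 < r -> holo_on (sq c r) f -> cderiv f c l ->
  exists m, cderiv (fun w => if w == c then l else (f w - f c) / (w - c)) c m.
Proof.
move=> r0 hf lP.
have [p1 p2 p3 p4] : [/\ 0 < r / 2, r / 2 < r, 0 < r / 4 & r / 4 < r / 2] by split; lra.
have [B B0 HB] := holo_bounded p1 p2 hf.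
have [A HA] := taylor_bd p3 p4 (fun z zr => hf z (sqW (ltW p2) zr)) HB.
have A0 : A 0%N = f c.
  have := HA 1%N 0; rewrite nm0 mul0r expr0n mulr0 mul0r addr0 => /(_ p3)/nm_le0.
  by rewrite big_ord1 expr0 mulr1 => /eqP; rewrite subr_eq0 => /eqP.
have K h m : nm h <= r / 8 -> 2 * B * (nm h / (r / 4)) ^+ m * (r / 4 / (r / 4 - nm h)) <=
    4 * B / (r / 4) ^+ m * nm h ^+ m.
  move=> hr; have n0 := nm_ge0 h.
  have k2 : r / 4 / (r / 4 - nm h) <= 2 by rewrite ler_pdivrMr; lra.
  have P0 : 0 <= 2 * B * (nm h / (r / 4)) ^+ m.
    by apply: mulr_ge0; [lra|apply: exprn_ge0; apply: divr_ge0; lra].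
  by have := ler_wpM2l P0 k2; rewrite expr_div_n; lra.
have A1 : A 1%N = l.
  apply: (cderiv_uniq (f := f) (z := c)) => //.
  apply: (@quad_cderiv _ _ _ _ (r / 8) (4 * B / (r / 4) ^+ 2)).
  - by rewrite divr_gt0.
  - by rewrite divr_ge0 ?exprn_ge0 ?mulr_ge0 // ltW.
  - move=> h /ltW hr; have := HA 2%N h; rewrite !big_ord_recl big_ord0 /= A0 expr0 mulr1 expr1 addr0.
    by rewrite opprD addrA => H; apply: le_trans (H _) (K _ _ hr); lra.
exists (A 2%N); apply: (@quad_cderiv _ _ _ _ (r / 8) (4 * B / (r / 4) ^+ 3)).
- by rewrite divr_gt0.
- by rewrite divr_ge0 ?exprn_ge0 ?mulr_ge0 // ltW.
move=> h /ltW hr; rewrite eqxx.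
have [->|h0] := eqVneq h 0.
  by rewrite addr0 eqxx subrr mulr0 subrr nm0 expr0n mulr0.
rewrite -subr_eq0 [c + h]addrC addrK (negPf h0).
have -> : (f (h + c) - f c) / h - l - A 2%N * h = (f (c + h) - (f c + l * h + A 2%N * h ^+ 2)) / h.
  by rewrite (addrC h c); field.
rewrite nmM nmV ler_pdivrMr ?nm_gt0 // -[X in _ <= X]mulrA -exprSr.
have := HA 3%N h; rewrite !big_ord_recl big_ord0 /= A0 A1 expr0 mulr1 expr1 addr0 addrA => H.
by apply: le_trans (H _) (K _ _ hr); lra.
Qed.

(** An entire function equal to 1 at 0; the Bernoulli generating function is its reciprocal, hence
    holomorphic near 0. *)
Definition expq (z : R[i]) : R[i] := if z == 0 then 1 else (cexp z - 1) / z.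

Lemma expq_holo z : exists l, cderiv expq z l.
Proof.
have E : expq = fun w => if w == 0 then 1 else (@cexp R w - cexp 0) / (w - 0).
  by apply/funext => w; rewrite /expq cexp0 subr0.
have [->|z0] := eqVneq z 0.
  have h : holo_on (sq 0 1) (@cexp R) by move=> w _; exists (cexp w); apply: cderiv_cexp.
  have D0 : cderiv (@cexp R) 0 1 by rewrite -[X in cderiv _ _ X]cexp0; apply: cderiv_cexp.
  by rewrite E; apply: holo_diffquot ltr01 h D0.
have nz : 0 < nm z by rewrite nm_gt0.
have D := cderivM (cderivB (cderiv_cexp z) (cderiv_cst 1 z)) (cderiv_inv z0).
eexists; apply: cderiv_near nz _ D => w wz; rewrite /expq; case: eqP => // w0.
by move: wz; rewrite w0 sub0r nmN ltxx.
Qed.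

Lemma expq_near0 : exists2 r : R, 0 < r & forall z, sq 0 r z -> expq z != 0.
Proof.
have [l lP] := expq_holo 0.
have h2 : 0 < 1 / 2 :> R by rewrite divr_gt0.
have [d d0 D] := cderiv_ccont lP h2.
exists (d / 2); first by rewrite divr_gt0.
move=> z /andP[]; rewrite subr0 => h1 h3.
have hz : nm z < d by apply: le_lt_trans (nm_le_ReIm _) _; lra.
have := D z hz; rewrite add0r {2}/expq eqxx => H.
apply: contraTneq H => ->; rewrite sub0r nmN nm1; lra.
Qed.

Definition bgen (z : R[i]) : R[i] := (expq z)^-1.

Lemma bgen_holo : exists2 r : R, 0 < r & holo_on (sq 0 r) bgen.
Proof.
have [r r0 H] := expq_near0; exists r => // z /H h.
by have [l lP] := expq_holo z; eexists; apply: cderiv_comp lP (cderiv_inv h).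
Qed.

Lemma bgen_real (x : R) : bgen x%:C = (bernoulli_gen 0 x)%:C.
Proof.
rewrite /bgen /expq /bernoulli_gen mul0r expR0 mulr1 -(rmorph0 (real_complex R)).
rewrite (inj_eq (@complexI R)); case: eqP => _; first by rewrite invr1.
by rewrite cexp_real invfM invrK fmorph_div rmorphB mulrC.
Qed.

(** The second alternative covers the nonzero multiples of 2 i pi; [expq_near0] excludes it near 0,
    where the identity is differentiated. *)
Lemma bgenM z : bgen z * (cexp z - 1) = z \/ expq z = 0.
Proof.
rewrite /bgen /expq; case: eqP => [->|/eqP z0]; first by left; rewrite cexp0 subrr mulr0.
have [->|e0] := eqVneq (cexp z - 1) 0; first by right; rewrite mul0r.
by left; field; rewrite e0 z0.
Qed.

Lemma bgenN z : bgen (- z) = bgen z + z \/ expq z = 0.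
Proof.
rewrite /bgen /expq oppr_eq0; case: eqP => [->|/eqP z0]; first by left; rewrite addr0.
have [->|e0] := eqVneq (cexp z - 1) 0; first by right; rewrite mul0r.
left; rewrite cexpN; have := cexp_neq0 z => c0.
have e1 : (cexp z)^-1 - 1 != 0.
  apply: contra e0; rewrite !subr_eq0 => /eqP h; rewrite -[cexp z]invrK h invr1 //.
have e2 : 1 - cexp z != 0 by rewrite -opprB oppr_eq0.
by field; rewrite z0 e0 c0 mulN1r e2.
Qed.

Lemma bernoulli_num_bgen k : bernoulli_num R k = Re (derive1n k bgen 0).
Proof.
have [r r0 H] := bgen_holo.
have H' : holo_on (sq (0 : R)%:C r) bgen by [].
rewrite /bernoulli_num /bernoulli_poly.
have [_ ->] := @real_restriction (bernoulli_gen 0) bgen 0 r k H'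
  (fun x _ => esym (congr1 (@complex.Re R) (bgen_real x))) 0 ltac:(by rewrite subrr normr0).
by [].
Qed.

(** Comparison of the m-th derivatives at 0 in the identity of [bgenM]; the term of index m is
    missing because e^z - 1 vanishes at 0. *)
Lemma bernoulli_rec m :
  \sum_(k < m) (bernoulli_num R k / k`!%:R)%:C * ((m - k)`!%:R)^-1 = (m == 1%N)%:R :> R[i].
Proof.
have [r1 r10 H1] := expq_near0; have [r2 r20 H2] := bgen_holo.
pose r := Num.min r1 r2.
have r0 : 0 < r by rewrite lt_min r10.
have [rr1 rr2] : r <= r1 /\ r <= r2 by rewrite /r !ge_min !lexx orbT.
have hb : holo_on (sq 0 r) bgen by move=> z /(sqW rr2); apply: H2.
pose f k z := derive1n k bgen z / k`!%:R.
pose g k (z : R[i]) := (cexp z - (k == 0)%:R) / k`!%:R.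
(* By the Leibniz rule, the j-th derivative of bgen(z) (e^z - 1), divided by j!. *)
pose p j z := \sum_(k < j.+1) f k z * g (j - k)%N z.
have fact0n k : k`!%:R != 0 :> R[i] by rewrite pnatr_eq0 -lt0n fact_gt0.
have fD k z : sq 0 r z -> cderiv (f k) z (k.+1%:R * f k.+1 z).
  move=> zr; have := cderivM (cderiv_derive1n k hb zr) (cderiv_cst (k`!%:R)^-1 z).
  rewrite mulr0 addr0 /f factS natrM; congr cderiv.
  by field; rewrite fact0n nat1r pnatr_eq0.
have gD k z : cderiv (g k) z (k.+1%:R * g k.+1 z).
  have := cderivM (cderivB (cderiv_cexp z) (cderiv_cst (k == 0)%:R z)) (cderiv_cst (k`!%:R)^-1 z).
  rewrite mulr0 addr0 /g factS natrM subr0; congr cderiv.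
  by field; rewrite fact0n nat1r pnatr_eq0.
have pD j z : sq 0 r z -> cderiv (p j) z (j.+1%:R * p j.+1 z).
  move=> zr.
  have := cderiv_sum (index_enum 'I_j.+1) (P := xpredT)
    (F := fun (k : 'I_j.+1) z => f k z * g (j - k)%N z)
    (fun k _ => cderivM (fD k z zr) (gD (j - k)%N z)).
  congr (cderiv _ z).
  rewrite big_split /= /p mulr_sumr.
  have -> : \sum_(k < j.+2) j.+1%:R * (f k z * g (j.+1 - k)%N z) =
     \sum_(k < j.+2) (k%:R * f k z * g (j.+1 - k)%N z + (j.+1 - k)%:R * (f k z * g (j.+1 - k)%N z)).
    by apply: eq_bigr => k _; rewrite natrB -1?ltnS //; ring.
  rewrite big_split /= [X in _ = X + _]big_ord_recl /= !mul0r add0r; congr (_ + _).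
  rewrite [RHS]big_ord_recr /= subnn mul0r addr0; apply: eq_bigr => k _.
  by rewrite subSn -1?ltnS //; ring.
have p0 z : sq 0 r z -> p 0%N z = z.
  move=> zr; rewrite /p big_ord1 /f /g fact0 !divr1.
  by case: (bgenM z) => // h; have := H1 z (sqW rr1 zr); rewrite h eqxx.
have loc q (q' : R[i] -> R[i]) z l l' : sq 0 r z -> (forall z, sq 0 r z -> q z = q' z) ->
    cderiv q z l -> cderiv q' z l' -> l = l'.
  move=> zr E D D'; have [d d0 S] := sq_open zr.
  by apply: cderiv_uniq (cderiv_near d0 _ D) D' => w wd; apply: E; apply: S; apply: sq_nm.
have p1 z : sq 0 r z -> p 1%N z = 1.
  by move=> zr; have := loc _ _ _ _ _ zr p0 (pD 0%N z zr) (cderiv_id z); rewrite mul1r.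
have p2 j z : sq 0 r z -> p j.+2 z = 0.
  elim: j z => [|j IH] z zr.
    have := loc _ _ _ _ _ zr p1 (pD 1%N z zr) (cderiv_cst 1 z).
    by move/eqP; rewrite mulf_eq0 pnatr_eq0 /= => /eqP.
  have := loc _ _ _ _ _ zr IH (pD j.+2 z zr) (cderiv_cst 0 z).
  by move/eqP; rewrite mulf_eq0 pnatr_eq0 /= => /eqP.
have s0 : sq 0 r 0 by apply: sq_center.
have pm : p m 0 = (m == 1%N)%:R.
  by case: m => [|[|m]] /=; rewrite ?p0 ?p1 ?p2.
rewrite -[RHS](rmorph_nat (real_complex R)) /=.
have : Re (p m 0) = (m == 1%N)%:R by rewrite pm; case: (m == 1%N).
move=> <-; rewrite /p big_ord_recr /= subnn /g cexp0 subrr mul0r mulr0 addr0.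
have -> : Re (\sum_(k < m) f k 0 * ((1 - (m - k == 0)%N%:R) / (m - k)`!%:R)) =
   \sum_(k < m) bernoulli_num R k / k`!%:R * ((m - k)`!%:R)^-1.
  rewrite (big_morph (@complex.Re R) (@cReD R) (erefl : Re 0 = 0)).
  apply: eq_bigr => k _; rewrite subn_eq0 leqNgt ltn_ord subr0 div1r.
  rewrite bernoulli_num_bgen /f -!(rmorph_nat (real_complex R)) -!fmorphV.
  by rewrite !cReM /= !mulr0 !subr0.
rewrite rmorph_sum /=; apply: eq_bigr => k _.
by rewrite !rmorphM /= !fmorphV /= !rmorph_nat.
Qed.

(** The identity bgen(-z) = bgen(z) + z, differentiated k times at 0: the summand z disappears for k
    > 1, and for odd k the derivative equals its opposite. *)
Lemma bernoulli_odd k : (1 < k)%N -> odd k -> bernoulli_num R k = 0.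
Proof.
move=> k1 ko.
have [r1 r10 H1] := expq_near0; have [r2 r20 H2] := bgen_holo.
pose r := Num.min r1 r2.
have r0 : 0 < r by rewrite lt_min r10.
have [rr1 rr2] : r <= r1 /\ r <= r2 by rewrite /r !ge_min !lexx orbT.
have hb : holo_on (sq 0 r) bgen by move=> z /(sqW rr2); apply: H2.
have sN z : sq 0 r z -> sq 0 r (- z).
  by rewrite /sq !subr0 cReN cImN !normrN.
pose q j (z : R[i]) : R[i] := if j == 0%N then z else (j == 1%N)%:R.
have qD j z : cderiv (q j) z (q j.+1 z).
  by case: j => [|[|j]]; [exact: cderiv_id|exact: cderiv_cst|exact: cderiv_cst].
have E j z : sq 0 r z -> (-1) ^+ j * derive1n j bgen (- z) = derive1n j bgen z + q j z.
  elim: j z => [|j IH] z zr.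
    rewrite mul1r /q /=; case: (bgenN z) => // h.
    by have := H1 z (sqW rr1 zr); rewrite h eqxx.
  have D1 := cderivD (cderiv_derive1n j hb zr) (qD j z).
  have D2 := cderivZ ((-1) ^+ j) (cderiv_comp (cderivN (cderiv_id z)) (cderiv_derive1n j hb (sN z zr))).
  have [d d0 S] := sq_open zr.
  have := cderiv_uniq (cderiv_near d0 _ D2) D1 => <-; first by rewrite exprS; ring.
  by move=> w wd; apply: IH; apply: S; apply: sq_nm.
have := E k 0 (sq_center 0 r0); rewrite oppr0 -signr_odd ko expr1 mulN1r.
have -> : q k 0 = 0 by case: k k1 {ko} => [|[|k]].
rewrite addr0 => /(congr1 (@complex.Re R)); rewrite cReN -bernoulli_num_bgen => h.
by lra.
Qed.

End Bernoulli.

(** * The derivatives of the Hurwitz zeta function at the nonpositive integers *)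

Section Sequences.
Context {R : realType}.
Implicit Types (u : nat -> R[i]) (l : R[i]).

Definition ccvg u l := forall e : R, 0 < e ->
  exists N0 : nat, forall N, (N0 <= N)%N -> nm (u N - l) <= e.

Definition clim u : R[i] := xget 0 [set l | ccvg u l].

Lemma ccvg_clim u l : ccvg u l -> ccvg u (clim u).
Proof. by move=> H; rewrite /clim; case: xgetP => [? _ //|/(_ l)]. Qed.

Lemma ccvg_uniq u l m : ccvg u l -> ccvg u m -> l = m.
Proof.
move=> ul um; apply/eqP; rewrite -subr_eq0; apply/eqP/nm_le0/ler_addgt0Pr => e e0.
have e2 : 0 < e / 2 by rewrite divr_gt0.
have [N1 H1] := ul _ e2; have [N2 H2] := um _ e2.
have h1 := H1 _ (leq_maxl N1 N2); have h2 := H2 _ (leq_maxr N1 N2).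
by rewrite add0r; have := nm_dist (u (maxn N1 N2)) l m; rewrite (nmBC l (u _)); lra.
Qed.

Lemma ccvg_le u l v (B : R) (N0 : nat) : ccvg u l ->
  (forall N, (N0 <= N)%N -> nm (u N - v) <= B) -> nm (l - v) <= B.
Proof.
move=> ul H; apply/ler_addgt0Pr => e e0; have [N1 H1] := ul _ e0.
have h1 := H1 _ (leq_maxl N1 N0); have h2 := H _ (leq_maxr N1 N0).
by have := nm_dist (u (maxn N1 N0)) l v; rewrite (nmBC l (u _)); lra.
Qed.

Lemma ccvg_shift u l (k : nat) : ccvg u l -> ccvg (fun n => u (n + k)%N) l.
Proof.
move=> ul e /ul[N0 H]; exists N0 => N hN; apply: H.
by apply: leq_trans hN (leq_addr _ _).
Qed.

Lemma ccvgD u v l m : ccvg u l -> ccvg v m -> ccvg (fun n => u n + v n) (l + m).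
Proof.
move=> ul vm e e0; have e2 : 0 < e / 2 by rewrite divr_gt0.
have [N1 H1] := ul _ e2; have [N2 H2] := vm _ e2.
exists (maxn N1 N2) => N; rewrite geq_max => /andP[/H1 h1 /H2 h2].
by rewrite opprD addrACA; apply: le_trans (nmD _ _) _; lra.
Qed.

Lemma ccvg_cst l : ccvg (fun=> l) l.
Proof. by move=> e e0; exists 0%N => N _; rewrite subrr nm0 ltW. Qed.

(* Telescoping comparison: 1/(k-X)^2 <= 1/(k-1-X) - 1/(k-X). *)
Lemma tail_bound u (K X : R) (n m : nat) : 0 <= K -> X + 1 < n%:R -> (n <= m)%N ->
  (forall k, (n <= k)%N -> nm (u k) <= K / (k%:R - X) ^+ 2) ->
  nm (\sum_(n <= k < m) u k) <= K / (n%:R - 1 - X).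
Proof.
move=> K0 nX hnm H.
suff : nm (\sum_(n <= k < m) u k) <= K / (n%:R - 1 - X) - K / (m%:R - 1 - X).
  have mn : n%:R <= m%:R :> R by rewrite ler_nat.
  have : 0 <= K / (m%:R - 1 - X) by rewrite divr_ge0 //; lra.
  by lra.
elim: m hnm => [|m IH].
  by rewrite leqn0 => /eqP ->; rewrite big_geq // nm0 subrr.
rewrite leq_eqVlt => /predU1P[->|]; first by rewrite big_geq // nm0 subrr.
rewrite ltnS => hm; rewrite big_nat_recr //=; apply: le_trans (nmD _ _) _.
have mn : n%:R <= m%:R :> R by rewrite ler_nat.
have h := lerD (IH hm) (H m hm); apply: le_trans h _.
rewrite -natr1; set x : R := m%:R in mn *.
have x1 : 0 < x - 1 - X by lra.
have x2 : 0 < x - X by lra.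
suff : K / (x - X) ^+ 2 <= K / (x - 1 - X) - K / (x + 1 - 1 - X) by lra.
have -> : K / (x - 1 - X) - K / (x + 1 - 1 - X) = K / ((x - 1 - X) * (x - X)).
  by field; rewrite !gt_eqF //; lra.
rewrite ler_wpM2l // lef_pV2 ?posrE ?exprn_gt0 ?mulr_gt0 // expr2 ler_pM2r //; lra.
Qed.

Lemma sum_tail u (n m : nat) : (n <= m)%N ->
  \sum_(k < m) u k - \sum_(k < n) u k = \sum_(n <= k < m) u k.
Proof.
by move=> h; rewrite -!(big_mkord xpredT u) [X in X - _](big_cat_nat (leq0n n) h) //= addrAC subrr add0r.
Qed.

(** The tail bound is explicit so that uniformity can be read off: X will bound |a| over a whole
    square, and X = -1 serves for terms of size 1/(k + 1)^2. *)
Lemma ccvg_series u (K X : R) (n0 : nat) : 0 <= K ->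
  (forall k, (n0 <= k)%N -> X + 1 < k%:R -> nm (u k) <= K / (k%:R - X) ^+ 2) ->
  exists l, ccvg (fun n => \sum_(k < n) u k) l /\
    forall n, (n0 <= n)%N -> X + 1 < n%:R -> nm (\sum_(k < n) u k - l) <= K / (n%:R - 1 - X).
Proof.
move=> K0 H.
have T n m : (n0 <= n)%N -> X + 1 < n%:R -> (n <= m)%N ->
    nm (\sum_(k < m) u k - \sum_(k < n) u k) <= K / (n%:R - 1 - X).
  move=> n0n Xn hnm; rewrite sum_tail //; apply: tail_bound => // k nk; apply: H.
    exact: leq_trans nk.
  by apply: lt_le_trans Xn _; rewrite ler_nat.
have [l lP] : exists l, ccvg (fun n => \sum_(k < n) u k) l.
  apply: complex_cauchy_cvg => e e0.
  pose N1 := Num.bound (`|X| + 2 + 2 * K / e).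
  have N1P : `|X| + 2 + 2 * K / e < N1%:R.
    by apply: archi_boundP; rewrite !addr_ge0 ?divr_ge0 ?mulr_ge0 // ltW.
  pose N0 := maxn n0 N1.
  have N0P : `|X| + 2 + 2 * K / e < N0%:R.
    by apply: lt_le_trans N1P _; rewrite ler_nat leq_maxr.
  have X1 := ler_norm X; have Ke : 0 <= 2 * K / e by rewrite divr_ge0 ?mulr_ge0 // ltW.
  have D : 0 < N0%:R - 1 - X by lra.
  have S : K / (N0%:R - 1 - X) <= e / 2.
    rewrite ler_pdivrMr //.
    have : e / 2 * (2 * K / e) <= e / 2 * (N0%:R - 1 - X).
      by rewrite ler_wpM2l ?divr_ge0 ?(ltW e0) //; lra.
    have -> : e / 2 * (2 * K / e) = K by field; rewrite gt_eqF.
    by [].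
  have XN0 : X + 1 < N0%:R by lra.
  exists N0 => N M hN hM; apply: le_trans (nm_dist (\sum_(k < N0) u k) _ _) _.
  rewrite (nmBC (\sum_(k < N0) u k)).
  have h1 := T N0 N (leq_maxl _ _) XN0 hN; have h2 := T N0 M (leq_maxl _ _) XN0 hM.
  by apply: le_trans (lerD h1 h2) _; lra.
exists l; split=> // n n0n Xn; rewrite nmBC; apply: (ccvg_le (N0 := n) lP) => N nN.
exact: T.
Qed.

End Sequences.

(** * Construction of the functions Z_j *)

Section Zeta.
Context {R : realType}.
Implicit Types (a u z l : R[i]).

(** The pair (p, q) for which the r-th derivative is u^(j+1-r) (p log u + q). The recurrence is the
    product rule: both entries are multiplied by the exponent, and the derivative of log adds p to
    the second. *)
Fixpoint zcoef (j r : nat) : R[i] * R[i] :=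
  if r is r'.+1 then
    let p := zcoef j r' in
    ((j.+1%:Z - r'%:Z)%:~R * p.1, (j.+1%:Z - r'%:Z)%:~R * p.2 + p.1)
  else (j.+1%:R^-1, - j.+1%:R^-1 ^+ 2).

(* The r-th derivative of u^(j+1)/(j+1) * L(u) - u^(j+1)/(j+1)^2, where L is a
   branch of the logarithm; the first derivative is u^j * L(u). *)
Definition zterm (L : R[i] -> R[i]) (j r : nat) u : R[i] :=
  u ^ (j.+1%:Z - r%:Z) * ((zcoef j r).1 * L u + (zcoef j r).2).

Lemma cderiv_zterm L j r u : u != 0 -> cderiv L u u^-1 ->
  cderiv (zterm L j r) u (zterm L j r.+1 u).
Proof.
move=> u0 DL; set m : int := j.+1%:Z - r%:Z.
have := cderivM (cderiv_expz m u0)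
  (cderivD (cderivZ (zcoef j r).1 DL) (cderiv_cst (zcoef j r).2 u)).
rewrite addr0; congr cderiv; rewrite /zterm /= -/m.
have -> : j.+1%:Z - r.+1%:Z = m - 1 by rewrite /m intS; ring.
rewrite expfzDr // -[u ^ -1]/(u^-1); set X := u ^ m; set M := m%:~R; field.
exact: u0.
Qed.

Lemma zterm1 L j u : zterm L j 1 u = u ^+ j * L u.
Proof.
have j0 : j.+1%:R != 0 :> R[i] by rewrite pnatr_eq0.
have e1 : j.+1%:Z - 1%:Z = j by rewrite intS [1 + _]addrC addrK.
have e2 : (j.+1%:Z - 0%:Z)%:~R = j.+1%:R :> R[i] by rewrite subr0 -pmulrn.
rewrite /zterm /= e1 e2 -exprnP.
rewrite divff // mul1r.
have -> : j.+1%:R * - j.+1%:R^-1 ^+ 2 + j.+1%:R^-1 = 0 :> R[i] by field; rewrite ?nat1r.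
by rewrite addr0.
Qed.

(** The factor j + 1 - r' is 0 at r' = j + 1: from order j + 2 on the derivatives are pure powers,
    which can be bounded without a logarithm. *)
Lemma zcoef_high j r : (j.+1 < r)%N -> (zcoef j r).1 = 0.
Proof.
elim: r => // r IH; rewrite ltnS leq_eqVlt => /predU1P[<-|/IH h] /=; last by rewrite h mulr0.
by rewrite subrr mul0r.
Qed.

Lemma slitD a (t : R) : slit a -> 0 <= t -> slit (a + t%:C).
Proof.
rewrite /slit cReD cImD /= addr0 => /orP[h|->] t0; last by rewrite orbT.
by rewrite ltr_wpDr.
Qed.

Lemma slit_nat a (k : nat) : slit a -> slit (a + k%:R).
Proof. by move=> sa; rewrite -(rmorph_nat (real_complex R)) /=; apply: slitD. Qed.

Definition bcoef (r : nat) : R[i] := (bernoulli_num R r / r`!%:R)%:C.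

Definition zmain (N j : nat) a := \sum_(r < N.+1) bcoef r * zterm (@clog R) j r a.

(** The defect of [zmain] in the difference equation of Z_j; summed over a, a + 1, a + 2, ... it
    gives the correction [zrem]. *)
Definition zerr (N j : nat) a := zmain N j (a + 1) - zmain N j a - a ^+ j * clog a.

Lemma cderiv_zmain N j a : slit a ->
  cderiv (zmain N j) a (\sum_(r < N.+1) bcoef r * zterm (@clog R) j r.+1 a).
Proof.
move=> sa; apply: cderiv_sum => r _; apply: cderivZ.
by apply: cderiv_zterm; [exact: slit_neq0|exact: cderiv_clog].
Qed.

Lemma rderiv_shift a t : rderiv (fun s : R => a + s%:C) t 1.
Proof.
have := @rderiv_affine R a 1 t; congr rderiv.
by apply/funext => s; rewrite mulr1.
Qed.

(** Euler-Maclaurin on the segment from a to a + 1, where m bounds |u| from below; the derivative of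
    order N + 1 is a constant times u^(j-N). *)
Lemma zerr_bound N j : (j < N)%N -> exists2 K : R, 0 <= K & forall a (m : R), slit a -> 0 < m ->
  (forall t : R, 0 <= t <= 1 -> m <= nm (a + t%:C)) ->
  nm (zerr N j a) <= K / m ^+ (N - j).
Proof.
move=> jN; pose D := nm (zcoef j N.+1).2.
pose S : R := \sum_(r < N.+1) nm (bcoef r) * 2 ^+ (N.+1 - r).
have S0 : 0 <= S by apply: sumr_ge0 => r _; rewrite mulr_ge0 ?nm_ge0 ?exprn_ge0.
exists (S * D) => [|a m sa m0 H]; first by rewrite mulr_ge0 ?nm_ge0.
pose phi k (t : R) := zterm (@clog R) j k (a + t%:C).
have N0 : (0 < N)%N by apply: leq_ltn_trans jN.
have := @euler_maclaurin R bcoef N N0 (@bernoulli_rec R) phi (D / m ^+ (N - j)).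
move=> /(_ _ _)/wrap[].
- move=> k t kN /andP[t0 _]; have st := slitD sa t0.
  have := rderiv_comp (cderiv_zterm j k (slit_neq0 st) (cderiv_clog st)) (rderiv_shift a t).
  by rewrite mulr1.
- move=> t t01; rewrite /phi /zterm zcoef_high ?ltnS // mul0r add0r nmM nmZ mulrC -/D.
  have -> : j.+1%:Z - N.+1%:Z = - (N - j)%N%:Z by lia.
  rewrite -exprnN ler_wpM2l ?nm_ge0 // lef_pV2 ?posrE ?exprn_gt0 //; last first.
    by apply: lt_le_trans (H t t01).
  by rewrite lerXn2r ?nnegrE ?nm_ge0 ?(ltW m0) // H.
rewrite /phi rmorph0 addr0 zterm1 rmorph1 -mulrA; exact.
Qed.

Definition zrem (N j : nat) a : R[i] := clim (fun n => \sum_(k < n) zerr N j (a + k%:R)).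

Lemma pow_decay (K x : R) (p : nat) : 0 <= K -> 1 <= x -> (2 <= p)%N -> K / x ^+ p <= K / x ^+ 2.
Proof.
move=> K0 x1 p2; have x0 : 0 < x by lra.
by rewrite ler_wpM2l // lef_pV2 ?posrE ?exprn_gt0 // ler_weXn2l.
Qed.

Lemma zerr_tail N j : (j.+1 < N)%N -> exists2 K : R, 0 <= K &
  forall a (X : R) (k : nat), slit a -> nm a <= X -> X + 1 < k%:R ->
    nm (zerr N j (a + k%:R)) <= K / (k%:R - X) ^+ 2.
Proof.
move=> jN; have [K K0 H] := zerr_bound (ltnW jN); exists K => // a X k sa aX Xk.
apply: le_trans (pow_decay K0 _ (_ : 2 <= N - j)%N); [|lra|lia].
apply: H; [exact: slit_nat|lra|] => t /andP[t0 _].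
have := nm_lerB (k%:R + t%:C) (- a); rewrite nmN opprK.
rewrite (_ : k%:R + t%:C + a = a + k%:R + t%:C); last by ring.
have -> : nm (k%:R + t%:C) = k%:R + t.
  rewrite -(rmorph_nat (real_complex R)) /= -rmorphD nm_real ger0_norm //.
  by rewrite addr_ge0.
by lra.
Qed.

Lemma zrem_cvg N j a : (j.+1 < N)%N -> slit a ->
  ccvg (fun n => \sum_(k < n) zerr N j (a + k%:R)) (zrem N j a).
Proof.
move=> jN sa; have [K K0 H] := zerr_tail jN.
have [l [lP _]] := @ccvg_series R (fun k => zerr N j (a + k%:R)) K (nm a) 0 K0
  (fun k _ Xk => H a (nm a) k sa (lexx _) Xk).
exact: ccvg_clim lP.
Qed.

Lemma zrem_tail N j : (j.+1 < N)%N -> exists2 K : R, 0 <= K &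
  forall a (X : R) (n : nat), slit a -> nm a <= X -> X + 1 < n%:R ->
    nm (\sum_(k < n) zerr N j (a + k%:R) - zrem N j a) <= K / (n%:R - 1 - X).
Proof.
move=> jN; have [K K0 H] := zerr_tail jN; exists K => // a X n sa aX Xn.
have [l [lP lH]] := @ccvg_series R (fun k => zerr N j (a + k%:R)) K X 0 K0
  (fun k _ Xk => H a X k sa aX Xk).
by rewrite (ccvg_uniq (zrem_cvg jN sa) lP); apply: lH.
Qed.

Lemma zremS N j a : (j.+1 < N)%N -> slit a -> zrem N j a = zerr N j a + zrem N j (a + 1).
Proof.
move=> jN sa; have s1 : slit (a + 1) by have := slit_nat 1 sa; rewrite mulr1n.
have h1 := ccvg_shift 1 (zrem_cvg jN sa).
have h2 := ccvgD (ccvg_cst (zerr N j a)) (zrem_cvg jN s1).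
apply: ccvg_uniq h1 _; move: h2; congr ccvg; apply/funext => n.
rewrite addn1 big_ord_recl mulr0n addr0; congr (_ + _); apply: eq_bigr => k _.
by rewrite lift0 -addrA nat1r.
Qed.

Lemma cderiv_zerr N j a : slit a -> exists l, cderiv (zerr N j) a l.
Proof.
move=> sa; have s1 : slit (a + 1) by have := slit_nat 1 sa; rewrite mulr1n.
eexists; apply: cderivB; first apply: cderivB.
- apply: (cderiv_comp (g := fun w => w + 1)); last exact: cderiv_zmain s1.
  by apply: cderivD; [exact: cderiv_id|exact: cderiv_cst].
- exact: cderiv_zmain.
- by apply: cderivM; [exact: cderivX (cderiv_id a)|exact: cderiv_clog].
Qed.

Lemma slit_open a : slit a -> exists2 r : R, 0 < r & forall w, sq a r w -> slit w.
Proof.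
case/orP => h.
- exists (Re a) => // w /andP[]; rewrite cReD cReN ltr_norml => /andP[? _] _.
  by apply/orP; left; lra.
- exists `|Im a|; first by rewrite normr_gt0.
  move=> w /andP[_]; rewrite cImD cImN => h2; apply/orP; right.
  by apply: contraTneq h2 => ->; rewrite sub0r normrN ltxx.
Qed.

(** The tail bound depends on the point only through an upper bound X of its modulus, so the
    convergence is uniform near a and Weierstrass' theorem applies. *)
Lemma cderiv_zrem N j a : (j.+1 < N)%N -> slit a -> exists l, cderiv (zrem N j) a l.
Proof.
move=> jN sa; have [r r0 rS] := slit_open sa; have [K K0 H] := zrem_tail jN.
pose X := nm a + 2 * r.
have [l lP _] : exists2 l, cderiv (zrem N j) a l & forall ds,
    (forall n, cderiv (fun a => \sum_(k < n) zerr N j (a + k%:R)) a (ds n)) ->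
    forall e : R, 0 < e -> exists N0 : nat, forall N, (N0 <= N)%N -> nm (ds N - l) <= e.
  apply: (weierstrass r0) => [n z zr|e e0].
    have sz := rS _ zr.
    have /choice[L LP] (k : nat) : exists l, cderiv (fun w => zerr N j (w + k%:R)) z l.
      have [l lP] := cderiv_zerr N j (slit_nat k sz).
      exists l => e /lP[d d0 D]; exists d => // h /D.
      by congr (nm (zerr _ _ _ - _ - _) <= _); ring.
    by exists (\sum_(k < n) L k); apply: cderiv_sum => k _; apply: LP.
  pose N0 := Num.bound (X + 1 + K / e).
  have X0 : 0 <= X by rewrite /X addr_ge0 ?nm_ge0 // mulr_ge0 // ltW.
  have Ke : 0 <= K / e by rewrite divr_ge0 // ltW.
  have N0P : X + 1 + K / e < N0%:R by apply: archi_boundP; lra.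
  exists N0 => n nN z zr.
  have nn : N0%:R <= n%:R :> R by rewrite ler_nat.
  have zX : nm z <= X.
    have -> : z = a + (z - a) by ring.
    apply: le_trans (nmD _ _) _; rewrite lerD2l.
    apply: le_trans (nm_le_ReIm _) _; move: zr => /andP[]; lra.
  apply: le_trans (H z X n (rS _ zr) zX _) _; first by lra.
  rewrite ler_pdivrMr; last by lra.
  have : e * (K / e) <= e * (n%:R - 1 - X) by rewrite ler_wpM2l ?(ltW e0) //; lra.
  by have -> : e * (K / e) = K by field; rewrite gt_eqF.
by exists l.
Qed.

(* For N > j + 1 this is zeta'(-j, a), the derivative in s at s = -j of the
   Hurwitz zeta function; it does not depend on N. *)
Definition zfun (N j : nat) a := zmain N j a + zrem N j a.

Lemma zfunS N j a : (j.+1 < N)%N -> slit a -> zfun N j (a + 1) = zfun N j a + a ^+ j * clog a.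
Proof. by move=> jN sa; rewrite /zfun (zremS jN sa) /zerr; ring. Qed.

Lemma cderiv_zfun N j a : (j.+1 < N)%N -> slit a -> exists l, cderiv (zfun N j) a l.
Proof.
move=> jN sa; have [l lP] := cderiv_zrem jN sa.
by eexists; apply: cderivD (cderiv_zmain N j sa) lP.
Qed.

(** With p = N - j and k >= 1, (rho + k)^(-p) <= rho^(2-p) (1/(rho + k - 1) - 1/(rho + k)), which
    telescopes; the term k = 0 is added apart, whence the factor 2. The lower bound on |a + s| is
    what [sector_nm] provides for a = z + 1 and rho = |z|. *)
Lemma zrem_sector N j : (j.+1 < N)%N -> forall kap : R, 0 < kap ->
  exists2 K : R, 0 <= K & forall a (rho : R), slit a -> 1 <= rho ->
    (forall s : R, 0 <= s -> kap * (rho + s) <= nm (a + s%:C)) ->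
    nm (zrem N j a) <= K / rho ^+ (N - j).-1.
Proof.
move=> jN kap k0; have [K K0 H] := zerr_bound (ltnW jN).
pose p := (N - j)%N; have p2 : (2 <= p)%N by rewrite /p; lia.
exists (2 * (K / kap ^+ p)) => [|a rho sa r1 Hs].
  by rewrite mulr_ge0 // divr_ge0 // exprn_ge0 // ltW.
have r0 : 0 < rho by lra.
have e k : nm (zerr N j (a + k%:R)) <= K / kap ^+ p / (rho + k%:R) ^+ p.
  have k00 : 0 <= k%:R :> R by [].
  apply: le_trans (H _ (kap * (rho + k%:R)) (slit_nat k sa) _ _) _.
  - by rewrite mulr_gt0 //; lra.
  - move=> t /andP[t0 _]; apply: le_trans (_ : _ <= kap * (rho + (k%:R + t))) _.
      by rewrite ler_wpM2l ?(ltW k0) //; lra.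
    apply: le_trans (Hs _ _) _; first by lra.
    by rewrite rmorphD /= rmorph_nat addrA.
  - by rewrite exprMn invfM mulrA.
pose K' := K / kap ^+ p.
have K'0 : 0 <= K' by rewrite /K' divr_ge0 // exprn_ge0 // ltW.
have S n : nm (\sum_(k < n.+1) zerr N j (a + k%:R)) <=
    K' / rho ^+ p + K' / rho ^+ (p - 2) * (rho^-1 - (rho + n%:R)^-1).
  elim: n => [|n IH].
    by rewrite big_ord1 !addr0 subrr mulr0 addr0; have := e 0%N; rewrite !addr0.
  rewrite big_ord_recr /=; apply: le_trans (nmD _ _) _; apply: le_trans (lerD IH (e n.+1)) _.
  rewrite -addrA lerD2l -natr1 -/K'; set x : R := n%:R.
  have x0 : 0 <= x by [].
  have y0 : 0 < rho + x by lra.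
  have y1 : 0 < rho + (x + 1) by lra.
  suff : K' / (rho + (x + 1)) ^+ p <= K' / rho ^+ (p - 2) * ((rho + x)^-1 - (rho + (x + 1))^-1) by lra.
  have -> : (rho + x)^-1 - (rho + (x + 1))^-1 = ((rho + x) * (rho + (x + 1)))^-1.
    by field; rewrite !gt_eqF.
  rewrite -mulrA ler_wpM2l // -invfM lef_pV2 ?posrE ?mulr_gt0 ?exprn_gt0 //.
  rewrite -[X in _ <= _ ^+ X](subnK p2) exprD; apply: ler_pM.
  - by rewrite exprn_ge0 // ltW.
  - by rewrite mulr_ge0 // ltW.
  - by rewrite lerXn2r ?nnegrE ?(ltW r0) ?(ltW y1) //; lra.
  - by rewrite expr2 ler_wpM2r ?(ltW y1) //; lra.
rewrite -(subr0 (zrem N j a)); apply: (ccvg_le (N0 := 1) (zrem_cvg jN sa)) => [[//|n] _].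
rewrite subr0; apply: le_trans (S n) _.
have a1 : K' / rho ^+ p <= K' / rho ^+ p.-1.
  rewrite ler_wpM2l // lef_pV2 ?posrE ?exprn_gt0 // ler_weXn2l //; lia.
have a2 : K' / rho ^+ (p - 2) * (rho^-1 - (rho + n%:R)^-1) <= K' / rho ^+ p.-1.
  have -> : p.-1 = (p - 2).+1 by lia.
  have P0 : 0 <= K' / rho ^+ (p - 2) by apply: divr_ge0 => //; rewrite exprn_ge0 // ltW.
  have h : 0 <= (rho + n%:R)^-1 by rewrite invr_ge0 addr_ge0 // ltW.
  have h2 : rho^-1 - (rho + n%:R)^-1 <= rho^-1 by lra.
  by have := ler_wpM2l P0 h2; rewrite exprSr invfM mulrA.
apply: le_trans (lerD a1 a2) _; rewrite -/p -/K' le_eqVlt.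
by apply/orP; left; apply/eqP; ring.
Qed.

End Zeta.

(** * The Riemann zeta function *)

Section RiemannZeta.
Context {R : realType}.
Implicit Types (a s z l : R[i]).

Fixpoint pcoef (r : nat) s : R[i] :=
  if r is r'.+1 then (1 - s - r'%:R) * pcoef r' s else (1 - s)^-1.

(* The r-th derivative of u^(1-s)/(1-s) with respect to u, for u > 0. *)
Definition pterm s (r : nat) (u : R) : R[i] :=
  pcoef r s * cexp ((1 - s - r%:R) * (ln u)%:C).

Definition pmain (N : nat) s (u : R) := \sum_(r < N.+1) bcoef r * pterm s r u.

Definition perr (N : nat) s (k : nat) :=
  pmain N s k.+1%:R - pmain N s k%:R - cexp (- s * (ln (k%:R : R))%:C).

(** The derivative of order N + 1 of u^(1-s)/(1-s) is a multiple of u^(-s-N); the condition on Re s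
    makes it O(u^(-2)), so that the defects are summable. *)
Definition zeta_region (N : nat) s := (2 - N%:R < Re s) && (s != 1).

Lemma rderiv_ln (u t : R) : 0 < u + t ->
  rderiv (fun v => (ln (u + v))%:C : R[i]) t ((u + t)^-1)%:C.
Proof.
move=> ut; apply: rderiv_ReIm => /=; last exact: is_derive_cst.
have h1 : is_derive t 1 (fun v => u + v) (1 : R).
  by apply/derive_epsP => e e0; exists 1 => // h _; rewrite (_ : _ - _ - _ = 0) ?normr0 ?mulr_ge0 ?(ltW e0) //; ring.
have := is_derive1_comp (is_derive1_ln ut) h1.
by rewrite mulr1.
Qed.

Lemma cexp_nln (u : R) : 0 < u -> cexp (- (ln u)%:C) = (u^-1)%:C.
Proof. by move=> u0; rewrite cexpN cexp_real lnK ?posrE // fmorphV. Qed.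

Lemma rderiv_pterm s (r : nat) (u t : R) : 0 < u + t ->
  rderiv (fun v => pterm s r (u + v)) t (pterm s r.+1 (u + t)).
Proof.
move=> ut; have D := rderiv_comp (cderiv_cexp _) (rderivZ (1 - s - r%:R) (rderiv_ln ut)).
have := rderivZ (pcoef r s) D; congr rderiv.
rewrite /pterm /= -natr1.
have -> : (1 - s - (r%:R + 1)) * (ln (u + t))%:C =
  (1 - s - r%:R) * (ln (u + t))%:C + - (ln (u + t))%:C by ring.
by rewrite cexpD cexp_nln //; ring.
Qed.

Lemma pterm1 s (u : R) : s != 1 -> pterm s 1 u = cexp (- s * (ln u)%:C).
Proof.
move=> s1; have s0 : 1 - s != 0 by rewrite subr_eq0 eq_sym.
have E : pcoef 1 s = 1 by rewrite /pcoef subr0 divff.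
have E2 : 1 - s - 1%:R = - s by ring.
by rewrite /pterm E E2 mul1r.
Qed.

Definition pbound (N : nat) : R := \sum_(r < N.+1) nm (@bcoef R r) * 2 ^+ (N.+1 - r).

Lemma pbound_ge0 N : 0 <= pbound N.
Proof. by apply: sumr_ge0 => r _; rewrite mulr_ge0 ?nm_ge0 ?exprn_ge0. Qed.

Lemma perr_bound N s (k : nat) : (0 < N)%N -> zeta_region N s ->
  nm (perr N s k.+1) <= pbound N * nm (pcoef N.+1 s) / k.+1%:R ^+ 2.
Proof.
move=> N0 /andP[sN s1]; set u : R := k.+1%:R.
have u1 : 1 <= u by rewrite ler1n.
have := @euler_maclaurin R (@bcoef R) N N0 (@bernoulli_rec R) (fun r t => pterm s r (u + t))
  (nm (pcoef N.+1 s) / u ^+ 2).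
move=> /(_ _ _)/wrap[].
- by move=> r t _ /andP[t0 _]; apply: rderiv_pterm; lra.
- move=> t /andP[t0 _]; rewrite /pterm nmM ler_wpM2l ?nm_ge0 // nm_cexp.
  have u0 : 0 < u by lra.
  have -> : (u ^+ 2)^-1 = expR (- (2 * ln u)).
    by rewrite expRN mulrDl mul1r expRD lnK ?posrE // expr2.
  rewrite ler_expR cReM /= mulr0 subr0 !cReD !cReN /= -(rmorph_nat (real_complex R)) /=.
  have l1 : 0 <= ln u by rewrite ln_ge0.
  have l2 : ln u <= ln (u + t) by rewrite ler_ln ?posrE //; lra.
  have c : 2 <= Re s + N%:R by lra.
  have -> : (1 - Re s - N.+1%:R) = - (Re s + N%:R) by rewrite -natr1; ring.
  rewrite mulNr lerN2; apply: ler_pM => //; lra.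
rewrite /perr /pmain addr0 pterm1 // -[k.+2%:R]natr1 -/u.
by rewrite -[pbound N * _ / _]mulrA; exact.
Qed.

(** By telescoping this is the sum of k^(-s) for 1 <= k <= n, minus [pmain N s] at n + 1: the
    Dirichlet partial sum corrected by its Euler-Maclaurin main term. In this form it converges on
    all of [zeta_region]. *)
Definition zpart (N n : nat) s := - pmain N s 1 - \sum_(k < n) perr N s k.+1.

Definition zlim (N : nat) s : R[i] := clim (fun n => zpart N n s).

Lemma zpart_cvg N s : (0 < N)%N -> zeta_region N s ->
  ccvg (fun n => zpart N n s) (zlim N s) /\
  forall n, (0 < n)%N -> nm (zpart N n s - zlim N s) <= pbound N * nm (pcoef N.+1 s) / n%:R.
Proof.
move=> N0 sN; set K := pbound N * _.
have K0 : 0 <= K by rewrite mulr_ge0 ?pbound_ge0 ?nm_ge0.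
have [l [lP lH]] := @ccvg_series R (fun k => perr N s k.+1) K (-1) 0 K0
  (fun k _ _ => ltac:(by rewrite opprK natr1; apply: perr_bound)).
have E n : zpart N n s - (- pmain N s 1 - l) = - (\sum_(k < n) perr N s k.+1 - l).
  by rewrite /zpart; ring.
have zl : ccvg (fun n => zpart N n s) (- pmain N s 1 - l).
  by move=> e /lP[N1 H]; exists N1 => n /H; rewrite E nmN.
have zc := ccvg_clim zl; split; first exact: zc.
move=> n n0; rewrite /zlim (ccvg_uniq zc zl) E nmN.
have := lH n (leq0n _); rewrite addNr opprK subrK; apply.
by rewrite ltr0n.
Qed.

Lemma cderiv_pcoef r s : s != 1 -> exists l, cderiv (pcoef r) s l.
Proof.
move=> s1; have s0 : 1 - s != 0 by rewrite subr_eq0 eq_sym.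
elim: r => [|r [l lP]].
  eexists; apply: cderiv_comp (cderivB (cderiv_cst 1 s) (cderiv_id s)) (cderiv_inv s0).
eexists; apply: cderivM lP.
exact: cderivB (cderivB (cderiv_cst 1 s) (cderiv_id s)) (cderiv_cst r%:R s).
Qed.

Lemma cderiv_cpow (c : R[i]) (x : R) s :
  cderiv (fun s => cexp ((c - s) * x%:C)) s (- x%:C * cexp ((c - s) * x%:C)).
Proof.
have := cderiv_comp (cderivM (cderivB (cderiv_cst c s) (cderiv_id s)) (cderiv_cst x%:C s))
  (cderiv_cexp _).
by congr cderiv; ring.
Qed.

Lemma cderiv_pterm r s (u : R) l : cderiv (pcoef r) s l ->
  cderiv (fun s => pterm s r u) s
    (l * cexp ((1 - s - r%:R) * (ln u)%:C) - pcoef r s * ((ln u)%:C * cexp ((1 - s - r%:R) * (ln u)%:C))).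
Proof.
move=> lP; have := cderivM lP (cderiv_cpow (1 - r%:R) (ln u) s).
have E z : 1 - r%:R - z = 1 - z - r%:R :> R[i] by ring.
rewrite /pterm E => h; move: h; rewrite mulNr mulrN.
by congr cderiv; apply/funext => z; rewrite E.
Qed.

Lemma cderiv_zpart N n s : s != 1 -> exists l, cderiv (zpart N n) s l.
Proof.
move=> s1.
have D u : exists l, cderiv (fun s => pmain N s u) s l.
  have /choice[L LP] (r : nat) := cderiv_pcoef r s1.
  eexists; apply: cderiv_sum => r _; apply: cderivZ; apply: cderiv_pterm; exact: LP.
have /choice[L LP] (k : nat) : exists l, cderiv (fun s => perr N s k) s l.
  have [l1 h1] := D k.+1%:R; have [l2 h2] := D k%:R.
  have h3 : cderiv (fun z => cexp (- z * (ln (k%:R : R))%:C)) s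
      (- (ln (k%:R : R))%:C * cexp ((0 - s) * (ln (k%:R : R))%:C)).
    have := cderiv_cpow 0 (ln (k%:R : R)) s.
    by congr (cderiv _ s); apply/funext => z; rewrite sub0r.
  by eexists; apply: cderivB (cderivB h1 h2) h3.
have [l lP] := D 1.
by exists (- l - \sum_(k < n) L k.+1); apply: cderivB; [exact: cderivN|apply: cderiv_sum].
Qed.

Lemma zeta_region_open N s : zeta_region N s ->
  exists2 r : R, 0 < r & forall w, sq s r w -> zeta_region N w.
Proof.
move=> /andP[sN s1]; have n0 : 0 < nm (s - 1) by rewrite nm_gt0 subr_eq0.
exists (Num.min (Re s - (2 - N%:R)) (nm (s - 1) / 2)).
  by rewrite lt_min subr_gt0 sN divr_gt0.
move=> w; rewrite /sq !lt_min => /andP[/andP[a1 a2] /andP[_ b2]].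
apply/andP; split.
  by move: a1; rewrite cReD cReN ltr_norml => /andP[? _]; lra.
apply/eqP => w1; have e : nm (s - 1) = nm (w - s) by rewrite w1 nmBC.
by have := nm_le_ReIm (w - s); lra.
Qed.

(** On the square of half the radius [pcoef N.+1] is bounded, and with it the constant in the O(1/n)
    rate of convergence. *)
Lemma zpart_unif N s : (0 < N)%N -> zeta_region N s ->
  exists2 r : R, 0 < r & (forall w, sq s r w -> zeta_region N w) /\
    forall e : R, 0 < e -> exists N0 : nat, forall n, (N0 <= n)%N ->
      forall z, sq s r z -> nm (zpart N n z - zlim N z) <= e.
Proof.
move=> N0 sN; have [r r0 rS] := zeta_region_open sN.
have [p1 p2] : 0 < r / 2 /\ r / 2 < r by split; lra.
have [B B0 HB] : exists2 B, 0 <= B & forall z, sq s (r / 2) z -> nm (pcoef N.+1 z) <= B.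
  by apply: (holo_bounded p1 p2) => z /rS /andP[_ z1]; apply: cderiv_pcoef.
have sub w : sq s (r / 2) w -> zeta_region N w by move=> h; apply: rS; apply: sqW h; lra.
exists (r / 2) => //; split=> // e e0.
have K0 : 0 <= pbound N * B / e by rewrite divr_ge0 ?mulr_ge0 ?pbound_ge0 // ltW.
exists (Num.bound (pbound N * B / e)).+1 => n nN z zr.
have n0 : (0 < n)%N by apply: leq_ltn_trans nN.
have [_ /(_ n n0) h] := zpart_cvg N0 (sub _ zr); apply: le_trans h _.
have nR : 0 < n%:R :> R by rewrite ltr0n.
rewrite ler_pdivrMr //; apply: le_trans (ler_wpM2l (pbound_ge0 N) (HB _ zr)) _.
rewrite (mulrC e) -ler_pdivrMr //; apply: le_trans (ltW (archi_boundP K0)) _.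
by rewrite ler_nat ltnW.
Qed.

Lemma cderiv_zlim N s : (0 < N)%N -> zeta_region N s -> exists l, cderiv (zlim N) s l.
Proof.
move=> N0 sN; have [r r0 [rS U]] := zpart_unif N0 sN.
have H n : holo_on (sq s r) (zpart N n).
  by move=> z /rS /andP[_ z1]; apply: cderiv_zpart.
by have [l lP _] := weierstrass r0 H U; exists l.
Qed.

Lemma cexp_int (u : R) (m : int) : 0 < u -> cexp (m%:~R * (ln u)%:C) = u%:C ^ m.
Proof.
move=> u0.
have P (n : nat) : cexp (n%:R * (ln u)%:C) = u%:C ^+ n.
  elim: n => [|n IH]; first by rewrite mul0r cexp0.
  by rewrite -natr1 mulrDl mul1r cexpD IH cexp_real lnK ?posrE // exprSr.
case: m => n; first by rewrite -pmulrn P.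
by rewrite NegzE mulrNz mulNr cexpN -pmulrn P.
Qed.

(** At s = -j the s-derivative of u^(1-s)/(1-s) is the opposite of u^(j+1) log(u)/(j+1) -
    u^(j+1)/(j+1)^2; the same holds for all u-derivatives, and this is the statement about their
    coefficients. *)
Lemma pcoef_zcoef j r : pcoef r (- j%:R) = (zcoef j r).1 /\
  cderiv (pcoef r) (- j%:R) (- (zcoef j r).2 : R[i]).
Proof.
have j0 : j.+1%:R != 0 :> R[i] by rewrite pnatr_eq0.
have E : 1 - - j%:R = j.+1%:R :> R[i] by rewrite opprK nat1r.
elim: r => [|r [IH1 IH2]] /=.
  rewrite E; split=> //.
  have s0 : 1 - - j%:R != 0 :> R[i] by rewrite E.
  have := cderiv_comp (cderivB (cderiv_cst 1 (- j%:R)) (cderiv_id (- j%:R))) (cderiv_inv s0).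
  by rewrite E; congr cderiv; rewrite opprK exprVn sub0r mulrN1 opprK.
have E2 : 1 - - j%:R - r%:R = (j.+1%:Z - r%:Z)%:~R :> R[i].
  by rewrite E rmorphB /= -!pmulrn.
rewrite E2 IH1; split=> //.
have := cderivM (cderivB (cderivB (cderiv_cst 1 (- j%:R)) (cderiv_id (- j%:R)))
  (cderiv_cst r%:R (- j%:R))) IH2.
by rewrite /= E2 IH1; congr cderiv; ring.
Qed.

Lemma cderiv_pmain N j (u : R) : 0 < u ->
  cderiv (fun s => pmain N s u) (- j%:R) (- zmain N j u%:C).
Proof.
move=> u0; have := cderiv_sum (index_enum 'I_N.+1) (P := xpredT)
  (fun (r : 'I_N.+1) _ => cderivZ (bcoef r) (cderiv_pterm u (pcoef_zcoef j r).2)).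
congr cderiv; rewrite /zmain -sumrN; apply: eq_bigr => r _.
have [-> _] := pcoef_zcoef j r.
have -> : 1 - - j%:R - r%:R = (j.+1%:Z - r%:Z)%:~R :> R[i].
  by rewrite opprK nat1r rmorphB /= -!pmulrn.
rewrite cexp_int // /zterm clog_real //; ring.
Qed.

Lemma cderiv_perr N j (k : nat) :
  cderiv (fun s => perr N s k.+1) (- j%:R) (- zerr N j (1 + k%:R)).
Proof.
have k0 : 0 < k.+1%:R :> R by [].
have h3 := cderiv_cpow 0 (ln (k.+1%:R : R)) (- j%:R).
have h := cderivB (cderivB (cderiv_pmain N j (ltr0Sn R k.+1)) (cderiv_pmain N j k0)) h3.
have E : - zmain N j k.+2%:R%:C - - zmain N j k.+1%:R%:C -
    - (ln k.+1%:R)%:C * cexp ((0 - - j%:R) * (ln k.+1%:R)%:C) = - zerr N j (1 + k%:R) :> R[i].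
  have e1 : 1 + k%:R = k.+1%:R :> R[i] by rewrite nat1r.
  rewrite /zerr e1 natr1 !rmorph_nat.
  have e2 : 0 - - j%:R = (j%:Z)%:~R :> R[i] by rewrite sub0r opprK -pmulrn.
  rewrite e2 cexp_int // -exprnP !rmorph_nat.
  by rewrite -(clog_real k0) rmorph_nat; ring.
rewrite -E; move: h; congr (cderiv _ (- j%:R)); apply/funext => z.
by rewrite /perr sub0r.
Qed.

Lemma cderiv_zpart_nat N n j :
  cderiv (zpart N n) (- j%:R) (zmain N j 1 + \sum_(k < n) zerr N j (1 + k%:R)).
Proof.
have h1 := cderivN (cderiv_pmain N j ltr01).
have h2 := cderiv_sum (index_enum 'I_n) (P := xpredT)
  (fun (k : 'I_n) _ => cderiv_perr N j k).
have := cderivB h1 h2; rewrite opprK rmorph1 sumrN opprK.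
by [].
Qed.

(** The s-derivatives of [zpart] at -j are the partial sums that define Z_j(1), and Weierstrass'
    theorem identifies the limits. N > j + 2 puts -j inside [zeta_region N]. *)
Lemma zlim_derive N j l : (j.+2 < N)%N -> cderiv (zlim N) (- j%:R) l -> l = zfun N j 1.
Proof.
move=> jN lP; have N0 : (0 < N)%N by lia.
have jr : zeta_region N (- j%:R).
  apply/andP; split.
    rewrite cReN -(rmorph_nat (real_complex R)) /=.
    by have : j.+2%:R < N%:R :> R; [rewrite ltr_nat|rewrite -!natr1; lra].
  by rewrite eq_sym -subr_eq0 opprK nat1r pnatr_eq0.
have [r r0 [rS U]] := zpart_unif N0 jr.
have H n : holo_on (sq (- j%:R) r) (zpart N n).
  by move=> z /rS /andP[_ z1]; apply: cderiv_zpart.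
have [m mP mU] := weierstrass r0 H U.
rewrite (cderiv_uniq lP mP).
have c1 : ccvg (fun n => zmain N j 1 + \sum_(k < n) zerr N j (1 + k%:R)) m.
  by move=> e e0; apply: (mU _ _ e e0) => n; apply: cderiv_zpart_nat.
apply: ccvg_uniq c1 _; apply: ccvgD; first exact: ccvg_cst.
by apply: zrem_cvg; [lia|rewrite /slit /= ltr01].
Qed.

Lemma powR_decay (sig e : R) : 0 < sig -> 0 < e ->
  exists K0 : nat, forall K : nat, (K0 <= K)%N -> expR (- sig * ln K.+1%:R) <= e.
Proof.
move=> s0 e0; pose x := expR (- ln e / sig).
exists (Num.bound x) => K hK.
have xK : x <= K.+1%:R.
  apply: le_trans (ltW (archi_boundP (expR_ge0 _))) _.
  by rewrite ler_nat; apply: leqW.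
have : - ln e / sig <= ln K.+1%:R by rewrite -[leLHS]expRK ler_ln ?posrE ?expR_gt0.
rewrite ler_pdivrMr // => h; rewrite -[leRHS](lnK (_ : e \in Num.pos)) ?posrE // ler_expR.
by lra.
Qed.

(** For Re s > 1 the correction [pmain N s] at n + 1 tends to 0, each of its terms being O(n^(1 - Re
    s)). *)
Lemma zeta_eq_zlim N (zeta : R[i] -> R[i]) s : (1 < N)%N -> riemann_zeta zeta ->
  1 < Re s -> zeta s = zlim N s.
Proof.
move=> N1 [_ Hz] s1; have N0 : (0 < N)%N by lia.
have sN : zeta_region N s.
  apply/andP; split; last by apply: contraTneq s1 => ->; rewrite /= ltxx.
  by have : 1 < N%:R :> R; [rewrite ltr1n|lra].
have [zc _] := zpart_cvg N0 sN.
have c1 : ccvg (fun n => \sum_(k < n) cexp (- s * (ln (k.+1%:R : R))%:C)) (zeta s).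
  have := Hz s s1 => /cvgrPdist_le H e e0.
  have e0' : 0 < e%:C by rewrite ltcR.
  have [N' _ H'] := H _ e0'; exists N' => n /H' /=.
  by rewrite nmE lecR nmBC /series /= big_mkord.
have E n : zpart N n s = \sum_(k < n) cexp (- s * (ln (k.+1%:R : R))%:C) - pmain N s n.+1%:R.
  rewrite /zpart; elim: n => [|n IH]; first by rewrite !big_ord0 subr0 sub0r.
  rewrite !big_ord_recr /= opprD addrA IH /perr; ring.
have c2 : ccvg (fun n => pmain N s n.+1%:R) 0.
  move=> e e0; pose B : R := \sum_(r < N.+1) nm (bcoef r) * nm (pcoef r s) + 1.
  have B0 : 0 < B by rewrite ltr_wpDl // sumr_ge0 // => r _; rewrite mulr_ge0 ?nm_ge0.
  have sg : 0 < Re s - 1 by lra.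
  have [K0 HK] := powR_decay sg (divr_gt0 e0 B0).
  exists K0 => n nK; rewrite subr0; apply: le_trans (nm_sum _ _ _) _.
  apply: le_trans (_ : _ <= \sum_(r < N.+1) nm (bcoef r) * nm (pcoef r s) * (e / B)) _.
    apply: ler_sum => r _; rewrite /pterm nmM (nmM (pcoef r s)) mulrA ler_wpM2l ?mulr_ge0 ?nm_ge0 // nm_cexp.
    apply: le_trans (HK n nK); rewrite ler_expR cReM /= mulr0 subr0.
    rewrite -(rmorph_nat (real_complex R)) !cReD !cReN /=.
    apply: ler_wpM2r; first by rewrite ln_ge0 // ler1n.
    by have : 0 <= r%:R :> R by []; lra.
  rewrite -mulr_suml mulrA ler_pdivrMr // mulrC ler_wpM2l ?(ltW e0) //.
  by rewrite /B lerDl.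
have c3 := ccvgD zc c2.
apply: ccvg_uniq c1 _; rewrite addr0 in c3; move: c3; congr ccvg.
by apply/funext => n; rewrite E subrK.
Qed.

Definition nearly0 (f : R[i] -> R[i]) (c : R[i]) :=
  exists2 d : R, 0 < d & forall w, nm (w - c) < d -> f w = 0.

(** One step of analytic continuation: the identity theorem carries vanishing near c to the disc of
    radius r, hence near c'. *)
Lemma nearly0_sq f c r c' : holo_on (sq c r) f -> nearly0 f c -> nm (c' - c) < r -> nearly0 f c'.
Proof.
move=> hf [d d0 D] cr; exists (r - nm (c' - c)); first by rewrite subr_gt0.
move=> w wc; have -> : w = c + (w - c) by ring.
apply: (identity_sq d0 hf) => [t /andP[t0 td]|].
  by apply: D; rewrite addrC addKr nm_real gtr0_norm.
by apply: le_lt_trans (nm_dist c' _ _) _; lra.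
Qed.

(* The continuation goes from the half-plane Re s > 1 to a neighbourhood of -j
   along the line Im s = 1, in steps of 1/2, and then down. *)
Lemma zeta_derive N j (zeta : R[i] -> R[i]) : (j.+2 < N)%N -> riemann_zeta zeta ->
  derive1 zeta (- j%:R) = zfun N j 1.
Proof.
move=> jN Hz; have N0 : (0 < N)%N by lia.
have jN' : j%:R + 3 <= N%:R :> R.
  by have : j.+3%:R <= N%:R :> R; [rewrite ler_nat|rewrite -!natr1; lra].
pose f s := zeta s - zlim N s.
(* Since N >= j + 3, [zeta_region N] contains every s <> 1 with Re s > -j - 1. *)
have hf s : - j%:R - 1 < Re s -> s != 1 -> exists l, cderiv f s l.
  move=> s1 s2; have [l lP] : exists l, cderiv (zlim N) s l.
    by apply: cderiv_zlim => //; apply/andP; split=> //; lra.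
  have := derivable_cderiv (Hz.1 s s2) => zP.
  by eexists; apply: cderivB zP lP.
have sqRe (c : R[i]) (r : R) w : sq c r w -> Re c - r < Re w < Re c + r /\ Im c - r < Im w < Im c + r.
  rewrite /sq !(cReD, cReN, cImD, cImN) !ltr_norml => /andP[/andP[? ?] /andP[? ?]].
  by split; apply/andP; split; lra.
have start : nearly0 f (2 +i* 1).
  exists 1; first exact: ltr01.
  move=> w wd; apply/eqP; rewrite subr_eq0; apply/eqP; apply: (zeta_eq_zlim _ Hz); first by lia.
  by have [/= /andP[w1 _] _] := sqRe _ _ _ (sq_nm wd); lra.
have along (m : nat) : m%:R / 2 <= j%:R + 2 :> R -> nearly0 f ((2 - m%:R / 2) +i* 1).
  elim: m => [|m IH] hm; first by rewrite mul0r subr0.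
  have hm' : m%:R / 2 <= j%:R + 2 - 1 / 2 :> R by move: hm; rewrite -natr1; lra.
  (* A square of radius 1 centred on the line Im s = 1 stays in Im s > 0 and so avoids the pole. *)
  apply: (@nearly0_sq f _ 1 _ _ (IH _)); last 2 first.
  - by lra.
  - have -> : (2 - m.+1%:R / 2) +i* 1 - (2 - m%:R / 2) +i* 1 = (- (1 / 2))%:C :> R[i].
      by apply/eqP; rewrite eq_complex /= subrr eqxx andbT -natr1; apply/eqP; field.
    by rewrite nm_real normrN ger0_norm; lra.
  - move=> w /sqRe[/= /andP[w1 _] /andP[w2 _]]; apply: hf; first by lra.
    by apply: contraTneq w2 => ->; rewrite /=; lra.
have at1 : nearly0 f ((- j%:R) +i* 1).
  (* From 2 to -j there are 2j + 4 steps of length 1/2. *)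
  have := along (j.*2 + 4)%N.
  have -> : (j.*2 + 4)%:R / 2 = j%:R + 2 :> R by rewrite natrD -muln2 natrM; field.
  move=> /(_ (lexx _)); congr (nearly0 f (_ +i* _)); ring.
have at2 : nearly0 f ((- j%:R) +i* (1 / 2)).
  apply: (@nearly0_sq f _ 1 _ _ at1).
  - move=> w /sqRe[/= /andP[w1 _] /andP[w2 _]]; apply: hf; first by lra.
    by apply: contraTneq w2 => ->; rewrite /=; lra.
  - apply: le_lt_trans (nm_le_ReIm _) _; rewrite /= subrr normr0 add0r ler0_norm; lra.
have at3 : nearly0 f (- j%:R).
  have E : - j%:R = (- j%:R : R) +i* 0 :> R[i].
    by rewrite -(rmorph_nat (real_complex R)) -rmorphN.
  (* This square crosses the real axis, but lies in Re s < 1 - j, to the left of the pole. *)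
  apply: (@nearly0_sq f _ 1 _ _ at2).
  - move=> w /sqRe[/= /andP[w1 w3] _]; apply: hf; first by lra.
    by apply: contraTneq w3 => ->; rewrite /=; have : 0 <= j%:R :> R by []; lra.
  - by rewrite E; apply: le_lt_trans (nm_le_ReIm _) _; rewrite /= subrr normr0 add0r ler0_norm; lra.
have [d d0 D] := at3.
have j1 : - j%:R != 1 :> R[i].
  by rewrite eq_sym -subr_eq0 opprK nat1r pnatr_eq0.
have [l lP] : exists l, cderiv (zlim N) (- j%:R) l.
  apply: cderiv_zlim => //; apply/andP; split=> //.
  by rewrite cReN -(rmorph_nat (real_complex R)) /=; lra.
rewrite -(zlim_derive jN lP); apply: cderiv_derive1.
apply: cderiv_near d0 _ lP => w /D; rewrite /f => /eqP; rewrite subr_eq0 => /eqP //.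
Qed.

End RiemannZeta.

(** * Identification of the multiple gamma functions *)

Section BinomialPolynomials.
Context {R : realType}.
Implicit Types (z u : R[i]) (p q : {poly R[i]}).

Lemma poly_ext p q : (forall x, p.[x] = q.[x]) -> p = q.
Proof.
move=> H; apply/eqP; rewrite -subr_eq0; apply/negPn/negP => n0.
have := @max_poly_roots _ (p - q) [seq i%:R | i <- iota 0 (size (p - q))] n0.
rewrite size_map size_iota ltnn => C; suff : false by [].
apply: C.
- by apply/allP => _ /mapP[i _ ->]; rewrite /root hornerD hornerN H subrr.
- rewrite map_inj_uniq ?iota_uniq // => i j /eqP.
  by rewrite eqr_nat => /eqP.
Qed.

Lemma poly_nat_zero p : (forall k : nat, p.[k%:R] = 0) -> p = 0.
Proof.
move=> H; apply/eqP/negPn/negP => n0.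
have := @max_poly_roots _ p [seq i%:R | i <- iota 0 (size p)] n0.
rewrite size_map size_iota ltnn => C; suff : false by [].
apply: C.
- by apply/allP => _ /mapP[i _ ->]; rewrite /root H.
- by rewrite map_inj_uniq ?iota_uniq // => i j /eqP; rewrite eqr_nat => /eqP.
Qed.

Lemma binom_polyE k z : (binom_poly R k).[z] = (k`!%:R)^-1 * \prod_(i < k) (z - i%:R).
Proof.
rewrite /binom_poly hornerZ horner_prod; congr (_ * _); apply: eq_bigr => i _.
by rewrite hornerD hornerN hornerX hornerC.
Qed.

Lemma size_binom_poly k : (size (binom_poly R k) <= k.+1)%N.
Proof.
apply: leq_trans (size_scale_leq _ _) _.
rewrite -(big_mkord xpredT (fun i => 'X - i%:R%:P)).
by rewrite (size_prod_XsubC _ (fun i : nat => i%:R)) size_iota subn0.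
Qed.

Lemma binom_poly0 k : (binom_poly R k).[0] = (k == 0%N)%:R.
Proof.
rewrite binom_polyE; case: k => [|k]; first by rewrite big_ord0 fact0 invr1 mul1r.
by rewrite big_ord_recl subrr mul0r mulr0.
Qed.

Lemma binom_pascal k z :
  (binom_poly R k.+1).[z + 1] = (binom_poly R k.+1).[z] + (binom_poly R k).[z].
Proof.
rewrite !binom_polyE big_ord_recl [X in _ = _ * X + _]big_ord_recr /= subr0.
have -> : \prod_(i < k) (z + 1 - (bump 0 i)%:R) = \prod_(i < k) (z - i%:R).
  by apply: eq_bigr => i _; rewrite /bump add1n -natr1; ring.
rewrite factS natrM; set P := \prod_(i < k) _.
have f0 : k`!%:R != 0 :> R[i] by rewrite pnatr_eq0 -lt0n fact_gt0.
have k0 : k.+1%:R != 0 :> R[i] by rewrite pnatr_eq0.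
by field; rewrite f0 nat1r k0.
Qed.

Lemma size_comp_binom n z : (0 < n)%N -> (size (binom_poly R n.-1 \Po (z%:P - 'X)) <= n)%N.
Proof.
move=> n0; apply: leq_trans (size_comp_poly_leq _ _) _.
have s2 : (size ((z%:P - 'X)%R : {poly R[i]}) <= 2)%N.
  by rewrite -opprB size_polyN size_XsubC.
have s1 := size_binom_poly n.-1; rewrite prednK // in s1.
apply: (@leq_ltn_trans (n.-1 * 1)); last by lia.
by apply: leq_mul; [move: s1|move: s2]; case: (size _) => [|m] //=; lia.
Qed.

Lemma sum_Gcoef n z u : (0 < n)%N ->
  \sum_(j < n) Gcoef n j z * u ^+ j = (binom_poly R n.-1).[z - u].
Proof.
move=> n0; have -> : (binom_poly R n.-1).[z - u] = (binom_poly R n.-1 \Po (z%:P - 'X)).[u].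
  by rewrite horner_comp hornerD hornerN hornerX hornerC.
rewrite (@horner_coef_wide _ n) //; exact: size_comp_binom.
Qed.

Lemma GcoefS n j z : (0 < n)%N -> Gcoef n.+1 j (z + 1) = Gcoef n.+1 j z + Gcoef n j z.
Proof.
case: n => // n _; rewrite /Gcoef /=.
have PE (p q r : {poly R[i]}) : (forall u, p.[u] = q.[u] + r.[u]) -> p = q + r.
  by move=> H; apply: poly_ext => u; rewrite hornerD.
have E := PE (binom_poly R n.+1 \Po ((z + 1)%:P - 'X))
  (binom_poly R n.+1 \Po (z%:P - 'X)) (binom_poly R n \Po (z%:P - 'X)).
rewrite E ?coefD // => u; rewrite !horner_comp !hornerD !hornerN !hornerX !hornerC.
by rewrite addrAC binom_pascal.
Qed.

Lemma Gcoef_high n z : (0 < n)%N -> Gcoef n n z = 0.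
Proof.
move=> n0; rewrite /Gcoef nth_default //; exact: size_comp_binom.
Qed.

Lemma Gcoef_nderiv n j z : Gcoef n j z = (-1) ^+ j * (binom_poly R n.-1)^`N(j).[z].
Proof.
rewrite /Gcoef; set p := binom_poly R _.
have -> : p \Po (z%:P - 'X) = \poly_(i < size p) ((-1) ^+ i * p^`N(i).[z]).
  apply: poly_ext => u; rewrite horner_comp hornerD hornerN hornerX hornerC.
  rewrite nderiv_taylor; last exact: mulrC.
  by rewrite horner_poly; apply: eq_bigr => i _; rewrite (exprNn u) mulrCA mulrA.
rewrite coef_poly; case: ltnP => // h.
by rewrite nderivn_poly0 // horner0 mulr0.
Qed.

Lemma size_nderivn_leq p j : (size p^`N(j) <= size p - j)%N.
Proof. by apply/leq_sizeP => i hi; rewrite coef_nderivn nth_default ?mul0rn // -leq_subLR. Qed.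

Definition Gpoly n j : {poly R[i]} := (-1) ^+ j *: (binom_poly R n.-1)^`N(j).

Lemma GpolyE n j z : (Gpoly n j).[z] = Gcoef n j z.
Proof. by rewrite hornerZ Gcoef_nderiv. Qed.

Lemma size_Gpoly n j : (0 < n)%N -> (size (Gpoly n j) <= n - j)%N.
Proof.
move=> n0; apply: leq_trans (size_scale_leq _ _) _.
apply: leq_trans (size_nderivn_leq _ _) _; apply: leq_sub2r.
by have := size_binom_poly n.-1; rewrite prednK.
Qed.

Lemma cderiv_horner p z : cderiv (fun w => p.[w]) z p^`().[z].
Proof.
elim/poly_ind: p => [|p c IH].
  have -> : (fun w => (0 : {poly R[i]}).[w]) = fun=> 0.
    by apply/funext => w; rewrite horner0.
  by rewrite deriv0 horner0; apply: cderiv_cst.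
have -> : (fun w => (p * 'X + c%:P).[w]) = (fun w => p.[w] * w + c).
  by apply/funext => w; rewrite hornerMXaddC.
have := cderivD (cderivM IH (cderiv_id z)) (cderiv_cst c z).
congr cderiv; rewrite derivD derivC derivM derivX !hornerE; ring.
Qed.

Lemma horner_bound p (m : nat) : (size p <= m.+1)%N -> exists2 C : R, 0 <= C &
  forall z, 1 <= nm z -> nm p.[z] <= C * nm z ^+ m.
Proof.
move=> sp; exists (\sum_(i < m.+1) nm p`_i).
  by apply: sumr_ge0 => i _; apply: nm_ge0.
move=> z z1; rewrite (horner_coef_wide _ sp) mulr_suml.
apply: le_trans (nm_sum _ _ _) _; apply: ler_sum => i _.
rewrite nmM nmX ler_wpM2l ?nm_ge0 // ler_weXn2l //.
by rewrite -ltnS.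
Qed.

(* The value of log G_n(z + 1), see branch_Lam. *)
Definition Lam N n z := \sum_(j < n) Gcoef n j z * (zfun N j (z + 1) - zfun N j 1).

Lemma Lam0 N n : Lam N n 0 = 0.
Proof. by rewrite /Lam add0r big1 // => j _; rewrite subrr mulr0. Qed.

Lemma LamS N n z : (0 < n)%N -> (n < N)%N -> slit (z + 1) ->
  Lam N n (z + 1) = \sum_(j < n) Gcoef n j (z + 1) * (zfun N j (z + 1) - zfun N j 1)
    + (n == 1%N)%:R * clog (z + 1).
Proof.
move=> n0 nN sz.
have -> : (n == 1%N)%:R = \sum_(j < n) Gcoef n j (z + 1) * (z + 1) ^+ j :> R[i].
  by rewrite sum_Gcoef // subrr binom_poly0; case: n n0 {nN} => [//|[|n]].
rewrite mulr_suml -big_split /=; apply: eq_bigr => j _.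
rewrite zfunS //; first by ring.
by apply: leq_ltn_trans nN.
Qed.

Lemma Lam_rec1 N z : (1 < N)%N -> slit (z + 1) -> Lam N 1 (z + 1) = Lam N 1 z + clog (z + 1).
Proof.
move=> N1 sz; rewrite LamS // mul1r /Lam !big_ord1; congr (_ * _ + _).
by rewrite !Gcoef_nderiv /= !expr0 !mul1r !nderivn0 !binom_polyE !big_ord0.
Qed.

Lemma Lam_rec N n z : (0 < n)%N -> (n.+1 < N)%N -> slit (z + 1) ->
  Lam N n.+1 (z + 1) = Lam N n.+1 z + Lam N n z.
Proof.
move=> n0 nN sz; rewrite LamS // eqSS (gtn_eqF n0) mul0r addr0.
have -> : Lam N n z = \sum_(j < n.+1) Gcoef n j z * (zfun N j (z + 1) - zfun N j 1).
  by rewrite big_ord_recr /= Gcoef_high // mul0r addr0.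
rewrite -big_split /=; apply: eq_bigr => j _.
by rewrite GcoefS // mulrDl.
Qed.

Lemma cderiv_Lam N n z : (n < N)%N -> slit (z + 1) -> exists l, cderiv (Lam N n) z l.
Proof.
move=> nN sz.
have /choice[L LP] (j : 'I_n) : exists l,
    cderiv (fun z => Gcoef n j z * (zfun N j (z + 1) - zfun N j 1)) z l.
  have h1 := cderiv_horner (Gpoly n j) z.
  have jN : (j.+1 < N)%N by apply: leq_ltn_trans nN.
  have [l2 h2] := cderiv_zfun jN sz.
  have h3 := cderivB (cderiv_comp (g := fun w => w + 1)
    (cderivD (cderiv_id z) (cderiv_cst 1 z)) h2) (cderiv_cst (zfun N j 1) z).
  eexists; have := cderivM h1 h3.
  by congr cderiv; apply/funext => w; rewrite GpolyE.
by exists (\sum_(j < n) L j); apply: cderiv_sum => j _.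
Qed.

End BinomialPolynomials.

(** * Iterated finite differences *)

Section Differences.
Context {R : realType}.

Fixpoint diffn {V : zmodType} (h : R) (k : nat) (f : R -> V) (t : R) : V :=
  if k is k'.+1 then diffn h k' f (t + h) - diffn h k' f t else f t.

Lemma diffnB (V : zmodType) (h : R) k (f g : R -> V) t :
  diffn h k (fun s => f s - g s) t = diffn h k f t - diffn h k g t.
Proof. by elim: k t => //= k IH t; rewrite !IH !opprD addrACA. Qed.

Lemma diffn_shift (V : zmodType) (h : R) k (f : R -> V) (c t : R) :
  diffn h k (fun s => f (s + c)) t = diffn h k f (t + c).
Proof. by elim: k t => //= k IH t; rewrite !IH addrAC. Qed.

Lemma diffn_real (h : R) k (f : R -> R) t :
  diffn h k (fun s => (f s)%:C : R[i]) t = (diffn h k f t)%:C.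
Proof. by elim: k t => //= k IH t; rewrite !IH rmorphB. Qed.

Lemma diffn_ext (V : zmodType) (h : R) k (f g : R -> V) (t : R) : 0 <= h ->
  (forall s, t <= s -> f s = g s) -> diffn h k f t = diffn h k g t.
Proof.
move=> h0; elim: k t => [|k IH] t H /=; first exact: H.
by congr (_ - _); apply: IH => s hs; apply: H => //; lra.
Qed.

(** Differences commute with derivatives, so the mean value theorem trades one difference for one
    derivative. *)
Lemma diffn_chain_ge0 (psi : nat -> R -> R) (h : R) k : 0 < h ->
  (forall j (t : R), 0 < t -> is_derive t 1 (psi j) (psi j.+1 t)) ->
  (forall t, 0 < t -> 0 <= psi k t) ->
  forall t, 0 < t -> 0 <= diffn h k (psi 0%N) t.
Proof.
move=> h0; elim: k psi => [|k IH] psi D P t t0 /=; first exact: P.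
have D1 j (s : R) : 0 < s -> is_derive s 1 (diffn h j (psi 0%N)) (diffn h j (psi 1%N) s).
  elim: j s => [|j IHj] s s0 /=; first exact: D.
  apply: is_deriveB; last exact: IHj.
  have sh : 0 < s + h by lra.
  have h1 : is_derive s 1 (fun v => v + h) (1 : R).
    by apply/derive_epsP => e e0; exists 1 => // v _; rewrite (_ : _ - _ - _ = 0) ?normr0 ?mulr_ge0 ?(ltW e0) //; ring.
  have h2 := IHj _ sh.
  by have := is_derive1_comp (g := fun v => v + h) h2 h1; rewrite mulr1.
have P1 := IH (fun j => psi j.+1) (fun j => D j.+1) P.
rewrite subr_ge0; have th : t <= t + h by lra.
have C : {within `[t, t + h], continuous (diffn h k (psi 0%N))}.
  apply: continuous_in_subspaceT => x; rewrite inE /= in_itv /= => /andP[xt _].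
  by apply: is_derive_cont (D1 k x _); lra.
have D' x : x \in `]t, (t + h)[ -> is_derive x 1 (diffn h k (psi 0%N)) (diffn h k (psi 1%N) x).
  by rewrite in_itv /= => /andP[xt _]; apply: D1; lra.
have [c + E] := MVT_segment th D' C.
rewrite in_itv /= => /andP[ct _].
rewrite -subr_ge0 E mulr_ge0 //; last by lra.
by apply: P1; lra.
Qed.

Lemma diffn_chain_small (phi : nat -> R -> R[i]) (h : R) k : 0 < h ->
  (forall j (t : R), 0 < t -> rderiv (phi j) t (phi j.+1 t)) ->
  (forall e : R, 0 < e -> exists T, forall t, T <= t -> nm (phi k t) <= e) ->
  forall e : R, 0 < e -> exists T, forall t, T <= t -> nm (diffn h k (phi 0%N) t) <= e.
Proof.
move=> h0; elim: k phi => [//|k IH] phi D P e e0 /=.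
have D1 j (s : R) : 0 < s -> rderiv (diffn h j (phi 0%N)) s (diffn h j (phi 1%N) s).
  elim: j s => [|j IHj] s s0 /=; first exact: D.
  apply: rderivB; last exact: IHj.
  have sh : 0 < s + h by lra.
  by move=> e' /(IHj _ sh)[d d0 X]; exists d => // v /X; rewrite (addrAC s h v).
have e1 : 0 < e / (2 * h) by rewrite divr_gt0 ?mulr_gt0.
have [T HT] := IH (fun j => phi j.+1) (fun j => D j.+1) P _ e1.
exists (Num.max T 1) => t; rewrite ge_max => /andP[Tt t1].
have th : t <= t + h by lra.
have := @mean_value R (diffn h k (phi 0%N)) (diffn h k (phi 1%N)) t (t + h) (e / (2 * h)) th.
have -> : 2 * (e / (2 * h)) * (t + h - t) = e by field; rewrite gt_eqF.
apply=> s /andP[s1 s2]; first by apply: D1; lra.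
by apply: HT; lra.
Qed.

End Differences.

(** * Uniqueness of Bohr-Mollerup type *)

Section Uniqueness.
Context {R : realType}.

(* With h = 1/q, the differences of order n+2 of l_(n+1) are squeezed between 0
   and the differences of order n+1 of l_n. *)
Lemma convex_diff_small (l : nat -> R -> R) (q : nat) : (0 < q)%N ->
  (forall x, 0 < x -> l 0%N x = ln (x + 1)) ->
  (forall n x, 0 < x -> l n.+1 (x + 1) = l n.+1 x + l n x) ->
  (forall n h t, 0 < h -> 0 < t -> 0 <= diffn h n.+2 (l n.+1) t) ->
  forall n x e, 0 < x -> 0 < e -> exists K0 : nat, forall K : nat, (K0 <= K)%N ->
    `|diffn q%:R^-1 n.+1 (l n) (x + K%:R / q%:R)| <= e.
Proof.
move=> q0 l0 lS lpos n x e x0 e0.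
have qR : 0 < q%:R :> R by rewrite ltr0n.
set h : R := q%:R^-1; have h0 : 0 < h by rewrite invr_gt0.
have xK (K : nat) : 0 < x + K%:R / q%:R by rewrite ltr_wpDr // divr_ge0 // ltW.
elim: n e e0 => [|n IH] e e0.
  exists (Num.bound (q%:R * (h / e))) => K hK /=.
  have hq : h / e <= K%:R * h.
    have Ke : q%:R * (h / e) <= K%:R.
      apply: le_trans (ltW (archi_boundP _)) _; last by rewrite ler_nat.
      by rewrite mulr_ge0 ?divr_ge0 // ltW.
    have hq1 : h * q%:R = 1 by rewrite mulVf // gt_eqF.
    by have := ler_wpM2l (ltW h0) Ke; rewrite (mulrA h q%:R) hq1 mul1r (mulrC h K%:R).
  set y := x + _; have y0 : 0 < y by apply: xK.
  have yh : h / e <= y by rewrite /y -/h; lra.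
  rewrite !l0 //; last by lra.
  have -> : ln (y + h + 1) - ln (y + 1) = ln (1 + h / (y + 1)).
    rewrite -ln_div ?posrE; [congr ln; field|lra|lra]; lra.
  have p0 : 0 <= h / (y + 1) by rewrite divr_ge0; lra.
  rewrite ger0_norm; last by rewrite ln_ge0 // lerDl.
  have h1 : 1 + h / (y + 1) <= expR (h / (y + 1)) by apply: expR_ge1Dx.
  apply: (@le_trans _ _ (h / (y + 1))).
    by rewrite -[leRHS]expRK ler_ln ?posrE ?expR_gt0 //; lra.
  rewrite ler_pdivrMr; last by lra.
  have : h <= e * y by rewrite mulrC -ler_pdivrMr.
  by lra.
have [K0 HK] := IH e e0; exists K0 => K hK.
pose a (i : nat) := diffn h n.+1 (l n.+1) (x + i%:R / q%:R).
have step i : a i.+1 - a i = diffn h n.+2 (l n.+1) (x + i%:R / q%:R).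
  by rewrite /a /= -natr1 mulrDl mul1r -/h !addrA.
have mono i : a i <= a i.+1 by rewrite -subr_ge0 step; apply: lpos.
have am : {homo a : i j / (i <= j)%N >-> i <= j}.
  by apply: homo_leq => // u v w; apply: le_trans.
have per : a (K + q)%N - a K = diffn h n.+1 (l n) (x + K%:R / q%:R).
  rewrite /a natrD mulrDl divff ?gt_eqF // addrA -diffn_shift -diffnB.
  apply: diffn_ext; first exact: ltW.
  move=> s hs; rewrite lS; first by ring.
  by apply: lt_le_trans hs; apply: xK.
rewrite -step ger0_norm ?subr_ge0 //.
apply: le_trans (HK K hK); rewrite -per; apply: le_trans (ler_norm _).
by rewrite lerD2r; apply: am; rewrite -[K.+1]addn1 leq_add2l.
Qed.

(** With step 1/q, the difference of order m + 1 is 1-periodic and tends to 0, hence is 0. If the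
    difference of order k + 1 vanishes, that of order k is constant along the grid; for k >= 1, q
    such increments make up one period of the difference of order k - 1, so the constant is 0. At
    order 1, d is invariant under all positive rational shifts, and continuity concludes. *)
Lemma periodic_const (d : R -> R[i]) (m : nat) :
  (forall t, 0 < t -> d (t + 1) = d t) ->
  (forall t, 0 < t -> rcont d t) ->
  (forall (q : nat) x e, (0 < q)%N -> 0 < x -> 0 < e ->
    exists K0 : nat, forall K : nat, (K0 <= K)%N ->
    nm (diffn q%:R^-1 m.+1 d (x + K%:R / q%:R)) <= e) ->
  forall x y, 0 < x -> 0 < y -> d x = d y.
Proof.
move=> per cont small.
have Z (q : nat) (k : nat) : (0 < q)%N -> (k <= m)%N -> forall x, 0 < x -> diffn q%:R^-1 (m - k).+1 d x = 0.
  move=> q0; have qR : 0 < q%:R :> R by rewrite ltr0n.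
  set h : R := q%:R^-1; have h0 : 0 < h by rewrite invr_gt0.
  have pd j t : 0 < t -> diffn h j d (t + 1) = diffn h j d t.
    move=> t0; rewrite -diffn_shift; apply: diffn_ext; first exact: ltW.
    by move=> s ts; apply: per; lra.
  have pdn j t (i : nat) : 0 < t -> diffn h j d (t + i%:R) = diffn h j d t.
    move=> t0; elim: i => [|i IHi]; first by rewrite addr0.
    by rewrite -natr1 addrA pd // ltr_wpDr.
  elim: k => [_|k IH km] x x0.
    rewrite subn0; apply: nm_le0; apply/ler_addgt0Pr => e e0; rewrite add0r.
    have [K0 HK] := small q x e q0 x0 e0.
    have := HK (K0 * q)%N (leq_pmulr _ q0).
    by rewrite natrM mulfK ?gt_eqF // pdn.
  have km' : (k <= m)%N by apply: ltnW.
  have E : (m - k)%N = (m - k.+1).+1 by rewrite subnSK.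
  set j := (m - k.+1)%N in E *.
  have cst t : 0 < t -> diffn h j.+1 d (t + h) = diffn h j.+1 d t.
    by move=> t0; apply/eqP; rewrite -subr_eq0; apply/eqP; have := IH km' t t0; rewrite E.
  have csti (i : nat) : diffn h j.+1 d (x + i%:R * h) = diffn h j.+1 d x.
    elim: i => [|i IHi]; first by rewrite mul0r addr0.
    by rewrite -natr1 mulrDl mul1r addrA cst // ltr_wpDr // mulr_ge0 // ltW.
  have T (i : nat) : diffn h j d (x + i%:R * h) - diffn h j d x = i%:R * diffn h j.+1 d x.
    elim: i => [|i IHi]; first by rewrite mul0r addr0 subrr mul0r.
    have e1 : x + i.+1%:R * h = x + i%:R * h + h by rewrite -natr1 mulrDl mul1r addrA.
    rewrite e1 -[i.+1%:R]natr1 [RHS]mulrDl mul1r -IHi -(csti i) /=; ring.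
  have := T q; rewrite divff ?gt_eqF // pd // subrr => /esym/eqP.
  by rewrite mulf_eq0 pnatr_eq0 -leqn0 leqNgt q0 /= => /eqP.
have P (q k : nat) x : (0 < q)%N -> 0 < x -> d (x + k%:R / q%:R) = d x.
  move=> q0 x0; have qR : 0 < q%:R :> R by rewrite ltr0n.
  elim: k => [|k IH]; first by rewrite mul0r addr0.
  have := Z q m q0 (leqnn m) (x + k%:R / q%:R); rewrite subnn /= => /(_ _)/wrap[].
    by rewrite ltr_wpDr // divr_ge0 // ltW.
  by move/eqP; rewrite subr_eq0 IH -natr1 mulrDl mul1r addrA => /eqP.
move=> x y; wlog xy : x y / x <= y => [W x0 y0|].
  by have [/W|/ltW /W] := leP x y; [apply|move=> ->].
move=> x0 y0; apply/eqP; rewrite -subr_eq0; apply/eqP/nm_le0/ler_addgt0Pr => e e0.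
rewrite add0r; have [dl d0 D] := cont y y0 e e0.
pose q := (Num.bound dl^-1).+1.
have qR : 0 < q%:R :> R by rewrite ltr0n.
have qd : q%:R^-1 < dl.
  rewrite -[dl]invrK ltf_pV2 ?posrE ?invr_gt0 //.
  apply: lt_le_trans (archi_boundP _) _; first by rewrite invr_ge0 ltW.
  by rewrite ler_nat.
have w0 : 0 <= (y - x) * q%:R by rewrite mulr_ge0 ?subr_ge0 // ltW.
(* x + k/q is the last grid point not beyond y, at distance less than 1/q. *)
pose k := Num.trunc ((y - x) * q%:R).
have /andP[k1 k2] := Num.Theory.truncn_itv w0.
rewrite -(P q k x (ltn0Sn _) x0).
have -> : x + k%:R / q%:R = y + (x + k%:R / q%:R - y) by ring.
apply: D; rewrite -/k in k1 k2.
have a1 : k%:R / q%:R <= y - x by rewrite ler_pdivrMr.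
have a2 : y - x < k%:R / q%:R + q%:R^-1.
  have -> : k%:R / q%:R + q%:R^-1 = k.+1%:R / q%:R :> R by rewrite -natr1; ring.
  by rewrite ltr_pdivlMr.
by rewrite ltr_norml; apply/andP; split; lra.
Qed.

End Uniqueness.

(** * Differences of Lambda_n at infinity *)

Section SmallDifferences.
Context {R : realType}.
Implicit Types (f g : R -> R[i]).

Definition dsmall (h : R) (k : nat) f := forall e : R, 0 < e ->
  exists T : R, forall t, T <= t -> nm (diffn h k f t) <= e.

Lemma dsmallD h k f g : dsmall h k f -> dsmall h k g -> dsmall h k (fun t => f t + g t).
Proof.
move=> F G e e0; have e2 : 0 < e / 2 by rewrite divr_gt0.
have [T HT] := F _ e2; have [S HS] := G _ e2.
exists (Num.max T S) => t; rewrite ge_max => /andP[/HT h1 /HS h2].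
have -> : diffn h k (fun t => f t + g t) t = diffn h k f t + diffn h k g t.
  by elim: k t {T HT S HS h1 h2 F G} => //= k IH t; rewrite !IH opprD addrACA.
by apply: le_trans (nmD _ _) _; lra.
Qed.

Lemma dsmall_sum (I : Type) (s : seq I) h k (F : I -> R -> R[i]) :
  (forall i, dsmall h k (F i)) -> dsmall h k (fun t => \sum_(i <- s) F i t).
Proof.
move=> H; elim: s => [|i s IH].
  under eq_fun do rewrite big_nil.
  move=> e e0; exists 0 => t _.
  have -> : diffn h k (fun=> 0 : R[i]) t = 0 by elim: k t {H} => //= k IH t; rewrite !IH subrr.
  by rewrite nm0 ltW.
by under eq_fun do rewrite big_cons; exact: dsmallD (H i) IH.
Qed.

Lemma dsmall_ext h k f g (T0 : R) : 0 <= h -> (forall t, T0 <= t -> f t = g t) ->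
  dsmall h k f -> dsmall h k g.
Proof.
move=> h0 E F e /F[T HT]; exists (Num.max T T0) => t; rewrite ge_max => /andP[t1 t2].
have -> : diffn h k g t = diffn h k f t; last exact: HT.
by apply/esym/diffn_ext => // s ts; apply: E; apply: le_trans ts.
Qed.

Lemma dsmall_vanish h k f : 0 <= h ->
  (forall e : R, 0 < e -> exists T : R, forall t, T <= t -> nm (f t) <= e) -> dsmall h k f.
Proof.
move=> h0 F; elim: k => [//|k IH] e e0 /=.
have e2 : 0 < e / 2 by rewrite divr_gt0.
have [T HT] := IH _ e2; exists T => t Tt.
apply: le_trans (nmB _ _) _; have := HT t Tt; have := HT (t + h) ltac:(lra); lra.
Qed.

(** The recurrence of [zcoef] from an arbitrary exponent and starting pair: the polynomial
    coefficients of Lambda_n multiply the terms [zterm] by powers of u, which leads outside that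
    family. *)
Fixpoint gcoef (m : int) (p : R[i] * R[i]) (k : nat) : R[i] * R[i] :=
  if k is k'.+1 then
    let q := gcoef m p k' in ((m - k'%:Z)%:~R * q.1, (m - k'%:Z)%:~R * q.2 + q.1)
  else p.

Definition gterm (m : int) (p : R[i] * R[i]) (u : R[i]) : R[i] := u ^ m * (p.1 * clog u + p.2).

Lemma rderiv_gterm m p k (t : R) : 0 < t ->
  rderiv (fun t => gterm (m - k%:Z) (gcoef m p k) (t%:C + 1)) t
    (gterm (m - k.+1%:Z) (gcoef m p k.+1) (t%:C + 1)).
Proof.
move=> t0; set u : R[i] := t%:C + 1.
have su : slit u by rewrite /slit /u cReD /= ltr_wpDl // ltW.
have u0 := slit_neq0 su.
have D := cderivM (cderiv_expz (m - k%:Z) u0)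
  (cderivD (cderivZ (gcoef m p k).1 (cderiv_clog su)) (cderiv_cst (gcoef m p k).2 u)).
have P : rderiv (fun t : R => t%:C + 1 : R[i]) t 1.
  have := rderiv_shift 1 t; congr rderiv; apply/funext => s; exact: addrC.
have := rderiv_comp D P; congr rderiv.
rewrite /gterm /= mulr1 addr0 -/u.
have -> : m - k.+1%:Z = m - k%:Z - 1 by rewrite intS; ring.
rewrite expfzDr // -[u ^ -1]/(u^-1); set X := u ^ _; set M := _%:~R; field.
exact: u0.
Qed.

(** With s the square root of y = t + 1, log y <= 2 s bounds the term by a multiple of 1/s. *)
Lemma gterm_vanish m p : (m <= -1)%R -> forall e : R, 0 < e ->
  exists T : R, forall t, T <= t -> nm (gterm m p (t%:C + 1)) <= e.
Proof.
move=> m1 e e0; pose A := 2 * nm p.1 + nm p.2.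
have A0 : 0 <= A by rewrite /A addr_ge0 ?mulr_ge0 ?nm_ge0.
exists (Num.max 1 ((A / e) ^+ 2)) => t; rewrite ge_max => /andP[t1 t2].
set y := t + 1; have y1 : 1 <= y by rewrite /y; lra.
have y0 : 0 < y by lra.
have -> : t%:C + 1 = y%:C :> R[i] by rewrite /y rmorphD.
rewrite /gterm nmM nmZ nm_real gtr0_norm // clog_real //.
pose s := Num.sqrt y; have s2 : s ^+ 2 = y by rewrite sqr_sqrtr // ltW.
have s0 : 0 < s by rewrite sqrtr_gt0.
have s1 : 1 <= s by rewrite -(@ler_pXn2r _ 2) ?nnegrE ?(ltW s0) // s2 expr1n.
have ln0 : 0 <= ln y by rewrite ln_ge0.
have lns : ln y <= 2 * s.
  rewrite -s2 expr2 lnM ?posrE //.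
  have sE : 1 + (s - 1) = s by ring.
  have : ln s <= s by have := @le_ln1Dx R (s - 1); rewrite sE; lra.
  by lra.
have b1 : nm (p.1 * (ln y)%:C + p.2) <= A * s.
  apply: le_trans (nmD _ _) _; rewrite nmM nm_real ger0_norm // /A mulrDl.
  apply: lerD; last by rewrite ler_peMr ?nm_ge0.
  by have := ler_wpM2l (nm_ge0 p.1) lns; lra.
have b2 : y ^ m <= y^-1.
  rewrite -[y^-1]/(y ^ (-1)) ler_weXz2l //.
have b0 : 0 <= y ^ m by rewrite exprz_ge0 // ltW.
apply: le_trans (ler_pM b0 (nm_ge0 _) b2 b1) _.
have -> : y^-1 * (A * s) = A / s by rewrite -s2; field; rewrite gt_eqF.
rewrite ler_pdivrMr // mulrC -ler_pdivrMr //.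
rewrite -(@ler_pXn2r _ 2) ?nnegrE ?(ltW s0) // ?divr_ge0 ?(ltW e0) // s2 /y; lra.
Qed.

Lemma dsmall_gterm h (k : nat) m p : 0 < h -> (m < k%:Z)%R ->
  dsmall h k (fun t => gterm m p (t%:C + 1)).
Proof.
move=> h0 mk.
have := @diffn_chain_small R (fun k t => gterm (m - k%:Z) (gcoef m p k) (t%:C + 1)) h k h0
  (fun j t => @rderiv_gterm m p j t).
rewrite subr0; apply; apply: gterm_vanish; lia.
Qed.

Lemma gtermM (i : nat) m p (c u : R[i]) : u != 0 ->
  c * u ^+ i * gterm m p u = gterm (i%:Z + m) (c * p.1, c * p.2) u.
Proof. by move=> u0; rewrite /gterm /= expfzDr // -exprnP; ring. Qed.

Lemma horner_shift1 (q : {poly R[i]}) (n : nat) z : (size q <= n)%N ->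
  q.[z] = \sum_(i < n) (q \Po ('X - 1%:P))`_i * (z + 1) ^+ i.
Proof.
move=> sq; rewrite -horner_coef_wide; last first.
  case: n sq => [|n] sq.
    by move: sq; rewrite leqn0 size_poly_eq0 => /eqP ->; rewrite comp_poly0 size_poly0.
  apply: leq_trans (size_comp_poly_leq _ _) _; rewrite size_XsubC muln1.
  by case: (size q) sq.
by rewrite horner_comp hornerD hornerN hornerX hornerC addrK.
Qed.

Lemma dsmall_poly_gterm h n (q : {poly R[i]}) (s : nat) m p : 0 < h -> (size q <= s)%N ->
  (m + s%:Z <= n.+1%:Z)%R -> dsmall h n.+1 (fun t => q.[t%:C] * gterm m p (t%:C + 1)).
Proof.
move=> h0 sq ms.
apply: (@dsmall_ext h n.+1 (fun t => \sum_(i < s) gterm (i%:Z + m)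
   ((q \Po ('X - 1%:P))`_i * p.1, (q \Po ('X - 1%:P))`_i * p.2) (t%:C + 1)) _ 0 (ltW h0)).
  move=> t t0; rewrite (horner_shift1 _ sq) mulr_suml; apply: eq_bigr => i _.
  rewrite -gtermM // slit_neq0 // /slit cReD /= ltr_wpDl //.
apply: dsmall_sum => i; apply: dsmall_gterm => //.
by have := ltn_ord i; lia.
Qed.

(** G_(n,j) has degree at most n - 1 - j, so its products with the terms of Z_j are u^m (p log u +
    q) with m <= n, whose differences of order n + 1 tend to 0. The product with [zrem] is
    O(t^(n-N)), which itself tends to 0. *)
Lemma Lam_dsmall N n h : (0 < n)%N -> (n < N)%N -> 0 < h ->
  dsmall h n.+1 (fun t => Lam N n t%:C).
Proof.
move=> n0 nN h0; apply: dsmall_sum => j.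
have jn := ltn_ord j; have jN : (j.+1 < N)%N by apply: leq_ltn_trans nN.
have Nn : ((N - j).-1 = (n - j).-1 + (N - n).-1.+1)%N by lia.
have sG := @size_Gpoly R n j n0.
apply: (@dsmall_ext h n.+1 (fun t => (\sum_(r < N.+1) bcoef r * ((Gpoly n j).[t%:C] * zterm (@clog R) j r (t%:C + 1))
   + (Gpoly n j).[t%:C] * gterm 0 (0, - zfun N j 1) (t%:C + 1))
   + (Gpoly n j).[t%:C] * zrem N j (t%:C + 1)) _ 0 (ltW h0)).
  move=> t t0; rewrite /zfun /zmain -GpolyE /gterm /= expr0z mul1r mul0r add0r.
  under eq_bigr do rewrite mulrCA.
  by rewrite -mulr_sumr /=; ring.
apply: dsmallD; first apply: dsmallD.
- apply: dsmall_sum => r.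
  have : dsmall h n.+1 (fun t => (bcoef r *: Gpoly n j).[t%:C] * gterm (j.+1%:Z - r%:Z) (zcoef j r) (t%:C + 1)).
    apply: (@dsmall_poly_gterm _ _ _ (n - j)) => //; last by lia.
    exact: leq_trans (size_scale_leq _ _) sG.
  by congr (dsmall _ _ _); apply/funext => t; rewrite hornerZ -mulrA.
- by apply: (@dsmall_poly_gterm _ _ _ (n - j)) => //; lia.
- apply: dsmall_vanish; first exact: ltW.
  have [C C0 HC] := @horner_bound R (Gpoly n j) (n - j).-1 ltac:(apply: leq_trans sG _; lia).
  have [K K0 HK] := zrem_sector jN (ltr01 : 0 < (1 : R)).
  move=> e e0; exists (Num.max 1 (C * K / e)) => t; rewrite ge_max => /andP[t1 t2].
  have tn : nm t%:C = t by rewrite nm_real ger0_norm //; lra.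
  have t0 : 0 < t by lra.
  have st : slit (t%:C + 1 : R[i]) by rewrite /slit cReD /= ltr_wpDl // ltW.
  have b1 := HC t%:C; rewrite tn in b1.
  have b2 := HK (t%:C + 1) t st t1.
  rewrite nmM; apply: le_trans (ler_pM (nm_ge0 _) (nm_ge0 _) (b1 t1) (b2 _)) _.
    move=> s s0; rewrite mul1r -(rmorph1 (real_complex R)) -!rmorphD nm_real ger0_norm; lra.
  have p0 : 0 < t ^+ (N - j).-1 by rewrite exprn_gt0.
  rewrite mulrA ler_pdivrMr // mulrAC.
  rewrite Nn exprD mulrA; apply: le_trans (_ : _ <= e * t * t ^+ (n - j).-1) _.
    rewrite ler_wpM2r ?exprn_ge0 ?(ltW t0) //.
    by move: t2; rewrite ler_pdivrMr // (mulrC t).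
  rewrite mulrAC ler_wpM2l ?mulr_ge0 ?exprn_ge0 ?(ltW e0) ?(ltW t0) //.
  by rewrite exprS ler_peMr ?(ltW t0) // exprn_ege1.
Qed.

End SmallDifferences.

(** * Agreement of log G_n with Lambda_n *)

Section RealIdentification.
Context {R : realType}.
Variable G : nat -> R[i] -> R[i].
Hypothesis HG : multiple_gamma G.

Definition lgam (n : nat) (x : R) : R := ln (Re (G n (x%:C + 1))).

Lemma gamma_pos n x : 0 <= x -> holomorphic_at (G n) (x%:C + 1) /\ 0 < G n (x%:C + 1).
Proof.
move=> x0; case: HG => _ H0 HS; case: n => [|n]; last first.
  by have [_ _ /(_ x x0)[]] := HS n.
split.
  have -> : G 0%N = id by apply/funext => z; exact: H0.
  by apply/nbhs_ballP; exists 1 => [|w _] /=; [exact: ltr01|exact: derivable_id].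
by rewrite H0 -(rmorph1 (real_complex R)) -rmorphD ltcR ltr_wpDl.
Qed.

Lemma gamma_real n x : 0 <= x -> exists2 r : R, 0 < r & G n (x%:C + 1) = r%:C.
Proof.
move=> x0; have [_ P] := gamma_pos n x0.
have E : G n (x%:C + 1) = (Re (G n (x%:C + 1)))%:C by rewrite RRe_real // gtr0_real.
by exists (Re (G n (x%:C + 1))); rewrite -?E // -ltcR -E.
Qed.

Lemma lgam0 x : lgam 0 x = ln (x + 1).
Proof. by case: HG => _ H0 _; rewrite /lgam H0 cReD. Qed.

Lemma lgamS n x : 0 <= x -> lgam n.+1 (x + 1) = lgam n.+1 x + lgam n x.
Proof.
move=> x0; have [_ _ /(_ n)[E _ _]] := HG.
have x1 : 0 <= x + 1 by rewrite addr_ge0.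
have e1 : (x + 1)%:C = x%:C + 1 by rewrite rmorphD.
have [h1 _] := gamma_pos n x0; have [h2 _] := gamma_pos n.+1 x0.
have [h3 _] := gamma_pos n.+1 x1; rewrite e1 in h3.
have [r r0 rE] := gamma_real n x0; have [s s0 sE] := gamma_real n.+1 x0.
have rs := E _ h1 h2 h3; rewrite rE sE in rs.
by rewrite /lgam e1 rs rE sE -rmorphM /= lnM ?posrE // addrC.
Qed.

Lemma lgam_at0 n : lgam n 0 = 0.
Proof.
have [_ H0 HS] := HG; rewrite /lgam add0r.
case: n => [|n]; first by rewrite H0 ln1.
by have [_ [_ ->] _] := HS n; rewrite ln1.
Qed.

Lemma holomorphic_sq f (z : R[i]) : holomorphic_at f z ->
  exists2 r : R, 0 < r & holo_on (sq z r) f.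
Proof.
move=> /nbhs_ballP[e /= e0 H].
have er : e = (Re e)%:C by rewrite RRe_real // gtr0_real.
have e0' : 0 < Re e by rewrite -ltcR -er.
exists (Re e / 2); first by rewrite divr_gt0.
move=> w /andP[w1 w2]; eexists; apply: derivable_cderiv; apply: H.
rewrite -ball_normE /= distrC nmE er ltcR.
by apply: le_lt_trans (nm_le_ReIm _) _; lra.
Qed.

(** Positivity at x keeps G_n in the right half-plane nearby, where the principal logarithm applies;
    [lgam] thus has real derivatives of all orders on the open half-line. *)
Lemma lgam_local n x : 0 < x -> exists2 r : R, 0 < r & exists g : R[i] -> R[i],
  holo_on (sq x%:C r) g /\ forall y, `|y - x| < r -> lgam n y = Re (g y%:C).
Proof.
move=> x0; have [h P] := gamma_pos n (ltW x0).
have [r r0 H] := holomorphic_sq h.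
have H1 z : sq x%:C r z -> exists l, cderiv (fun w => G n (w + 1)) z l.
  move=> zr; have zr1 : sq (x%:C + 1) r (z + 1) by move: zr; rewrite /sq opprD addrACA subrr addr0.
  have [l lP] := H _ zr1; exists (l * (1 + 0)).
  exact: (cderiv_comp (g := fun w => w + 1) (cderivD (cderiv_id z) (cderiv_cst 1 z)) lP).
have [s s0 sE] := gamma_real n (ltW x0).
have [l lP] := H1 _ (sq_center x%:C r0).
have s2 : 0 < s / 2 by rewrite divr_gt0.
have [d d0 D] := cderiv_ccont lP s2.
(* r is for holomorphy, x keeps the real points of the square nonnegative, and d/2 keeps G_n within
   s/2 of its positive value s. *)
pose r' := Num.min (Num.min r x) (d / 2).
have r'0 : 0 < r' by rewrite !lt_min r0 x0 divr_gt0.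
have [a1 a2 a3] : [/\ r' <= r, r' <= x & r' <= d / 2].
  by rewrite /r' !ge_min !lexx !orbT.
have S z : sq x%:C r' z -> slit (G n (z + 1)).
  move=> /andP[z1 z2]; apply/orP; left.
  have zd : nm (z - x%:C) < d by apply: le_lt_trans (nm_le_ReIm _) _; lra.
  have := D _ zd; rewrite (_ : x%:C + (z - x%:C) = z) ?sE => [h1|]; last by ring.
  have := Re_nm (G n (z + 1) - s%:C); rewrite cReD cReN /= ler_norml => /andP[? _].
  by lra.
exists r' => //; exists (fun z => clog (G n (z + 1))); split.
  move=> z zr; have [m mP] := H1 z (sqW a1 zr).
  by eexists; apply: cderiv_comp mP (cderiv_clog (S z zr)).
move=> y; rewrite ltr_norml => /andP[y1 y2]; have y0 : 0 <= y by lra.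
have [u u0 uE] := gamma_real n y0.
by rewrite /lgam uE clog_real.
Qed.

Lemma lgam_derive n k (x : R) : 0 < x ->
  is_derive x 1 (derive1n k (lgam n)) (derive1n k.+1 (lgam n) x).
Proof.
move=> x0; have [r r0 [g [gh gE]]] := lgam_local n x0.
have xx : `|x - x| < r by rewrite subrr normr0.
have [h _] := real_restriction k gh gE xx.
by have [_ ->] := real_restriction k.+1 gh gE xx.
Qed.

Lemma lgam_diff_ge0 n h t : 0 < h -> 0 < t -> 0 <= diffn h n.+2 (lgam n.+1) t.
Proof.
move=> h0; have P s : 0 < s -> 0 <= derive1n n.+2 (lgam n.+1) s.
  by move=> s0; have [_ _ /(_ n)[_ _ /(_ s (ltW s0))[]]] := HG.
exact: (diffn_chain_ge0 (psi := fun j => derive1n j (lgam n.+1)) h0 (@lgam_derive n.+1) P).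
Qed.

Lemma slit_real (t : R) : 0 <= t -> slit (t%:C + 1 : R[i]).
Proof. by move=> t0; rewrite /slit cReD /= ltr_wpDl. Qed.

(** Constancy is shown on t > 0, where [lgam] is known to be differentiable; periodicity carries the
    normalisation at 0 to the point 1 and fixes the constant. *)
Lemma lgam_Lam_periodic N m : (m.+1 < N)%N ->
  (forall t, 0 <= t -> (lgam m.+1 (t + 1))%:C - Lam N m.+1 (t + 1)%:C =
    (lgam m.+1 t)%:C - Lam N m.+1 t%:C) ->
  forall x, 0 <= x -> (lgam m.+1 x)%:C = Lam N m.+1 x%:C.
Proof.
move=> mN per x; rewrite le_eqVlt => /predU1P[<-|x0]; first by rewrite lgam_at0 Lam0.
pose d t := (lgam m.+1 t)%:C - Lam N m.+1 t%:C.
have d1 : d 1 = 0.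
  by have := per 0 (lexx 0); rewrite add0r -/(d 1) => ->; rewrite lgam_at0 Lam0 subrr.
have cont t : 0 < t -> rcont d t.
  move=> t0; have [l lP] := cderiv_Lam mN (slit_real (ltW t0)).
  have h1 := rderiv_comp lP (rderiv_real t).
  have h2 : rderiv (fun t => (lgam m.+1 t)%:C) t (derive1n 1 (lgam m.+1) t)%:C.
    by apply: rderiv_ReIm => /=; [exact: (lgam_derive m.+1 0 t0)|exact: is_derive_cst].
  exact: rderiv_rcont (rderivB h2 h1).
have small (q : nat) y e : (0 < q)%N -> 0 < y -> 0 < e ->
    exists K0 : nat, forall K : nat, (K0 <= K)%N ->
    nm (diffn q%:R^-1 m.+2 d (y + K%:R / q%:R)) <= e.
  move=> q0 y0 e0; have e2 : 0 < e / 2 by rewrite divr_gt0.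
  have qR : 0 < q%:R :> R by rewrite ltr0n.
  have h0 : 0 < q%:R^-1 :> R by rewrite invr_gt0.
  have [T HT] := Lam_dsmall (ltn0Sn m) mN h0 e2.
  have [K1 HK1] := convex_diff_small q0 (fun x _ => lgam0 x)
    (fun n x x0 => lgamS n (ltW x0)) lgam_diff_ge0 m.+1 y0 e2.
  have P0 : 0 <= `|T| * q%:R by rewrite mulr_ge0 // ltW.
  exists (maxn K1 (Num.bound (`|T| * q%:R))) => K; rewrite geq_max => /andP[/HK1 k1 k2].
  have TK : T <= y + K%:R / q%:R.
    have h : `|T| <= K%:R / q%:R.
      by rewrite ler_pdivlMr //; apply: le_trans (ltW (archi_boundP P0)) _; rewrite ler_nat.
    by have := ler_norm T; lra.
  have k3 := HT _ TK.
  rewrite diffnB diffn_real; apply: le_trans (nmB _ _) _; rewrite nm_real.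
  by apply: le_trans (lerD k1 k3) _; lra.
have : d x = d 1 := periodic_const (m := m.+1) (fun t t0 => per t (ltW t0)) cont small x0 ltr01.
by rewrite d1 => /eqP; rewrite subr_eq0 => /eqP.
Qed.

Lemma lgam_Lam N m x : (m.+1 < N)%N -> 0 <= x -> (lgam m.+1 x)%:C = Lam N m.+1 x%:C.
Proof.
have eC (a b : R) : (a + b)%:C = a%:C + b%:C :> R[i] by rewrite rmorphD.
elim: m x => [|m IH] x mN; apply: (lgam_Lam_periodic mN) => t t0.
- have E : (ln (t + 1))%:C = clog (t%:C + 1).
    by rewrite -(rmorph1 (real_complex R)) -rmorphD clog_real // ltr_wpDl.
  rewrite (lgamS 0 t0) lgam0 !eC (Lam_rec1 mN (slit_real t0)) E.
  by rewrite opprD addrACA subrr addr0.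
- rewrite (lgamS m.+1 t0) !eC (Lam_rec (ltn0Sn m) mN (slit_real t0)).
  by rewrite (IH t (ltnW mN) t0) opprD addrACA subrr addr0.
Qed.

Variables (n : nat) (L : R[i] -> R[i]).
Hypotheses (n0 : (0 < n)%N) (HL : log_shift_branch (G n) L).

Lemma lgam_LamE N x : (n < N)%N -> 0 <= x -> (lgam n x)%:C = Lam N n x%:C.
Proof. by case: n n0 => // m _; apply: lgam_Lam. Qed.

Lemma branch_cderiv z : slit (z + 1) -> exists l, cderiv L z l.
Proof.
move=> sz; have [D _ _] := HL; eexists; apply: derivable_cderiv; apply: D.
rewrite inE /slit_plane /= => -[h1 h2]; move: sz.
by rewrite /slit cReD cImD /= addr0 h1 eqxx orbF; lra.
Qed.

(** G_n being positive, sin(Im L) = 0 on the half-line; Im L is continuous and 0 at 0, hence cannot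
    leave 0. *)
Lemma branch_real x : 0 <= x -> L x%:C = (lgam n x)%:C.
Proof.
move=> x0; have [D E L0] := HL; have sl := slit_real.
have ex t : 0 <= t -> cexp (L t%:C) = G n (t%:C + 1).
  move=> t0; apply: E; rewrite inE /slit_plane /= => -[_ h]; lra.
have trig t : 0 <= t -> sin (Im (L t%:C)) = 0 /\ lgam n t = Re (L t%:C).
  move=> t0; have [r r0 rE] := gamma_real n t0.
  have e1 := ex t t0; rewrite rE in e1; split.
    have /(congr1 (@complex.Im R)) := e1; rewrite /cexp cImM /= mul0r addr0.
    by move/eqP; rewrite mulf_eq0 gt_eqF ?expR_gt0 //= => /eqP.
  rewrite /lgam rE /= -[RHS]expRK -nm_cexp e1 nm_real gtr0_norm //.
have I0 t : 0 <= t -> Im (L t%:C) = 0.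
  move=> t0; apply/eqP/negPn/negP => I0.
  pose y s := `|Im (L s%:C)|.
  have ydef (s : R) : 0 <= s -> {for s, continuous (fun s : R => Im (L s%:C))}.
    move=> s0; have [l lP] := branch_cderiv (sl s s0).
    exact: is_derive_cont (rderiv_Im (rderiv_comp lP (rderiv_real s))).
  have yc : {within `[0, t], continuous y}.
    apply: continuous_in_subspaceT => s; rewrite inE /= in_itv /= => /andP[s0 _].
    by apply: continuous_comp (ydef s s0) _; apply: norm_continuous.
  have y0 : y 0 = 0 by rewrite /y L0 normr0.
  have yt : 0 < y t by rewrite normr_gt0.
  (* A value in ]0, 1], which |Im L| would have to take; but sin w > 0 because w < pi. *)
  pose w := Num.min (y t) 1.
  have w0 : 0 < w by rewrite lt_min yt ltr01.
  have [w1 w2] : w <= y t /\ w <= 1 by rewrite /w !ge_min !lexx orbT.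
  have [|c] := IVT t0 yc (v := w).
    by rewrite y0 minEle maxEle (ltW yt) (ltW w0).
  rewrite in_itv /= => /andP[c0 _] yw.
  have [s0 _] := trig c c0.
  have : sin w = 0.
    by rewrite -yw /y; case: (ger0P (Im (L c%:C))) => _; rewrite ?sinN s0 ?oppr0.
  have := @sin_gt0_pi R w; rewrite w0 /= => /(_ _)/wrap[]; last by move=> + h; rewrite h ltxx.
  by have := pi_ge2 R; lra.
have [_ ->] := trig x x0.
by apply/eqP; rewrite eq_complex /= I0 // !eqxx.
Qed.

(* Squares used for the continuation: one around a large positive real gives the
   half-plane Re z > -1, and those around +-iT the rest of the slit plane. *)
Lemma branch_Lam N z : (n < N)%N -> slit (z + 1) -> L z = Lam N n z.
Proof.
move=> nN sz; pose f w := L w - Lam N n w.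
have hf w : slit (w + 1) -> exists l, cderiv f w l.
  move=> sw; have [l lP] := branch_cderiv sw; have [m mP] := cderiv_Lam nN sw.
  by eexists; apply: cderivB lP mP.
have fr x : 0 <= x -> f x%:C = 0.
  by move=> x0; rewrite /f branch_real // (lgam_LamE nN x0) subrr.
suff : f z = 0 by move/eqP; rewrite subr_eq0 => /eqP.
have right w : -1 < Re w -> f w = 0.
  (* T is large enough for |w|^2 < 2T (Re w + 1), which implies |w - T| < T + 1. *)
  move=> w1; pose T : R := `|Re w| + nm w ^+ 2 / (Re w + 1) + 1.
  have p0 : 0 <= nm w ^+ 2 / (Re w + 1) by rewrite divr_ge0 ?exprn_ge0 ?nm_ge0 //; lra.
  have T0 : 0 < T by rewrite /T; have := normr_ge0 (Re w); lra.
  have hs : holo_on (sq T%:C (T + 1)) f.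
    move=> v /andP[]; rewrite cReD cReN /= ltr_norml => /andP[v1 _] _; apply: hf.
    by rewrite /slit cReD /=; apply/orP; left; lra.
  have Z (t : R) : 0 < t < 1 -> f (T%:C + t%:C) = 0.
    by move=> /andP[t0 _]; rewrite -rmorphD fr //; lra.
  have := identity_sq ltr01 hs Z (h := w - T%:C).
  rewrite (_ : T%:C + (w - T%:C) = w); [apply|by ring].
  rewrite -(@ltr_pXn2r _ 2) ?nnegrE ?nm_ge0 //; last by lra.
  rewrite sqr_nm cReD cReN cImD cImN /= subr0.
  have e1 : (Re w - T) ^+ 2 + Im w ^+ 2 = nm w ^+ 2 - 2 * T * Re w + T ^+ 2.
    by rewrite sqr_nm; ring.
  rewrite e1.
  have e2 : nm w ^+ 2 < 2 * T * (Re w + 1).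
    have -> : nm w ^+ 2 = nm w ^+ 2 / (Re w + 1) * (Re w + 1) by field; lra.
    rewrite ltr_pM2r; last by lra.
    by rewrite /T; have := normr_ge0 (Re w); lra.
  by rewrite !expr2 in e2 *; lra.
have [|zr] := ltP (-1) (Re z); first exact: right.
have zi : Im z != 0.
  by move: sz; rewrite /slit cReD cImD /= addr0 => /orP[|//]; lra.
pose sg : R := Num.sg (Im z).
(* T is large enough for |z|^2 < 2T |Im z|, that is |z - c| < T for the centre c at height T on the
   side of z. *)
pose T : R := nm z ^+ 2 / `|Im z| + 1.
have i0 : 0 < `|Im z| by rewrite normr_gt0.
have p0 : 0 <= nm z ^+ 2 / `|Im z| by rewrite divr_ge0 ?exprn_ge0 ?nm_ge0.
have T0 : 0 < T by rewrite /T; lra.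
have sg2 : sg * sg = 1.
  by rewrite /sg -expr2 sqr_sg zi.
have sgn : `|sg| = 1 by rewrite /sg normr_sg zi.
pose c : R[i] := 0 +i* (sg * T).
have hs : holo_on (sq c T) f.
  move=> v /andP[_]; rewrite cImD cImN /= => v2; apply: hf; apply/orP; right.
  rewrite cImD /= addr0; apply: contraTneq v2 => ->.
  by rewrite sub0r normrN normrM sgn mul1r gtr0_norm // ltxx.
have Z (t : R) : 0 < t < 1 -> f (c + t%:C) = 0.
  by move=> /andP[t0 _]; apply: right; rewrite cReD /=; lra.
have := identity_sq ltr01 hs Z (h := z - c).
rewrite (_ : c + (z - c) = z); [apply|by ring].
rewrite -(@ltr_pXn2r _ 2) ?nnegrE ?nm_ge0 ?(ltW T0) //.
rewrite sqr_nm cReD cReN cImD cImN /= subr0.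
have e1 : Re z ^+ 2 + (Im z - sg * T) ^+ 2 = nm z ^+ 2 - 2 * T * (sg * Im z) + sg * sg * T ^+ 2.
  by rewrite sqr_nm; ring.
have e3 : sg * Im z = `|Im z| by rewrite /sg normrEsg.
rewrite e1 sg2 mul1r e3.
have e2 : nm z ^+ 2 < T * `|Im z|.
  have -> : nm z ^+ 2 = nm z ^+ 2 / `|Im z| * `|Im z| by field; rewrite gt_eqF.
  by rewrite ltr_pM2r // /T; lra.
have := mulr_gt0 T0 i0; lra.
Qed.

End RealIdentification.

(** * The asymptotic expansion *)

Section SectorGeometry.
Context {R : realType}.
Implicit Types z : R[i].

Lemma sector_cos (delta : R) z : 0 < delta < pi -> sector delta z ->
  - (cos delta * nm z) <= Re z.
Proof.
move=> /andP[d0 dpi] [z0 hz]; have nz : 0 < nm z by rewrite nm_gt0.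
have -> : Re z = cos (carg z) * nm z by rewrite cos_carg // divfK // gt_eqF.
have e : - cos delta = cos (pi - delta) by rewrite cosB cospi sinpi mul0r addr0 mulN1r.
rewrite -mulNr ler_pM2r // e -(cos_norm (carg z)).
have t0 := normr_ge0 (carg z); rewrite leNgt ltr_cos ?in_itv /=.
- by rewrite -leNgt ltW.
- by apply/andP; split; lra.
- by apply/andP; split; lra.
Qed.

(** With c = cos delta and x = |z|, |z + s|^2 >= x^2 - 2csx + s^2 = (1-c)/2 (x+s)^2 + (1+c)/2
    (x-s)^2. The constant (1-c)/2 lies in ]0, 1], so its square is at most itself. *)
Lemma sector_nm (delta : R) : 0 < delta < pi -> exists2 kap : R, 0 < kap &
  forall z, sector delta z -> forall s : R, 0 <= s -> kap * (nm z + s) <= nm (z + s%:C).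
Proof.
move=> hd; have c1 : cos delta < 1.
  have /andP[d0 dpi] := hd; rewrite -cos0 ltr_cos ?in_itv //= ?lexx ?pi_ge0 //; lra.
have cm1 := cos_geN1 delta.
exists ((1 - cos delta) / 2) => [|z hz s s0]; first by lra.
have h := sector_cos hd hz; have n0 := nm_ge0 z.
rewrite -(@ler_pXn2r _ 2) ?nnegrE ?nm_ge0 //; last by rewrite mulr_ge0 ?addr_ge0 //; lra.
rewrite sqr_nm cReD cImD /= addr0.
have e : (Re z + s) ^+ 2 + Im z ^+ 2 = nm z ^+ 2 + 2 * s * Re z + s ^+ 2.
  by rewrite sqr_nm; ring.
rewrite e exprMn; set c := cos delta in c1 cm1 h *; set x := nm z in n0 h *.
apply: (@le_trans _ _ ((1 - c) / 2 * (x + s) ^+ 2)).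
  rewrite ler_wpM2r ?exprn_ge0 ?addr_ge0 // expr2 -[leRHS]mulr1 ler_wpM2l //; lra.
apply: (@le_trans _ _ (x ^+ 2 + 2 * s * (- (c * x)) + s ^+ 2)); last first.
  by rewrite lerD2r lerD2l ler_wpM2l //; lra.
have -> : x ^+ 2 + 2 * s * (- (c * x)) + s ^+ 2
   = (1 - c) / 2 * (x + s) ^+ 2 + (1 + c) / 2 * (x - s) ^+ 2 by field.
by rewrite lerDl mulr_ge0 ?sqr_ge0 //; lra.
Qed.

Lemma sector_slit (delta : R) z : 0 < delta < pi -> sector delta z -> slit (z + 1).
Proof.
move=> hd hz; have [kap k0 H] := sector_nm hd.
have nz : 0 < nm z by rewrite nm_gt0; exact: hz.1.
rewrite /slit cReD cImD /= addr0; have [i0|] := eqVneq (Im z) 0; last by rewrite orbT.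
have [r0|r0] := leP 0 (Re z); first by apply/orP; left; lra.
have := H z hz (nm z) (ltW nz).
have -> : z + (nm z)%:C = 0.
  have -> : nm z = - Re z by rewrite nm_sqrt i0 expr0n addr0 sqrtr_sqr ltr0_norm.
  by apply/eqP; rewrite eq_complex cReD cImD /= i0 addr0 subrr !eqxx.
rewrite nm0 => h; have : 0 < kap * (nm z + nm z) by rewrite mulr_gt0 // addr_gt0.
by move=> /lt_le_trans /(_ h); rewrite ltxx.
Qed.

End SectorGeometry.

(** * The coefficient of the logarithm *)

Section LogCoefficient.
Context {R : realType}.
Implicit Types (z u : R[i]) (p : {poly R[i]}).

Definition bernoulli_op (N : nat) p : {poly R[i]} := \sum_(r < N.+1) bcoef r *: p^`(r).

(* The Euler-Maclaurin formula has no remainder for polynomials. *)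
Lemma bernoulli_opS N p u : (0 < N)%N -> (size p <= N.+1)%N ->
  (bernoulli_op N p).[u + 1] = (bernoulli_op N p).[u] + p^`().[u].
Proof.
move=> N0 sp; pose phi k (t : R) := p^`(k).[u + t%:C].
have Hr k (t : R) : (k <= N)%N -> 0 <= t <= 1 -> rderiv (phi k) t (phi k.+1 t).
  move=> _ _; rewrite -[phi k.+1 t]mulr1.
  have D := cderiv_horner p^`(k) (u + t%:C); rewrite -derivnS in D.
  exact: rderiv_comp D (rderiv_shift u t).
have H0 (t : R) : 0 <= t <= 1 -> nm (phi N.+1 t) <= 0.
  by move=> _; rewrite /phi derivn_poly0 // horner0 nm0.
have := @euler_maclaurin R (@bcoef R) N N0 (@bernoulli_rec R) phi 0 Hr H0.
rewrite mulr0 => /nm_le0; rewrite /phi /= rmorph0 addr0 => E.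
have O v : (bernoulli_op N p).[v] = \sum_(r < N.+1) bcoef r * p^`(r).[v].
  by rewrite horner_sum; apply: eq_bigr => r _; rewrite hornerZ.
by rewrite !O; move: E; rewrite rmorph1 => /eqP; rewrite subr_eq0 subr_eq (addrC p^`().[u]) => /eqP.
Qed.

(** The Bernoulli polynomial B_(j+1)(u), divided by j + 1. *)
Definition bpoly (j : nat) : {poly R[i]} :=
  bernoulli_op j.+1 (j.+1%:R^-1 *: 'X^(j.+1)).

Lemma bpolyS j u : (bpoly j).[u + 1] = (bpoly j).[u] + u ^+ j.
Proof.
rewrite bernoulli_opS //; last by apply: leq_trans (size_scale_leq _ _) _; rewrite size_polyXn.
rewrite derivZ derivXn hornerZ hornerMn hornerXn /= -[u ^+ j *+ _]mulr_natl mulKf //.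
Qed.

Lemma zcoef_ffact j r : (@zcoef R j r).1 = j.+1%:R^-1 * (j.+1 ^_ r)%:R.
Proof.
elim: r => [|r IH]; first by rewrite ffactn0 mulr1.
rewrite /= IH ffactnSr natrM mulrCA; congr (_ * _); rewrite mulrC.
have [rj|jr] := leqP r j.+1; last by rewrite ffact_small // !mul0r.
by rewrite subzn // -pmulrn.
Qed.

(** The right-hand side is the coefficient of log a in [zmain N j a]; it is polynomial since the
    terms of order above j + 1 carry no logarithm. *)
Lemma bpoly_zcoef N j a : (j < N)%N -> a != 0 ->
  (bpoly j).[a] = \sum_(r < N.+1) bcoef r * (a ^ (j.+1%:Z - r%:Z) * (zcoef j r).1).
Proof.
move=> jN a0; rewrite /bpoly /bernoulli_op horner_sum.
rewrite -(big_mkord xpredT (fun r => (bcoef r *: (j.+1%:R^-1 *: 'X^(j.+1))^`(r)).[a])).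
rewrite -(big_mkord xpredT (fun r => bcoef r * (a ^ (j.+1%:Z - r%:Z) * (zcoef j r).1))).
rewrite [RHS](big_cat_nat _ (n := j.+2)) //=.
rewrite [X in _ = _ + X]big_nat [X in _ = _ + X]big1 ?addr0; last first.
  by move=> r /andP[r1 _]; rewrite zcoef_high // !mulr0.
rewrite !big_nat; apply: eq_bigr => r /andP[_ rj].
rewrite hornerZ derivnZ hornerZ derivnXn hornerMn hornerXn zcoef_ffact.
rewrite subzn // -exprnP -mulr_natr; ring.
Qed.

Lemma bpoly0 j : (bpoly j).[0] = bcoef j.+1 * j`!%:R.
Proof.
rewrite /bpoly /bernoulli_op horner_sum.
have E r : (bcoef r *: (j.+1%:R^-1 *: 'X^(j.+1))^`(r)).[0]
    = bcoef r * (j.+1%:R^-1 * (0 ^+ (j.+1 - r) *+ (j.+1 ^_ r))).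
  by rewrite hornerZ derivnZ hornerZ derivnXn hornerMn hornerXn.
rewrite -(big_mkord xpredT (fun r => (bcoef r *: (j.+1%:R^-1 *: 'X^(j.+1))^`(r)).[0])).
rewrite big_nat_recr // big_nat big1 => [|r /andP[_ rj]]; last first.
  by rewrite E expr0n subn_eq0 leqNgt rj mul0rn !mulr0.
by rewrite /= add0r E subnn expr0 ffactnn factS natrM mulKf // pnatr_eq0.
Qed.

(** The coefficient of log(z + 1) that comes out of the main terms of the Z_j; [logcoefR] is, by
    [logcoefR_E], the one displayed in the expansion. *)
Definition logcoefL n z := \sum_(j < n) Gcoef n j z * (bpoly j).[z + 1].
Definition logcoefR n z :=
  (binom_poly R n).[z + 1] + \sum_(j < n) bcoef j.+1 * j`!%:R * Gcoef n j z.

Lemma logcoefL_S n z : (0 < n)%N ->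
  logcoefL n.+1 (z + 1) = logcoefL n.+1 z + logcoefL n z.
Proof.
move=> n0; rewrite /logcoefL.
have -> : \sum_(j < n.+1) Gcoef n.+1 j (z + 1) * (bpoly j).[z + 1 + 1]
  = \sum_(j < n.+1) Gcoef n.+1 j (z + 1) * (bpoly j).[z + 1].
  have E : \sum_(j < n.+1) Gcoef n.+1 j (z + 1) * (z + 1) ^+ j = 0.
    by rewrite sum_Gcoef // subrr binom_poly0; case: n n0.
  by rewrite -[RHS]addr0 -[X in _ = _ + X]E -big_split /=; apply: eq_bigr => j _; rewrite bpolyS mulrDr.
have -> : \sum_(j < n) Gcoef n j z * (bpoly j).[z + 1]
  = \sum_(j < n.+1) Gcoef n j z * (bpoly j).[z + 1].
  by rewrite big_ord_recr /= Gcoef_high // mul0r addr0.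
rewrite -big_split /=.
by apply: eq_bigr => j _; rewrite GcoefS // mulrDl.
Qed.

Lemma logcoefR_S n z : (0 < n)%N ->
  logcoefR n.+1 (z + 1) = logcoefR n.+1 z + logcoefR n z.
Proof.
move=> n0; rewrite /logcoefR binom_pascal.
rewrite [X in _ = _ + (_ + X)](_ : _ = \sum_(j < n.+1) bcoef j.+1 * j`!%:R * Gcoef n j z).
  rewrite addrACA -big_split /=; congr (_ + _).
  by apply: eq_bigr => j _; rewrite GcoefS // mulrDr.
by rewrite big_ord_recr /= Gcoef_high // mulr0 addr0.
Qed.

Lemma logcoef_m1 n : (0 < n)%N -> logcoefL n (-1) = logcoefR n (-1).
Proof.
move=> n0; rewrite /logcoefL /logcoefR addNr binom_poly0 eqn0Ngt n0 add0r.
by apply: eq_bigr => j _; rewrite bpoly0 mulrC.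
Qed.

Lemma logcoef1_S z : logcoefL 1 (z + 1) = logcoefL 1 z + 1 /\
  logcoefR 1 (z + 1) = logcoefR 1 z + 1.
Proof.
have G1 w : Gcoef 1 0 w = 1.
  have := sum_Gcoef w 0 (ltn0Sn 0).
  by rewrite big_ord1 expr0 mulr1 => ->; rewrite binom_polyE big_ord0 fact0 invr1 mulr1.
rewrite /logcoefL /logcoefR !big_ord1 /= !G1 !mul1r bpolyS expr0 binom_pascal.
by rewrite [X in _ + X + _]binom_polyE big_ord0 fact0 invr1 !mulr1 addrAC.
Qed.

(** By induction on n both sides have the same increment, so their difference is a 1-periodic
    polynomial. It vanishes at -1, where the powers of z + 1 disappear, and therefore
    identically. *)
Lemma logcoefE n z : (0 < n)%N -> logcoefL n z = logcoefR n z.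
Proof.
elim: n z => // n IH z _.
pose P := \sum_(j < n.+1) Gpoly n.+1 j * (bpoly j \Po ('X + 1%:P)) -
  (binom_poly R n.+1 \Po ('X + 1%:P) + \sum_(j < n.+1) (bcoef j.+1 * j`!%:R) *: Gpoly n.+1 j).
have PE w : P.[w] = logcoefL n.+1 w - logcoefR n.+1 w.
  rewrite hornerD hornerN hornerD horner_comp hornerD hornerX hornerC !horner_sum; congr (_ - (_ + _)).
    by apply: eq_bigr => j _; rewrite hornerM GpolyE horner_comp !hornerE.
  by apply: eq_bigr => j _; rewrite hornerZ GpolyE.
clearbody P; have PS w : P.[w + 1] = P.[w].
  rewrite !PE; case: n IH {PE} => [|n] IH.
    by have [-> ->] := logcoef1_S w; ring.
  by rewrite logcoefL_S // logcoefR_S // IH //; ring.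
(* The shift turns the zeros -1, 0, 1, ... of P into the natural numbers. *)
have P0 : P \Po ('X - 1%:P) = 0.
  apply: poly_nat_zero => k; rewrite horner_comp !hornerE.
  elim: k => [|k IHk]; first by rewrite sub0r PE logcoef_m1 // subrr.
  by rewrite -natr1 addrAC PS.
have : (P \Po ('X - 1%:P)).[z + 1] = 0 by rewrite P0 horner0.
by rewrite horner_comp !hornerE addrK PE => /eqP; rewrite subr_eq0 => /eqP.
Qed.

End LogCoefficient.

(** * Assembling the expansion *)

Section Expansion.
Context {R : realType}.
Implicit Types (z u a : R[i]).

(** The part of [zterm] free of the logarithm. *)
Definition zpow (j r : nat) a : R[i] := a ^ (j.+1%:Z - r%:Z) * (zcoef j r).2.

Definition zsum (n r : nat) z := \sum_(j < n) Gcoef n j z * zpow j r (z + 1).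

Lemma cderiv_clog_quot a u : a != 0 -> slit (u / a) ->
  cderiv (fun w => clog (w / a)) u u^-1.
Proof.
move=> a0 su; have u0 : u != 0.
  by apply/eqP => u0; have := slit_neq0 su; rewrite u0 mul0r eqxx.
have D := cderivZ a^-1 (cderiv_id u).
have -> : (fun w => clog (w / a)) = (fun w => clog (a^-1 * w)).
  by apply/funext => w; rewrite mulrC.
have su' : slit (a^-1 * u) by rewrite mulrC.
have := cderiv_comp D (cderiv_clog su'); congr cderiv.
by field; rewrite ?a0 ?u0.
Qed.

(** Since -t = z - (z + t), binom(-t, n-1) is the sum of the G_(n,j)(z) (z + t)^j, so the
    differentiated function is a combination of terms [zterm] for the branch w -> log(w/(z+1)). That
    branch is 0 at t = 1, which leaves the log-free parts; this is why [zterm] takes the branch as a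
    parameter. *)
Lemma Fterm_zsum n r z : (0 < n)%N -> z + 1 != 0 -> Fterm n r z = zsum n r.+1 z.
Proof.
move=> n0 a0; set a := z + 1; pose L w := clog (w / a).
pose f (t : R[i]) := (binom_poly R n.-1).[- t] * clog ((z + t) / (z + 1)).
have na : 0 < nm a by rewrite nm_gt0.
have sl w : nm (w - 1) < nm a -> slit ((z + w) / a).
  move=> h; rewrite (_ : (z + w) / a = 1 + (w - 1) / a); last by rewrite /a; field.
  rewrite /slit cReD /=; apply/orP; left.
  have : nm ((w - 1) / a) < 1 by rewrite nmM nmV ltr_pdivrMr // mul1r.
  by have := Re_nm ((w - 1) / a); rewrite ler_norml => /andP[h1 _] h2; lra.
have H k w : nm (w - 1) < nm a ->
    derive1n k f w = \sum_(j < n) Gcoef n j z * zterm L j k.+1 (z + w).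
  elim: k w => [|k IH] w hw.
    rewrite derive1n0 /f.
    have -> : - w = z - (z + w) by ring.
    rewrite -sum_Gcoef // mulr_suml; apply: eq_bigr => j _.
    by rewrite zterm1 mulrA.
  rewrite derive1nS; apply: cderiv_derive1.
  have d0 : 0 < nm a - nm (w - 1) by lra.
  apply: (@cderiv_near R (fun v => \sum_(j < n) Gcoef n j z * zterm L j k.+1 (z + v)) _ w _ _ d0).
    move=> v hv; rewrite IH //; have := nm_dist w v 1; lra.
  apply: cderiv_sum => j _; apply: cderivZ.
  have sw := sl w hw.
  have zw : z + w != 0.
    by apply/eqP => e; have := slit_neq0 sw; rewrite e mul0r eqxx.
  have D : cderiv L (z + w) (z + w)^-1 := cderiv_clog_quot a0 sw.
  by apply/cderiv_shift; exact: cderiv_zterm.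
rewrite /Fterm -/f (H r 1); last by rewrite subrr nm0.
apply: eq_bigr => j _; congr (_ * _); rewrite /zterm /zpow -/a /L divff // clog1 mulr0 add0r.
by [].
Qed.

Lemma sum_even (V : nmodType) (F : nat -> V) m : (forall r, odd r -> F r = 0) ->
  \sum_(r < m.*2) F r = \sum_(r < m) F r.*2.
Proof.
move=> F0; elim: m => [|m IH]; first by rewrite !big_ord0.
by rewrite doubleS !big_ord_recr /= IH (F0 m.*2.+1) ?addr0 //= odd_double.
Qed.

(** The derivative u^j log u has no log-free part; hence B_1 contributes only to the coefficient of
    the logarithm. *)
Lemma zsum1 n z : zsum n 1 z = 0.
Proof.
apply: big1 => j _; rewrite /zpow /= subr0.
have -> : (j.+1)%:~R * - (j.+1%:R^-1) ^+ 2 + j.+1%:R^-1 = 0 :> R[i].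
  by rewrite -pmulrn; field; rewrite nat1r pnatr_eq0.
by rewrite !mulr0.
Qed.

Lemma zsum0 n z : zsum n 0 z = - \sum_(j < n) Gcoef n j z * ((z + 1) ^+ j.+1 / j.+1%:R ^+ 2).
Proof.
rewrite /zsum -sumrN; apply: eq_bigr => j _; rewrite /zpow /= subr0 -exprnP exprVn.
by rewrite !mulrN.
Qed.

Lemma bcoef0 : bcoef 0 = 1 :> R[i].
Proof.
have E := @bernoulli_rec R 1; rewrite big_ord1 in E.
have -> : bcoef 0 = bcoef 0 / (1 - 0)`!%:R :> R[i] by rewrite subn0 divr1.
exact: E.
 Qed.

Lemma zmain_split N n z : (0 < n)%N -> (n <= N)%N -> z + 1 != 0 ->
  \sum_(j < n) Gcoef n j z * zmain N j (z + 1) =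
    logcoefR n z * clog (z + 1) + \sum_(r < N.+1) bcoef r * zsum n r z.
Proof.
move=> n0 nN a0; rewrite -logcoefE // mulr_suml.
have -> : \sum_(r < N.+1) bcoef r * zsum n r z
  = \sum_(j < n) Gcoef n j z * \sum_(r < N.+1) bcoef r * zpow j r (z + 1).
  under eq_bigr => r _ do rewrite mulr_sumr.
  rewrite exchange_big; apply: eq_bigr => j _ /=.
  by rewrite mulr_sumr; apply: eq_bigr => r _; rewrite mulrCA.
rewrite -big_split /=; apply: eq_bigr => j _.
rewrite (@bpoly_zcoef R N) //; last exact: leq_trans nN.
rewrite -mulrA -mulrDr mulr_suml -big_split /=; congr (_ * _); apply: eq_bigr => r _.
by rewrite /zterm /zpow; ring.
Qed.

Lemma binom_deriv_Gcoef n j z : binom_deriv n j z = j`!%:R * Gcoef n j z.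
Proof.
by rewrite /binom_deriv Gcoef_nderiv nderivn_def hornerMn -mulr_natl mulrCA.
Qed.

Lemma logcoefR_E n z : logcoefR n z = (binom_poly R n).[z + 1] +
  \sum_(1 <= r < n.+1) (bernoulli_num R r / r`!%:R)%:C * binom_deriv n r.-1 z.
Proof.
rewrite /logcoefR; congr (_ + _).
rewrite big_add1 /= big_mkord; apply: eq_bigr => j _.
by rewrite binom_deriv_Gcoef mulrA.
Qed.

(** With r = j + 1 the factor in front of (z + 1)^r - 1 is G_(n,j)(z)/(j+1)^2, so the constants
    1/(j+1)^2 cancel and the term of order 0 of Euler-Maclaurin remains. Here w j stands for
    zeta'(-j). *)
Lemma sum_binom_deriv n z (w : nat -> R[i]) :
  \sum_(1 <= r < n.+1) binom_deriv n r.-1 z * (r`!%:R * r%:R)^-1 * ((z + 1) ^+ r - 1)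
  + \sum_(0 <= j < n) Gcoef n j z * (w j + (j.+1%:R ^+ 2)^-1)
  = \sum_(j < n) Gcoef n j z * w j - zsum n 0 z.
Proof.
rewrite big_add1 /= !big_mkord zsum0 opprK -!big_split /=; apply: eq_bigr => j _.
rewrite binom_deriv_Gcoef factS natrM.
have f0 : j`!%:R != 0 :> R[i] by rewrite pnatr_eq0 -lt0n fact_gt0.
have k0 : j.+1%:R != 0 :> R[i] by rewrite pnatr_eq0.
by field; rewrite nat1r k0 f0.
Qed.

Lemma Gcoef_bound n j : (j < n)%N -> exists2 C : R, 0 <= C &
  forall z, 1 <= nm z -> nm (Gcoef n j z) <= C * nm z ^+ (n.-1 - j).
Proof.
move=> jn; have n0 : (0 < n)%N by apply: leq_trans jn.
have s : (size (@Gpoly R n j) <= (n.-1 - j).+1)%N.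
  by apply: leq_trans (size_Gpoly j n0) _; rewrite -subSn ?prednK //; lia.
have [C C0 H] := horner_bound s.
by exists C => // z /H; rewrite GpolyE.
Qed.

Lemma pow_ratio (x : R) (p q : nat) (m : int) :
  1 <= x -> p%:Z - q%:Z <= m -> x ^+ p / x ^+ q <= x ^ m.
Proof.
move=> x1 pq; have x0 : x != 0 by rewrite gt_eqF //; lra.
have -> : x ^+ p / x ^+ q = x ^ (p%:Z - q%:Z) by rewrite expfzDr // exprnN.
exact: ler_weXz2l.
Qed.

Lemma sum_bound (D : R[i] -> Prop) (X : R[i] -> R) (n : nat) (F : nat -> R[i] -> R[i]) :
  (forall j, (j < n)%N -> exists K : R, forall z, D z -> nm (F j z) <= K * X z) ->
  exists K : R, forall z, D z -> nm (\sum_(j < n) F j z) <= K * X z.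
Proof.
elim: n => [|n IH] H.
  by exists 0 => z _; rewrite big_ord0 nm0 mul0r.
have [K HK] := IH (fun j jn => H j (ltnW jn)); have [K' HK'] := H n (ltnSn n).
exists (K + K') => z Dz; rewrite big_ord_recr mulrDl.
exact: le_trans (nmD _ _) (lerD (HK z Dz) (HK' z Dz)).
Qed.

(** What Euler-Maclaurin of order N = 2M + 3 yields beyond the truncated expansion. The term in
    B_(2M+2) has size |z|^(n-1-j) |z|^(j-2M-1), exactly the allowed order; the one with [zrem] is
    smaller by one more power of |z|. *)
Lemma remainder_bound (delta : R) n M j : 0 < delta < pi -> (n < 2 * M)%N -> (j < n)%N ->
  exists K : R, forall z, sector delta z /\ 1 <= nm z ->
    nm (Gcoef n j z * (bcoef (2 * M).+2 * zpow j (2 * M).+2 (z + 1)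
                       + zrem (2 * M).+3 j (z + 1)))
      <= K * nm z ^ (n%:Z - (2 * M)%:Z - 2).
Proof.
move=> hd nM jn; set m : int := n%:Z - (2 * M)%:Z - 2.
have m1 : (n.-1 - j)%:Z - ((2 * M).+1 - j)%:Z <= m by rewrite /m; lia.
have m2 : (n.-1 - j)%:Z - ((2 * M).+3 - j).-1%:Z <= m by rewrite /m; lia.
have [C C0 HC] := Gcoef_bound jn.
have [kap k0 Hk] := sector_nm hd.
have jN : (j.+1 < (2 * M).+3)%N by lia.
have [K K0 HK] := zrem_sector jN k0.
pose q := ((2 * M).+1 - j)%N; rewrite /zpow.
have e1 a : a ^ (j.+1%:Z - (2 * M).+2%:Z) = a ^- q.
  by rewrite exprnN; congr (_ ^ _); rewrite /q -subzn; lia.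
move: (bcoef _) (zcoef _ _).2 => b c; pose B := nm b * nm c / kap ^+ q.
have B0 : 0 <= B by rewrite /B !mulr_ge0 ?nm_ge0 ?invr_ge0 ?exprn_ge0 // ltW.
exists (C * B + C * K) => z [hz z1].
have z0 : 0 < nm z by lra.
have sl := sector_slit hd hz.
have az : kap * nm z <= nm (z + 1).
  have := Hk z hz 1 ler01; rewrite rmorph1; apply: le_trans.
  by rewrite ler_wpM2l ?(ltW k0) //; lra.
have az0 : 0 < kap * nm z by rewrite mulr_gt0.
have h1 : nm (b * ((z + 1) ^ (j.+1%:Z - (2 * M).+2%:Z) * c)) <= B / nm z ^+ q.
  rewrite e1 !nmM nmV nmX.
  have -> : nm b * ((nm (z + 1) ^+ q)^-1 * nm c) = nm b * nm c * (nm (z + 1) ^+ q)^-1 by ring.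
  have -> : B / nm z ^+ q = nm b * nm c * ((kap * nm z) ^+ q)^-1.
    by rewrite /B exprMn invfM mulrA.
  apply: ler_wpM2l; first exact: mulr_ge0 (nm_ge0 _) (nm_ge0 _).
  rewrite lef_pV2 ?posrE ?exprn_gt0 //; last exact: lt_le_trans az.
  exact: lerXn2r (ltW az0) (nm_ge0 _) az.
have h2 : nm (zrem (2 * M).+3 j (z + 1)) <= K / nm z ^+ ((2 * M).+3 - j).-1.
  apply: HK => // s s0.
  have -> : z + 1 + s%:C = z + (1 + s)%:C by rewrite rmorphD rmorph1 addrA.
  apply: le_trans (Hk z hz (1 + s) _); last by lra.
  by rewrite ler_wpM2l ?(ltW k0) //; lra.
have p1 : nm z ^+ (n.-1 - j) / nm z ^+ q <= nm z ^ m.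
  by apply: pow_ratio.
have p2 : nm z ^+ (n.-1 - j) / nm z ^+ ((2 * M).+3 - j).-1 <= nm z ^ m.
  by apply: pow_ratio.
rewrite nmM; apply: le_trans (ler_pM (nm_ge0 _) (nm_ge0 _) (HC z z1) (nmD _ _)) _.
rewrite mulrDr mulrDl; apply: lerD.
  apply: le_trans (ler_wpM2l _ h1) _; first by rewrite mulr_ge0 // exprn_ge0 // ltW.
  by rewrite mulrACA ler_wpM2l // mulr_ge0.
apply: le_trans (ler_wpM2l _ h2) _; first by rewrite mulr_ge0 // exprn_ge0 // ltW.
by rewrite mulrACA ler_wpM2l // mulr_ge0.
Qed.

(** Odd indices drop out, index 1 by [zsum1] and the others by the vanishing of B_r; of the even
    ones, the first and the last are split off. An odd order N makes the number N + 1 of terms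
    even. *)
Lemma bernoulli_sum M n z : (0 < n)%N -> z + 1 != 0 ->
  \sum_(r < (2 * M).+4) bcoef r * zsum n r z = zsum n 0 z
    + \sum_(1 <= r < M.+1) bcoef (2 * r) * Fterm n (2 * r).-1 z
    + bcoef (2 * M).+2 * zsum n (2 * M).+2 z.
Proof.
move=> n0 a0; have -> : (2 * M).+4 = M.+2.*2 by lia.
rewrite (sum_even (F := fun r => bcoef r * zsum n r z)) => [|[|[|r]] // ro].
- rewrite big_ord_recr big_ord_recl /= bcoef0 mul1r; congr (_ + _ + _).
    rewrite big_add1 big_mkord; apply: eq_bigr => r _.
    by rewrite Fterm_zsum // prednK ?muln_gt0 // mul2n.
  by rewrite doubleS mul2n.
- by rewrite zsum1 mulr0.
- by rewrite /bcoef bernoulli_odd // mul0r rmorph0 mul0r.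
Qed.

End Expansion.

Theorem theorem3 (R : realType)
  (G : nat -> R[i] -> R[i]) (HG : multiple_gamma G)
  (zeta : R[i] -> R[i]) (Hzeta : riemann_zeta zeta)
  (n : nat) (Hn : (1 <= n)%N)
  (logG : R[i] -> R[i]) (HlogG : log_shift_branch (G n) logG)
  (delta : R) (Hdelta : 0 < delta < pi)
  (M : nat) (HM : (n < 2 * M)%N) :
  exists K rho : R, forall z : R[i], sector delta z -> rho%:C <= `|z| ->
    `| logG z -
       ( ((binom_poly R n).[z + 1]
          + \sum_(1 <= r < n.+1)
              (bernoulli_num R r / r`!%:R)%:C * binom_deriv n r.-1 z)
           * clog (z + 1)
         - \sum_(1 <= r < n.+1)
             binom_deriv n r.-1 z * (r`!%:R * r%:R)^-1 * ((z + 1) ^+ r - 1)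
         - \sum_(0 <= j < n)
             Gcoef n j z * (derive1 zeta (- j%:R) + (j.+1%:R ^+ 2)^-1)
         + \sum_(1 <= r < M.+1)
             (bernoulli_num R (2 * r) / (2 * r)`!%:R)%:C
               * Fterm n (2 * r).-1 z ) |
      <= K%:C * `|z| ^ (n%:Z - (2 * M)%:Z - 2).
Proof.
have [K HK] := sum_bound (fun j (jn : (j < n)%N) => remainder_bound Hdelta HM jn).
exists K, 1 => z hz z1.
have z1' : 1 <= nm z by move: z1; rewrite nmE -[1%:C]/(real_complex R 1) lecR.
have sl := sector_slit Hdelta hz.
have nN : (n < (2 * M).+3)%N by lia.
have := HK z (conj hz z1'); rewrite -lecR => H.
rewrite (_ : K%:C * `|z| ^ _ = (K * nm z ^ (n%:Z - (2 * M)%:Z - 2))%:C); last first.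
  by rewrite nmE [RHS]rmorphM [in RHS]fmorphXz.
apply: le_trans H; rewrite nmE lecR le_eqVlt; apply/orP; left; apply/eqP; congr nm.
have a0 := slit_neq0 sl.
(* The difference to be bounded equals the quantity estimated in [H], so an exact identity remains
   to be checked; the values Z_j(1) enter through [zeta_derive]. *)
have EL : logG z = logcoefR n z * clog (z + 1)
    + \sum_(r < (2 * M).+4) bcoef r * zsum n r z
    + \sum_(j < n) Gcoef n j z * zrem (2 * M).+3 j (z + 1)
    - \sum_(j < n) Gcoef n j z * derive1 zeta (- j%:R).
  rewrite (branch_Lam HG Hn HlogG nN sl) -zmain_split ?(ltnW nN) // -big_split -sumrB.
  apply: eq_bigr => j _ /=; have jN : (j.+2 < (2 * M).+3)%N by have := ltn_ord j; lia.
  by rewrite (zeta_derive jN Hzeta) -mulrDr -mulrBr.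
have EB := sum_binom_deriv n z (fun j => derive1 zeta (- j%:R)).
rewrite EL (bernoulli_sum M Hn a0) -logcoefR_E -/(bcoef _).
have -> : \sum_(j < n) Gcoef n j z * (bcoef (2 * M).+2 * zpow j (2 * M).+2 (z + 1)
      + zrem (2 * M).+3 j (z + 1))
  = bcoef (2 * M).+2 * zsum n (2 * M).+2 z
    + \sum_(j < n) Gcoef n j z * zrem (2 * M).+3 j (z + 1).
  rewrite mulr_sumr -big_split; apply: eq_bigr => j _ /=.
  by rewrite mulrDr [X in X + _]mulrCA.
(* Adding and subtracting the zeta sum produces the left-hand side of [EB]. *)
rewrite -[X in _ - X - _ + _](addrK (\sum_(0 <= j < n) Gcoef n j z * (derive1 zeta (- j%:R) + (j.+1%:R ^+ 2)^-1))).
rewrite EB.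
move: (logcoefR n z) (clog (z + 1)) (zsum n 0 z) (zsum n (2 * M).+2 z) (bcoef (2 * M).+2) => l c s t b.
rewrite /bcoef; set F := \sum_(1 <= r < M.+1) _; set Z := \sum_(0 <= j < n) _.
set W := \sum_(j < n) _; set D := \sum_(j < n) _.
by clearbody F Z W D; ring.
Qed.
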